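(* Let $N\ge 1$, $k\ge 1$, $q\in(0,1)$, $a_1,\dots,a_N>0$, and $\mathsf R,\mathsf L\ge 0$ not both zero. Let $\mathbf x(t)=(x_1(t)>\dots>x_N(t))$, $t\ge0$, be the $N$-particle $q$-PushASEP with these parameters, started from the step initial condition $x_i(0)=-i$, $i=1,\dots,N$. Then for every $\mathbf n=(n_1,\dots,n_k)\in\mathbb Z^k$ with $N\ge n_1\ge n_2\ge\dots\ge n_k\ge 0$ and every $t\ge 0$, $$\mathbb E\Big(\prod_{i=1}^{k}q^{x_{n_i}(t)+n_i}\Big)=\frac{(-1)^{k}q^{k(k-1)/2}}{(2\pi \mathbf i)^{k}}\oint\cdots\oint\ \prod_{1\le A<B\le k}\frac{z_A-z_B}{z_A-qz_B}\ \prod_{j=1}^{k}\Big(\prod_{i=1}^{n_j}\frac{a_i}{a_i-z_j}\Big)\frac{\Pi_t(qz_j)}{\Pi_t(z_j)}\frac{dz_j}{z_j},$$ where $\Pi_t(z):=e^{t(\mathsf R z+\mathsf L z^{-1})}$, $\mathbf i=\sqrt{-1}$, and for each $A=1,\dots,k$ the (positively oriented closed) integration contour for $z_A$ contains in its interior $a_1,\dots,a_N$ and all of the contours $\{q z_B\}_{B>A}$ (the images under multiplication by $q$ of the contours of $z_B$, $B>A$), but does not contain zero.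
   Context: The $N$-particle $q$-PushASEP is the continuous-time Markov process on the state space $X^N$ of configurations $\mathbf x=(x_1>x_2>\dots>x_N)$, $x_i\in\mathbb Z$, with two virtual particles $x_0=+\infty$, $x_{N+1}=-\infty$. Write $\mathrm{gap}_i:=x_{i-1}-x_i-1$, and use the convention $q^{+\infty}=0$ (so $q^{x_0}=0$; thus the product $\prod_i q^{x_{n_i}+n_i}$ is $0$ if some $n_i=0$). The dynamics are: (Right jumps) Each particle $x_i$, $1\le i\le N$, independently jumps to the right by one at rate $a_i\mathsf R(1-q^{\mathrm{gap}_i})$. (Left jumps) Each particle $x_i$, $1\le i\le N$, independently jumps to the left by one at rate $a_i^{-1}\mathsf L$. Whenever a particle $x_j$ has moved to the left by one (by its own jump or due to a push), it instantaneously pushes its left neighbor $x_{j+1}$ to the left by one with probability $q^{\mathrm{gap}_{j+1}}$ (the gap before the move); if $x_{j+1}$ is pushed it may in turn push $x_{j+2}$ by the same rule, and so on. Equivalently, the Markov generator acts on $f:X^N\to\mathbb R$ by $$(\mathscr L f)(\mathbf x)=\sum_{i=1}^{N}\mathsf R a_i(1-q^{x_{i-1}-x_i-1})(f(\mathbf x_i^+)-f(\mathbf x))+\sum_{i=1}^N \mathsf L a_i^{-1}\sum_{j=i}^{N}q^{x_i-x_j-(j-i)}(1-q^{x_j-x_{j+1}-1})(f(\mathbf x^-_{j,i})-f(\mathbf x)),$$ where $\mathbf x_i^+$ is $\mathbf x$ with $x_i$ replaced by $x_i+1$, and $\mathbf x^-_{j,i}$ is $\mathbf x$ with $x_m$ replaced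 by $x_m-1$ for all $m=i,i+1,\dots,j$ (terms whose new configuration is not strictly ordered have zero coefficient). *)

(* Defs.v *)
From HB Require Import structures.
From mathcomp Require Import all_boot all_order all_algebra.
From mathcomp Require Import all_classical all_reals all_analysis.
From mathcomp Require Import complex.

Set Implicit Arguments.
Unset Strict Implicit.
Unset Printing Implicit Defensive.

Import Order.TTheory GRing.Theory Num.Theory numFieldNormedType.Exports.

Local Open Scope classical_set_scope.
Local Open Scope ring_scope.

(* The ordinal i : 'I_N stands for the particle of index i.+1, so that
   x ord0 is the position of the rightmost particle. *)
Record config (N : nat) := Config {
  positions :> {ffun 'I_N -> int};
  _ : [forall i : 'I_N, forall j : 'I_N, (i < j)%N ==> (positions j < positions i)] }.

HB.instance Definition _ N := [isSub for @positions N].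
HB.instance Definition _ N := [Countable of config N by <:].

Lemma step_subproof N : let x := [ffun i : 'I_N => - (i.+1)%:Z] in
  [forall i : 'I_N, forall j : 'I_N, (i < j)%N ==> (x j < x i)].
Proof.
by apply/forallP => i; apply/forallP => j; apply/implyP => ij;
  rewrite !ffunE ltrN2 ltz_nat ltnS.
Qed.

Definition step N : config N := Config (step_subproof N).

HB.instance Definition _ N := isPointed.Build (config N) (step N).

HB.instance Definition _ N := @isMeasurable.Build default_measure_display
  (config N) discrete_measurable discrete_measurable0
  discrete_measurableC discrete_measurableU.

(* Position of the particle of index m, indices starting from 1, with the
   virtual particles at +oo (m = 0) and -oo (m = N + 1). *)
Definition particle N (x : config N) (m : nat) : \bar int :=
  if m is m'.+1 then
    (if insub m' is Some i then (x i)%:E else -oo%E)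
  else +oo%E.

(* q ^ +oo = 0; the value at -oo is never used. *)
Definition qpow (R : realType) (q : R) (e : \bar int) : R :=
  if e is r%:E then q ^ r else 0.

(* gap x m = x_(m-1) - x_m - 1, for 1 <= m <= N + 1. *)
Definition gap N (x : config N) (m : nat) : \bar int :=
  (particle x m.-1 - particle x m - 1%:E)%E.

(* When the new positions are not strictly ordered, the move is replaced by x;
   it then has rate zero in the generator. *)
Definition right_move N (x : config N) (i : 'I_N) : config N :=
  insubd x [ffun m => if m == i then x m + 1 else x m].

Definition left_move N (x : config N) (i j : 'I_N) : config N :=
  insubd x [ffun m : 'I_N => if (i <= m <= j)%N then x m - 1 else x m].

Definition qPushASEP_generator (R : realType) N (q : R) (a : 'I_N -> R)
    (rR rL : R) (f : config N -> R) (x : config N) : R :=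
  \sum_(i < N) rR * a i * (1 - qpow q (gap x i.+1)) *
    (f (right_move x i) - f x) +
  \sum_(i < N) rL * (a i)^-1 *
    \sum_(j < N | (i <= j)%N)
      q ^ (x i - x j - (j%:Z - i%:Z)) * (1 - qpow q (gap x j.+2)) *
      (f (left_move x i j) - f x).

Section markov_process.
Context (R : realType) (dS : measure_display) (S : measurableType dS).

Definition markov_semigroup (K : R -> R.-pker S ~> S) : Prop :=
  (forall x A, measurable A -> K 0 x A = \d_x A) /\
  (forall s t x A, 0 <= s -> 0 <= t -> measurable A ->
     K (s + t) x A = (\int[K s x]_y K t y A)%E).

(* L f is the derivative at time 0, in the sup norm, of t |-> K t f, for every
   bounded measurable f.  This is the right notion only for a generator L which
   is bounded on bounded functions (here all jump rates are bounded). *)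
Definition semigroup_generator (K : R -> R.-pker S ~> S)
    (L : (S -> R) -> S -> R) : Prop :=
  forall f : S -> R, measurable_fun setT f -> bounded_fun f ->
  forall e : R, 0 < e -> \forall h \near (0 : R)^'+, forall x : S,
    `| ((\int[K h x]_y f y) - f x) / h - L f x | <= e.

Context (d : measure_display) (T : measurableType d) (P : probability T R).

Definition history (X : R -> {mfun T >-> S}) (s : R) : set (set T) :=
  <<s [set A | exists u B, [/\ 0 <= u <= s, measurable B & A = X u @^-1` B]] >>.

Definition markov_property (X : R -> {mfun T >-> S})
    (K : R -> R.-pker S ~> S) : Prop :=
  forall s t A B, 0 <= s -> 0 <= t -> history X s A -> measurable B ->
    P (A `&` X (s + t) @^-1` B) = (\int[P]_(w in A) K t (X s w) B)%E.

(* Right-continuous paths with left limits, S being seen as discrete. *)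
Definition jump_paths (X : R -> {mfun T >-> S}) : Prop :=
  {ae P, forall w, forall t, 0 <= t ->
    (\forall u \near t^'+, X u w = X t w) /\
    (0 < t -> exists y, \forall u \near t^'-, X u w = y)}.

Definition markov_jump_process (L : (S -> R) -> S -> R) (x0 : S)
    (X : R -> {mfun T >-> S}) : Prop :=
  [/\ {ae P, forall w, X 0 w = x0},
      jump_paths X &
      exists K : R -> R.-pker S ~> S,
        [/\ markov_semigroup K, semigroup_generator K L &
            markov_property X K]].

End markov_process.

Section contours.
Context (R : realType).
Local Open Scope complex_scope.

(* The topology of R[i] is the one of the alias R[i]^o. *)
Implicit Types (g : R -> R[i]^o) (f : R[i] -> R[i]).

Definition cexp (z : R[i]) : R[i] :=
  (expR (complex.Re z))%:C * (cos (complex.Im z) +i* sin (complex.Im z)).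

Definition cderivable g (s : R) : Prop :=
  derivable (fun u => complex.Re (g u)) s 1 /\
  derivable (fun u => complex.Im (g u)) s 1.

Definition cderive g : R -> R[i]^o := fun s =>
  derive1 (fun u => complex.Re (g u)) s +i* derive1 (fun u => complex.Im (g u)) s.

(* C^1 on [0, 1] except at finitely many points, where the derivative has
   one-sided limits. *)
Definition piecewise_C1 g : Prop :=
  [/\ {within `[0, 1], continuous g},
      exists s : seq R, forall u, 0 < u < 1 -> u \notin s ->
        cderivable g u /\ {for u, continuous (cderive g)},
      forall u, 0 <= u < 1 -> cvg (cderive g v @[v --> u^'+]) &
      forall u, 0 < u <= 1 -> cvg (cderive g v @[v --> u^'-])].

Definition trace g : set R[i]^o := g @` `[0, 1].

Definition contour_integral g f : R[i] :=
  let h s := f (g s) * cderive g s in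
  (\int[lebesgue_measure]_(s in `[0, 1]) complex.Re (h s)) +i*
  (\int[lebesgue_measure]_(s in `[0, 1]) complex.Im (h s)).

Definition winding_number g (w : R[i]) : R[i] :=
  (2%:R * pi%:C * 'i%C)^-1 * contour_integral g (fun z => (z - w)^-1).

(* The bounded components of the complement. *)
Definition contour_interior g : set R[i]^o :=
  [set z | ~ trace g z /\
           bounded_set (connected_component (~` trace g) z)].

(* Positively oriented piecewise C^1 Jordan curve. *)
Definition contour g : Prop :=
  [/\ piecewise_C1 g,
      g 0 = g 1,
      forall s u, 0 <= s < 1 -> 0 <= u < 1 -> g s = g u -> s = u &
      forall w, contour_interior g w -> winding_number g w = 1].

Definition vcons k (z0 : R[i]) (z : 'I_k -> R[i]) : 'I_k.+1 -> R[i] :=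
  fun i => if unlift ord0 i is Some j then z j else z0.

(* The variable of index 0 is integrated last. *)
Fixpoint iterated_contour_integral k :
    ('I_k -> R -> R[i]^o) -> (('I_k -> R[i]) -> R[i]) -> R[i] :=
  match k with
  | 0 => fun _ F => F (fun _ => 0)
  | k'.+1 => fun gs F =>
      contour_integral (gs ord0) (fun z0 =>
        iterated_contour_integral (fun i => gs (lift ord0 i))
          (fun z => F (vcons z0 z)))
  end.

(* g A is the contour of the variable z_A. *)
Definition nested_contours N k (q : R) (a : 'I_N -> R)
    (g : 'I_k -> R -> R[i]^o) : Prop :=
  [/\ forall A, contour (g A),
      forall A i, contour_interior (g A) (a i)%:C,
      forall A B : 'I_k, (A < B)%N ->
        forall z, trace (g B) z -> contour_interior (g A) (q%:C * z) &
      forall A, ~ (trace (g A) `|` contour_interior (g A)) 0].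

Definition Pi_ (rR rL t : R) (z : R[i]) : R[i] :=
  cexp (t%:C * (rR%:C * z + rL%:C * z^-1)).

End contours.

(* Main.v *)
Require Import Defs.
From mathcomp Require Import all_boot all_order all_algebra all_fingroup finmap.
From mathcomp Require Import all_classical all_reals all_analysis.
From mathcomp Require Import complex measurable_realfun.
From mathcomp Require Import ring lra zify.
Set Implicit Arguments.
Unset Strict Implicit.
Unset Printing Implicit Defensive.
Import Order.TTheory GRing.Theory Num.Theory numFieldNormedType.Exports.
Import ComplexField.
Local Open Scope classical_set_scope.
Local Open Scope ring_scope.
Local Open Scope complex_scope.

(** Write [u_v = q ^ (x_v + v)], with [u_0 = 0], so that the expectation is that of the
    monomial [f_n = u_(n_1) ... u_(n_k)].  The theorem is a duality: both sides, as
    functions of [t] and of the weakly decreasing [n], solve the same finite system of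
    linear equations [d/dt h(n) = dual h n], with the same initial value.

    For the process, each allowed move multiplies [f_n] by a power of [q], so the generator
    applied to [f_n] is [f_n] times an explicit function of the [u_v].  A summation by
    parts in the left jumps ([dual_prod]) recombines it into a combination of monomials
    [f_m] of the same degree, which defines [dual] ([generator_observable]).

    For the contour integrals, the derivative in [t] multiplies the integrand by
    [sum_l rR (q - 1) z_l + rL (q^-1 - 1) / z_l].  Lowering an index [n_l = v] to [v - 1]
    multiplies the integrand by [1 - z_l / a_v].  When [n_l = n_(l+1)] the factor
    [z_l - q z_(l+1)] cancels the only pole which keeps the two contours apart, and the
    integrand becomes antisymmetric ([moment_integral_boundary]); hence [z_l] may be
    replaced by [q z_(l+1)], and everything reduces to the last variable of each group of
    equal indices.  When [n_k = 0] the innermost contour encloses no pole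
    ([moment_integral_eq0]).  These three facts give the same operator [dual]
    ([dual_integral]).  At [t = 0] the contours are removed one by one, the outermost
    first, through the residues at [0] and at infinity ([moment_integral_step]).

    Integration along a contour is used only as a bounded linear functional on the
    functions which are bounded and uniformly continuous on its trace.  Such functionals
    satisfy Fubini's theorem ([fubini_functional]); since they kill polynomials and
    multiple poles, their values on rational functions follow from those on simple poles,
    that is, from winding numbers ([functional_rational]).  This takes the place of
    Cauchy's theorem.

    The two solutions are compared along Euler's scheme with mesh [t / m].  The integrals
    with [(1 + (t / m) w)^j] in place of the exponential satisfy the scheme exactly and
    converge ([euler_step], [euler_limit]).  The expectations satisfy it with an error of
    smaller order, by the definition of the generator ([mean_step]).  As that definition
    concerns bounded functions only, the monomials are cut off where [V = u_N ^ k] exceeds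
    a level [A]; the error comes from the moves across this level, is bounded through
    [min(V, A)^2], whose expectation grows at most exponentially uniformly in [A], and is
    of order [A^-1] ([mean_scheme]).  Monotone convergence removes the cut-off
    ([cutoff_integral]). *)

Notation cnorm := Normc.normc.

(** * The real modulus of a complex number *)

Section cnorm_theory.
Context (R : realType).
Implicit Types x y z : R[i].

Lemma cnorm_normE z : `|z| = (cnorm z)%:C.
Proof. by rewrite normc_def; case: z. Qed.

Lemma cnorm_ge0 z : 0 <= cnorm z.
Proof. by case: z => a b /=; exact: sqrtr_ge0. Qed.

Lemma cnormD x y : cnorm (x + y) <= cnorm x + cnorm y.
Proof. exact: le_normcD. Qed.

Lemma cnormN x : cnorm (- x) = cnorm x.
Proof. exact: normcN. Qed.

Lemma cnormB x y : cnorm (x - y) = cnorm (y - x).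
Proof. by rewrite -cnormN opprB. Qed.

Lemma cnorm_distD y x z : cnorm (x - z) <= cnorm (x - y) + cnorm (y - z).
Proof. by rewrite (le_trans _ (cnormD _ _))// addrA subrK. Qed.

Lemma cnormM x y : cnorm (x * y) = cnorm x * cnorm y.
Proof. exact: Normc.normcM. Qed.

Lemma cnormV x : cnorm x^-1 = (cnorm x)^-1.
Proof. exact: Normc.normcV. Qed.

Lemma cnormX x n : cnorm (x ^+ n) = cnorm x ^+ n.
Proof.
by elim: n => [|n IH]; rewrite ?expr0 ?Normc.normc1// !exprS cnormM IH.
Qed.

Lemma cnormR (x : R) : cnorm x%:C = `|x|.
Proof. by rewrite /= expr0n/= addr0 sqrtr_sqr. Qed.

Lemma cnorm0 : cnorm (0 : R[i]) = 0. Proof. exact: Normc.normc0. Qed.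

Lemma cnorm1 : cnorm (1 : R[i]) = 1. Proof. exact: Normc.normc1. Qed.

Lemma cnorm_eq0 z : (cnorm z == 0) = (z == 0).
Proof.
by apply/eqP/eqP => [/Normc.eq0_normc//|->]; exact: cnorm0.
Qed.

Lemma cnorm_gt0 z : (0 < cnorm z) = (z != 0).
Proof. by rewrite lt_neqAle cnorm_ge0 andbT eq_sym cnorm_eq0. Qed.

Lemma cnorm_sum (I : Type) (s : seq I) (P : pred I) (F : I -> R[i]) :
  cnorm (\sum_(i <- s | P i) F i) <= \sum_(i <- s | P i) cnorm (F i).
Proof.
elim/big_ind2 : _ => [|x1 x2 y1 y2 h1 h2|//]; first by rewrite cnorm0.
by rewrite (le_trans (cnormD _ _))// lerD.
Qed.

Lemma cnorm_Re z : `|complex.Re z| <= cnorm z.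
Proof. by rewrite -lecR (le_trans (normc_ge_Re z))// cnorm_normE. Qed.

Lemma cnorm_Im z : `|complex.Im z| <= cnorm z.
Proof.
case: z => a b /=; rewrite -[leLHS]sqrtr_sqr ler_wsqrtr//.
by rewrite lerDr sqr_ge0.
Qed.

Lemma cnorm_ReIm z : cnorm z <= `|complex.Re z| + `|complex.Im z|.
Proof.
rewrite [z in leLHS]complexE (le_trans (cnormD _ _))// cnormM !cnormR lerD2l.
by rewrite (_ : cnorm 'i = 1) ?mul1r//= expr0n/= expr1n add0r sqrtr1.
Qed.

Lemma cnorm_le_eps z (B : R) :
  (forall e, 0 < e -> cnorm z <= B * e) -> z = 0.
Proof.
move=> h; apply/eqP; rewrite -cnorm_eq0 eq_le cnorm_ge0 andbT.
apply/ler_addgt0Pl => e e0; rewrite addr0.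
have B1 : 0 < `|B| + 1 by rewrite ltr_wpDl.
have := h (e / (`|B| + 1)) (divr_gt0 e0 B1) => /le_trans; apply.
rewrite mulrA ler_pdivrMr// mulrC ler_pM2l//.
by rewrite (le_trans (ler_norm _))// lerDl.
Qed.

End cnorm_theory.

(** * Bounded functionals and Fubini's theorem *)

Section good_functions.
Context (R : realType).
Local Notation C := (R[i]).

(** The distance [d] is any real function: products of planes are given the sum of the
    moduli of the coordinate differences, without a topology on functions. *)
Definition unif_cont (T : Type) (d : T -> T -> R) (K : set T) (f : T -> C) :=
  forall e, 0 < e -> exists2 r, 0 < r &
    forall x y, K x -> K y -> d x y < r -> cnorm (f x - f y) <= e.

Definition bounded_on (T : Type) (K : set T) (f : T -> C) :=
  exists B, forall x, K x -> cnorm (f x) <= B.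

Definition good (T : Type) (d : T -> T -> R) (K : set T) (f : T -> C) :=
  unif_cont d K f /\ bounded_on K f.

Definition cdist (z w : C) : R := cnorm (z - w).
Definition ffdist k (z w : 'I_k -> C) : R := \sum_(i < k) cnorm (z i - w i).
Definition pdist (T1 T2 : Type) (d1 : T1 -> T1 -> R) (d2 : T2 -> T2 -> R)
  (p p' : T1 * T2) : R := d1 p.1 p'.1 + d2 p.2 p'.2.

Section closure.
Context (T : Type) (d : T -> T -> R) (K : set T).
Local Notation good := (good d K).

Lemma bounded_on_pos f : bounded_on K f ->
  exists2 B, 0 < B & forall x, K x -> cnorm (f x) <= B.
Proof.
case=> B hB; exists (`|B| + 1); first by rewrite ltr_wpDl.
by move=> x /hB /le_trans; apply; rewrite (le_trans (ler_norm _))// lerDl.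
Qed.

Lemma good_ext f g : (forall x, K x -> f x = g x) -> good f -> good g.
Proof.
move=> fg [uf [B hB]]; split; last by exists B => x Kx; rewrite -fg//; exact: hB.
move=> e /uf[r r0 h]; exists r => // x y Kx Ky xy.
by rewrite -!fg//; exact: h.
Qed.

Lemma good_cst c : good (fun=> c).
Proof.
split; last by exists (cnorm c).
by move=> e e0; exists 1 => // x y *; rewrite subrr cnorm0 ltW.
Qed.

Lemma good_add f g : good f -> good g -> good (fun x => f x + g x).
Proof.
move=> [uf [B hB]] [ug [B' hB']]; split; last first.
  by exists (B + B') => x Kx; rewrite (le_trans (cnormD _ _))// lerD// ?hB ?hB'.
move=> e e0; have e2 : 0 < e / 2 by rewrite divr_gt0.
have [r r0 hr] := uf _ e2; have [r' r'0 hr'] := ug _ e2.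
exists (Num.min r r'); first by rewrite lt_min r0.
move=> x y Kx Ky; rewrite lt_min => /andP[h1 h2].
rewrite opprD addrACA (le_trans (cnormD _ _))// [e]splitr lerD//.
- exact: hr.
- exact: hr'.
Qed.

Lemma good_mul f g : good f -> good g -> good (fun x => f x * g x).
Proof.
move=> [uf /bounded_on_pos[B B0 hB]] [ug /bounded_on_pos[B' B'0 hB']].
split; last first.
  by exists (B * B') => x Kx; rewrite cnormM ler_pM// ?cnorm_ge0 ?hB ?hB'.
move=> e e0.
have [r r0 hr] := uf (e / 2 / B') ltac:(by rewrite !divr_gt0).
have [r' r'0 hr'] := ug (e / 2 / B) ltac:(by rewrite !divr_gt0).
exists (Num.min r r'); first by rewrite lt_min r0.
move=> x y Kx Ky; rewrite lt_min => /andP[h1 h2].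
have -> : f x * g x - f y * g y = f x * (g x - g y) + (f x - f y) * g y.
  by rewrite mulrBr mulrBl addrA subrK.
rewrite (le_trans (cnormD _ _))// [e]splitr !cnormM lerD//.
- rewrite (le_trans (ler_pM _ _ (hB x Kx) (hr' x y Kx Ky h2))) ?cnorm_ge0//.
  by rewrite mulrC divfK// gt_eqF.
- rewrite (le_trans (ler_pM _ _ (hr x y Kx Ky h1) (hB' y Ky))) ?cnorm_ge0//.
  by rewrite divfK// gt_eqF.
Qed.

Lemma good_scale c f : good f -> good (fun x => c * f x).
Proof. by move=> gf; apply: good_mul => //; exact: good_cst. Qed.

Lemma good_opp f : good f -> good (fun x => - f x).
Proof.
by move=> gf; apply: good_ext (good_scale (-1) gf) => x _; rewrite mulN1r.
Qed.

Lemma good_sub f g : good f -> good g -> good (fun x => f x - g x).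
Proof. by move=> gf gg; apply: good_add => //; exact: good_opp. Qed.

Lemma good_inv f c : 0 < c -> (forall x, K x -> c <= cnorm (f x)) ->
  good f -> good (fun x => (f x)^-1).
Proof.
move=> c0 hc [uf _]; split; last first.
  exists c^-1 => x Kx; rewrite cnormV lef_pV2 ?posrE ?hc//.
  by rewrite (lt_le_trans c0)// hc.
move=> e e0; have [r r0 hr] := uf (e * (c * c)) ltac:(by rewrite !mulr_gt0).
exists r => // x y Kx Ky xy.
have fx : 0 < cnorm (f x) by rewrite (lt_le_trans c0)// hc.
have fy : 0 < cnorm (f y) by rewrite (lt_le_trans c0)// hc.
have -> : (f x)^-1 - (f y)^-1 = (f y - f x) / (f x * f y).
  have := fx; have := fy; rewrite !cnorm_gt0 => fy0 fx0.
  by field; rewrite fx0 fy0.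
rewrite cnormM cnormV cnormM ler_pdivrMr ?mulr_gt0//.
rewrite cnormB (le_trans (hr _ _ Kx Ky xy))// ler_pM2l//.
by rewrite ler_pM ?hc// ltW.
Qed.

Lemma good_sum (I : Type) (s : seq I) (P : pred I) (f : I -> T -> C) :
  (forall i, P i -> good (f i)) -> good (fun x => \sum_(i <- s | P i) f i x).
Proof.
move=> h; elim: s => [|i s IH].
  by apply: good_ext (good_cst 0) => x _; rewrite big_nil.
case Pi : (P i).
  by apply: good_ext (good_add (h _ Pi) IH) => x _; rewrite big_cons Pi.
by apply: good_ext IH => x _; rewrite big_cons Pi.
Qed.

Lemma good_prod (I : Type) (s : seq I) (P : pred I) (f : I -> T -> C) :
  (forall i, P i -> good (f i)) -> good (fun x => \prod_(i <- s | P i) f i x).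
Proof.
move=> h; elim: s => [|i s IH].
  by apply: good_ext (good_cst 1) => x _; rewrite big_nil.
case Pi : (P i).
  by apply: good_ext (good_mul (h _ Pi) IH) => x _; rewrite big_cons Pi.
by apply: good_ext IH => x _; rewrite big_cons Pi.
Qed.

Lemma good_exp f n : good f -> good (fun x => f x ^+ n).
Proof.
move=> gf; elim: n => [|n IH]; first exact: good_cst.
by apply: good_ext (good_mul gf IH) => x _; rewrite exprS.
Qed.

End closure.

Lemma good_comp (T T' : Type) d d' (K : set T) (K' : set T') (h : T -> T') f :
  (forall x, K x -> K' (h x)) ->
  (forall x y, K x -> K y -> d' (h x) (h y) <= d x y) ->
  good d' K' f -> good d K (fun x => f (h x)).
Proof.
move=> Kh dh [uf [B hB]]; split; last by exists B => x /Kh /hB.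
move=> e /uf[r r0 hr]; exists r => // x y Kx Ky xy.
by apply: hr; rewrite ?(le_lt_trans (dh _ _ _ _) xy)//; exact: Kh.
Qed.

Lemma good_sub_set T (d : T -> T -> R) (K K' : set T) f :
  K `<=` K' -> good d K' f -> good d K f.
Proof. by move=> KK'; exact: (@good_comp T T d d K K' id). Qed.

Lemma good_id K : (exists B, forall z, K z -> cnorm z <= B) -> good cdist K id.
Proof.
by move=> bK; split => // e e0; exists e => // x y _ _ /ltW.
Qed.

(** Contour integrals and their differences enter only through these properties.  By
    [functional_ext] a value depends on the restriction to [K] alone, so that the
    integrand may be singular, or have a junk value, off the contours. *)
Record functional (T : Type) (d : T -> T -> R) (K : set T)
    (J : (T -> C) -> C) : Prop := Functional {
  functional_ext : forall f g, (forall x, K x -> f x = g x) -> J f = J g;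
  functional_lin : forall c f g, good d K f -> good d K g ->
    J (fun x => c * f x + g x) = c * J f + J g;
  functional_bnd : exists2 V, 0 <= V & forall f B, 0 <= B -> good d K f ->
    (forall x, K x -> cnorm (f x) <= B) -> cnorm (J f) <= V * B }.

Section functional_theory.
Context (T : Type) (d : T -> T -> R) (K : set T) (J : (T -> C) -> C).
Hypothesis hJ : functional d K J.

Lemma functional_cst0 : J (fun=> 0) = 0.
Proof.
have /= := functional_lin hJ 1 (good_cst d K 0) (good_cst d K 0).
rewrite (@functional_ext _ _ _ _ hJ _ (fun=> 0)); last first.
  by move=> x _; rewrite mulr0 addr0.
by rewrite mul1r => /esym /(congr1 (fun z => z - J (fun=> 0))); rewrite addrK subrr.
Qed.

Lemma functional_eq0 f : (forall x, K x -> f x = 0) -> J f = 0.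
Proof. by move=> h; rewrite (functional_ext hJ h) functional_cst0. Qed.

Lemma functionalZ c f : good d K f -> J (fun x => c * f x) = c * J f.
Proof.
move=> gf; rewrite -[RHS]addr0 -functional_cst0 -(functional_lin hJ)//; last exact: good_cst.
by congr J; apply/funext => x; rewrite addr0.
Qed.

Lemma functionalD f g : good d K f -> good d K g ->
  J (fun x => f x + g x) = J f + J g.
Proof.
move=> gf gg; rewrite -[J f]mul1r -(functional_lin hJ)//.
by congr J; apply/funext => x; rewrite mul1r.
Qed.

Lemma functionalB f g : good d K f -> good d K g ->
  J (fun x => f x - g x) = J f - J g.
Proof.
move=> gf gg; rewrite addrC -mulN1r -(functional_lin hJ)//.
by congr J; apply/funext => x; rewrite mulN1r addrC.
Qed.

Lemma functional_sum (I : Type) (s : seq I) (f : I -> T -> C) :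
  (forall i, good d K (f i)) ->
  J (fun x => \sum_(i <- s) f i x) = \sum_(i <- s) J (f i).
Proof.
move=> gf; elim: s => [|i s IH].
  by rewrite big_nil; apply: functional_eq0 => x _; rewrite big_nil.
rewrite big_cons -IH -functionalD//; last by apply: good_sum => j _.
by congr J; apply/funext => x; rewrite big_cons.
Qed.

Lemma functional_sub_set (K' : set T) : K `<=` K' -> functional d K' J.
Proof.
move=> KK'; split.
- by move=> f g fg; apply: (functional_ext hJ) => x /KK'/fg.
- by move=> c f g gf gg; apply: (functional_lin hJ); exact: good_sub_set KK' _.
- have [V V0 hV] := functional_bnd hJ; exists V => // f B B0 gf hf.
  by apply: hV => //; [exact: good_sub_set KK' _|move=> x /KK'/hf].
Qed.

End functional_theory.

Lemma functional_zero T (d : T -> T -> R) K : functional d K (fun=> 0).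
Proof.
split => //; first by move=> *; rewrite mulr0 addr0.
by exists 0 => // f B B0 _ _; rewrite cnorm0 mul0r.
Qed.

Lemma functional_sub T (d : T -> T -> R) K J J' :
  functional d K J -> functional d K J' ->
  functional d K (fun f => J f - J' f).
Proof.
move=> h h'; split.
- by move=> f g fg; rewrite (functional_ext h fg) (functional_ext h' fg).
- move=> c f g gf gg; rewrite (functional_lin h)// (functional_lin h')//; ring.
- have [V V0 hV] := functional_bnd h; have [V' V'0 hV'] := functional_bnd h'.
  exists (V + V'); first exact: addr_ge0.
  move=> f B B0 gf hf; rewrite (le_trans (cnormD _ _))// cnormN mulrDl.
  by rewrite lerD// ?hV ?hV'.
Qed.

Section fubini.
Context (T1 T2 : Type) (d1 : T1 -> T1 -> R) (d2 : T2 -> T2 -> R).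
Context (K1 : set T1) (K2 : set T2).
Hypotheses (d1_xx : forall x, d1 x x = 0) (d2_xx : forall x, d2 x x = 0).
Context (F : T1 -> T2 -> C).
Hypothesis gF : good (pdist d1 d2) (K1 `*` K2) (fun p => F p.1 p.2).

Lemma good_slice1 y : K2 y -> good d1 K1 (F ^~ y).
Proof.
move=> Ky; apply: (good_comp (h := fun x => (x, y)) _ _ gF) => //=.
by move=> x x' _ _; rewrite /pdist/= d2_xx addr0.
Qed.

Lemma good_slice2 x : K1 x -> good d2 K2 (F x).
Proof.
move=> Kx; apply: (good_comp (h := fun y => (x, y)) _ _ gF) => //=.
by move=> y y' _ _; rewrite /pdist/= d1_xx add0r.
Qed.

Lemma good_functional (I : (T2 -> C) -> C) :
  functional d2 K2 I -> good d1 K1 (fun x => I (F x)).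
Proof.
move=> hI; have [V V0 hV] := functional_bnd hI.
case: (gF) => uF /bounded_on_pos[B B0 hB]; split; last first.
  exists (V * B) => x Kx; apply: hV => [||y Ky]; first exact: ltW.
    exact: good_slice2.
  exact: (hB (x, y)).
move=> e e0; have V1 : 0 < V + 1 by rewrite ltr_wpDl.
have [r r0 hr] := uF (e / (V + 1)) (divr_gt0 e0 V1).
exists r => // x x' Kx Kx' xx'.
have e'0 : 0 <= e / (V + 1) by rewrite divr_ge0// ltW.
rewrite -(functionalB hI) ?(le_trans (hV _ (e / (V + 1)) e'0 _ _))//.
- by apply: good_sub; exact: good_slice2.
- by move=> y Ky; apply: (hr (x, y) (x', y)) => //=; rewrite /pdist/= d2_xx addr0.
- by rewrite mulrCA ler_piMr ?(ltW e0)// ler_pdivrMr// mul1r lerDl.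
- exact: good_slice2.
- exact: good_slice2.
Qed.
End fubini.

Definition totally_bounded (K : set C) :=
  forall r, 0 < r -> exists n (p : 'I_n -> C),
    (forall i, K (p i)) /\ forall z, K z -> exists i, cnorm (z - p i) < r.

Lemma max0_lip (a b : R) : `|Num.max 0 a - Num.max 0 b| <= `|a - b|.
Proof.
rewrite /Num.max; case: ltP => a0; case: ltP => b0; rewrite ?subrr ?normr0//.
- by rewrite subr0 gtr0_norm// (le_trans _ (ler_norm _))//; lra.
- by rewrite sub0r normrN gtr0_norm// distrC (le_trans _ (ler_norm _))//; lra.
Qed.

(** The tents around the points of a net; normalized, they form the partition of unity of
    [fubini_functional]. *)
Lemma good_hat (K : set C) r p :
  good cdist K (fun z => (Num.max 0 (r - cnorm (z - p)))%:C).
Proof.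
split; last first.
  exists `|r| => z _; rewrite cnormR ger0_norm ?le_max ?lexx// ge_max normr_ge0/=.
  by rewrite (le_trans _ (ler_norm _))// lerBlDr lerDl cnorm_ge0.
move=> e e0; exists e => // z w _ _ /ltW zw.
rewrite -rmorphB cnormR (le_trans (max0_lip _ _))// (le_trans _ zw)//.
rewrite ler_norml.
have h1 := cnorm_distD w z p; have h2 := cnorm_distD z w p.
have h3 := cnormB z w; rewrite /cdist; apply/andP; split; lra.
Qed.

(** A partition of unity subordinate to a fine net of [K1] approximates [F] uniformly by
    finite sums of products of functions of one variable, on which the two functionals
    commute by linearity; boundedness passes to the limit. *)
Lemma fubini_functional (T2 : Type) (d2 : T2 -> T2 -> R)
    (K1 : set C) (K2 : set T2) (J : (C -> C) -> C) (I : (T2 -> C) -> C)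
    (F : C -> T2 -> C) :
  (forall y, d2 y y = 0) -> totally_bounded K1 ->
  functional cdist K1 J -> functional d2 K2 I ->
  good (pdist cdist d2) (K1 `*` K2) (fun p => F p.1 p.2) ->
  J (fun x => I (F x)) = I (fun y => J (F ^~ y)).
Proof.
move=> d2_xx tK hJ hI gF.
have d1_xx (x : C) : cdist x x = 0 by rewrite /cdist subrr cnorm0.
have [V V0 hV] := functional_bnd hJ; have [V' V'0 hV'] := functional_bnd hI.
have gF1 := good_slice1 d2_xx gF; have gF2 := good_slice2 d1_xx gF.
have gIF : good cdist K1 (fun x => I (F x)) by exact: (good_functional (F := F) d1_xx d2_xx gF hI).
have gF' : good (pdist d2 cdist) (K2 `*` K1) (fun p => F p.2 p.1).
  apply: (good_comp (h := fun p => (p.2, p.1)) _ _ gF) => [[y x] [/=]//|].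
  by move=> [y x] [y' x'] _ _; rewrite /pdist/= addrC.
have gJF : good d2 K2 (fun y => J (F ^~ y)).
  exact: (good_functional (F := fun y x => F x y) d2_xx d1_xx gF' hJ).
apply/eqP; rewrite -subr_eq0; apply/eqP/(@cnorm_le_eps _ _ (V * V' + V' * V)) => e e0.
have e0' := ltW e0.
have [r r0 hr] := gF.1 e e0.
have [n [p [Kp hp]]] := tK (r / 2) (divr_gt0 r0 (ltr0n _ 2)).
pose u i z := Num.max 0 (r - cnorm (z - p i)).
have u_ge0 i z : 0 <= u i z by rewrite /u le_max lexx.
pose U z := \sum_(i < n) u i z.
have Ur z : K1 z -> r / 2 <= U z.
  move=> /hp[i hi]; rewrite /U (bigD1 i)//= ler_wpDr ?sumr_ge0//.
  by rewrite /u le_max; apply/orP; right; lra.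
have U0 z : K1 z -> 0 < U z by move=> /Ur; apply: lt_le_trans; rewrite divr_gt0.
have gU : good cdist K1 (fun z => (U z)%:C).
  apply: good_ext (good_sum (P := xpredT) (index_enum 'I_n) (f := fun i z => (u i z)%:C) _).
    by move=> z _; rewrite rmorph_sum.
  by move=> i _; exact: good_hat.
pose f i z : C := (u i z)%:C / (U z)%:C.
have gf i : good cdist K1 (f i).
  apply: good_mul; first exact: good_hat.
  apply: (good_inv (c := r / 2)) gU; first by rewrite divr_gt0.
  by move=> z Kz; rewrite cnormR ger0_norm ?Ur// ltW// U0.
have f1 z : K1 z -> \sum_i f i z = 1.
  move=> Kz; rewrite -mulr_suml -rmorph_sum/= divff//.
  by apply/eqP => -[/eqP]; rewrite gt_eqF// U0.
have nf z : K1 z -> \sum_i cnorm (f i z) = 1.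
  move=> Kz; rewrite -(divff (lt0r_neq0 (U0 _ Kz))) mulr_suml.
  by apply: eq_bigr => i _; rewrite cnormM cnormV !cnormR !ger0_norm// ltW// U0.
(* [f] is the partition of unity, [p] the net: [G] interpolates [F] from the net. *)
pose G z y := \sum_i f i z * F (p i) y.
have FG z y : K1 z -> K2 y -> cnorm (F z y - G z y) <= e.
  move=> Kz Ky; rewrite -[F z y]mul1r -(f1 _ Kz) mulr_suml -sumrB.
  rewrite (le_trans (cnorm_sum _ _ _))// -[e]mul1r -(nf _ Kz) mulr_suml ler_sum//.
  move=> i _; rewrite -mulrBr cnormM.
  have [zr|zr] := ltP (cnorm (z - p i)) r.
    rewrite ler_wpM2l ?cnorm_ge0//; apply: (hr (z, y) (p i, y)) => //=.
    by rewrite /pdist/= d2_xx addr0.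
  by rewrite /f /u max_l ?subr_le0// mul0r cnorm0 !mul0r.
pose S := \sum_i J (f i) * I (F (p i)).
have h1 : cnorm (J (fun x => I (F x)) - S) <= V * (V' * e).
  have -> : S = J (fun x => \sum_i I (F (p i)) * f i x).
    rewrite (functional_sum hJ) => [|i]; last exact: good_scale.
    by apply: eq_bigr => i _; rewrite (functionalZ hJ)// mulrC.
  have gs : good cdist K1 (fun x => \sum_i I (F (p i)) * f i x).
    by apply: good_sum => i _; exact: good_scale.
  rewrite -(functionalB hJ)//; apply: hV; [by rewrite mulr_ge0|exact: good_sub|].
  move=> x Kx; rewrite (_ : \sum_i _ = I (G x)); last first.
    rewrite (functional_sum hI) => [|i]; last by apply: good_scale; exact: gF2.
    by apply: eq_bigr => i _; rewrite (functionalZ hI) 1?mulrC//; exact: gF2.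
  have gG : good d2 K2 (G x) by apply: good_sum => i _; apply: good_scale; exact: gF2.
  rewrite -(functionalB hI)//; last exact: gF2.
  by apply: hV' => //; [apply: good_sub => //; exact: gF2|move=> y; exact: FG].
have h2 : cnorm (I (fun y => J (F ^~ y)) - S) <= V' * (V * e).
  have -> : S = I (fun y => \sum_i J (f i) * F (p i) y).
    rewrite (functional_sum hI) => [|i]; last by apply: good_scale; exact: gF2.
    by apply: eq_bigr => i _; rewrite (functionalZ hI)//; exact: gF2.
  have gs : good d2 K2 (fun y => \sum_i J (f i) * F (p i) y).
    by apply: good_sum => i _; apply: good_scale; exact: gF2.
  rewrite -(functionalB hI)//; apply: hV'; [by rewrite mulr_ge0|exact: good_sub|].
  move=> y Ky; rewrite (_ : \sum_i _ = J (G ^~ y)); last first.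
    rewrite /G (functional_sum hJ _ (f := fun i x => f i x * F (p i) y)) => [|i]; last first.
      by apply: good_mul => //; exact: good_cst.
    apply: eq_bigr => i _; rewrite mulrC -(functionalZ hJ)//.
    by congr J; apply/funext => x; rewrite mulrC.
  have gG : good cdist K1 (G ^~ y).
    by apply: good_sum => i _; apply: good_mul => //; exact: good_cst.
  rewrite -(functionalB hJ)//; last exact: gF1.
  by apply: hV => //; [apply: good_sub => //; exact: gF1|move=> x Kx; exact: FG].
rewrite (_ : J _ - I _ = (J (fun x => I (F x)) - S) - (I (fun y => J (F ^~ y)) - S)).
  by rewrite (le_trans (cnormD _ _))// cnormN mulrDl -!mulrA lerD.
by rewrite opprB addrA subrK.
Qed.

End good_functions.

(** * Iterated functionals *)

Section iterated_functionals.
Context (R : realType).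
Local Notation C := (R[i]).

Fixpoint iter_functional k :
    ('I_k -> (C -> C) -> C) -> (('I_k -> C) -> C) -> C :=
  match k with
  | 0 => fun _ F => F (fun _ => 0)
  | k'.+1 => fun Js F =>
      Js ord0 (fun z0 =>
        iter_functional (fun i => Js (lift ord0 i)) (fun z => F (vcons z0 z)))
  end.

(** The definition of the iterated integral is this recursion for contour integrals.
    Abstracting the functionals allows one of them to be exchanged for another. *)
Lemma iterated_contour_integralE k (g : 'I_k -> R -> R[i]^o) F :
  iterated_contour_integral g F =
  iter_functional (fun i => contour_integral (g i)) F.
Proof.
elim: k g F => [//|k IH] g F /=; congr contour_integral.
by apply/funext => z0; rewrite IH.
Qed.

Definition boxset k (Ks : 'I_k -> set C) : set ('I_k -> C) :=
  [set z | forall i, Ks i (z i)].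

Lemma vcons0 k z0 (z : 'I_k -> C) : vcons z0 z ord0 = z0.
Proof. by rewrite /vcons unlift_none. Qed.

Lemma vconsS k z0 (z : 'I_k -> C) i : vcons z0 z (lift ord0 i) = z i.
Proof. by rewrite /vcons liftK. Qed.

Lemma boxset_vcons k (Ks : 'I_k.+1 -> set C) z0 z :
  Ks ord0 z0 -> boxset (fun i => Ks (lift ord0 i)) z -> boxset Ks (vcons z0 z).
Proof. by move=> K0 Kz i; rewrite /vcons; case: unliftP => [j|] ->. Qed.

Lemma ffdist_xx k (z : 'I_k -> C) : ffdist z z = 0.
Proof. by rewrite /ffdist big1// => i _; rewrite subrr cnorm0. Qed.

Lemma cdist_xx (z : C) : cdist z z = 0.
Proof. by rewrite /cdist subrr cnorm0. Qed.

Lemma ffdist_vcons k z0 w0 (z w : 'I_k -> C) :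
  ffdist (vcons z0 z) (vcons w0 w) = pdist (@cdist R) (@ffdist R k) (z0, z) (w0, w).
Proof.
rewrite /ffdist big_ord_recl !vcons0; congr (_ + _).
by apply: eq_bigr => i _; rewrite !vconsS.
Qed.

Lemma good_vcons k (Ks : 'I_k.+1 -> set C) F :
  good (@ffdist R k.+1) (boxset Ks) F ->
  good (pdist (@cdist R) (@ffdist R k))
    (Ks ord0 `*` boxset (fun i => Ks (lift ord0 i)))
    (fun p => F (vcons p.1 p.2)).
Proof.
apply: (good_comp (h := fun p : C * ('I_k -> C) => vcons p.1 p.2)) => /=.
  by move=> [z0 z] [/= K0 Kz]; exact: boxset_vcons.
by move=> [z0 z] [w0 w] _ _; rewrite ffdist_vcons.
Qed.

Lemma iter_functionalP k (Ks : 'I_k -> set C) Js :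
  (forall i, functional (@cdist R) (Ks i) (Js i)) ->
  functional (@ffdist R k) (boxset Ks) (iter_functional Js).
Proof.
elim: k Ks Js => [|k IH] Ks Js hJ.
  have box0 z : boxset Ks z by case.
  split => //=; first by move=> f g fg; exact: fg.
  by exists 1 => // f B B0 _ h; rewrite mul1r; exact: h.
have hI := IH _ _ (fun i => hJ (lift ord0 i)).
have gs F z0 : good (@ffdist R k.+1) (boxset Ks) F -> Ks ord0 z0 ->
    good (@ffdist R k) (boxset (fun i => Ks (lift ord0 i))) (fun z => F (vcons z0 z)).
  move=> /good_vcons gF K0.
  exact: (good_slice2 (F := fun z0 z => F (vcons z0 z)) cdist_xx gF).
have gI F : good (@ffdist R k.+1) (boxset Ks) F -> good (@cdist R) (Ks ord0)
    (fun z0 => iter_functional (fun i => Js (lift ord0 i)) (fun z => F (vcons z0 z))).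
  move=> /good_vcons gF.
  exact: (good_functional (F := fun z0 z => F (vcons z0 z)) cdist_xx (@ffdist_xx k) gF hI).
split => /=.
- move=> f g fg; apply: (functional_ext (hJ ord0)) => z0 K0.
  by apply: (functional_ext hI) => z Kz; apply: fg; exact: boxset_vcons.
- move=> c f g gf gg; rewrite -(functional_lin (hJ ord0)); [|exact: gI..].
  apply: (functional_ext (hJ ord0)) => z0 K0.
  by rewrite -(functional_lin hI)//; exact: gs.
- have [V V0 hV] := functional_bnd (hJ ord0); have [V' V'0 hV'] := functional_bnd hI.
  exists (V * V'); first exact: mulr_ge0.
  move=> f B B0 gf hf; rewrite -mulrA; apply: hV; [exact: mulr_ge0|exact: gI|].
  move=> z0 K0; apply: hV' => //; first exact: gs.
  by move=> z Kz; apply: hf; exact: boxset_vcons.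
Qed.

Definition upd k (z : 'I_k -> C) i w : 'I_k -> C :=
  fun j => if j == i then w else z j.

Lemma upd_vcons0 k z0 (z : 'I_k -> C) w : upd (vcons z0 z) ord0 w = vcons w z.
Proof.
apply/funext => j; rewrite /upd /vcons; case: unliftP => [j'|] ->; last by rewrite eqxx.
by rewrite eq_sym (negPf (neq_lift _ _)).
Qed.

Lemma upd_vconsS k z0 (z : 'I_k -> C) i w :
  upd (vcons z0 z) (lift ord0 i) w = vcons z0 (upd z i w).
Proof.
apply/funext => j; rewrite /upd /vcons; case: unliftP => [j'|] ->.
  by rewrite (inj_eq lift_inj).
by rewrite (negPf (neq_lift _ _)).
Qed.

(** Fubini's theorem moves slot [i] to the innermost place, where only the slices of [F]
    matter.  This is how one contour is deformed while the other variables stay fixed. *)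
Lemma iter_functional_replace k (Ks : 'I_k -> set C) Js i J' F :
  (forall j, functional (@cdist R) (Ks j) (Js j)) ->
  functional (@cdist R) (Ks i) J' -> totally_bounded (Ks i) ->
  good (@ffdist R k) (boxset Ks) F ->
  (forall z, (forall j, j != i -> Ks j (z j)) ->
    Js i (fun w => F (upd z i w)) = J' (fun w => F (upd z i w))) ->
  iter_functional Js F =
  iter_functional (fun j => if j == i then J' else Js j) F.
Proof.
elim: k Ks Js i J' F => [|k IH] Ks Js i J' F; first by case: i.
have [i'|] := unliftP ord0 i => ->{i} hJ hJ' tb gF eqJ.
  rewrite /=; apply: (functional_ext (hJ ord0)) => z0 K0.
  rewrite (IH (fun j => Ks (lift ord0 j)) _ i' J')//.
  - apply: (good_slice2 (F := fun z0 z => F (vcons z0 z)) cdist_xx (good_vcons gF)).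
    exact: K0.
  - move=> z Kz; have := eqJ (vcons z0 z).
    rewrite (_ : (fun w => F _) = (fun w => F (vcons z0 (upd z i' w)))).
      2: by apply/funext => w; rewrite upd_vconsS.
    apply => j; case: (unliftP ord0 j) => [j'|] ->; rewrite ?vcons0 ?vconsS//.
    by rewrite (inj_eq lift_inj) => /Kz.
rewrite /=.
set I := iter_functional (fun i => Js (lift ord0 i)).
have hI : functional (@ffdist R k) (boxset (fun i => Ks (lift ord0 i))) I.
  exact: iter_functionalP.
have gF' := good_vcons gF.
rewrite (@fubini_functional _ _ _ _ _ _ I (fun z0 z => F (vcons z0 z))
  (@ffdist_xx k) tb (hJ ord0) hI gF').
rewrite (@fubini_functional _ _ _ _ _ _ I (fun z0 z => F (vcons z0 z))
  (@ffdist_xx k) tb hJ' hI gF').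
apply: (functional_ext hI) => z Kz; have := eqJ (vcons 0 z).
rewrite (_ : (fun w => F _) = (fun w => F (vcons w z))).
  2: by apply/funext => w; rewrite upd_vcons0.
apply => j; case: (unliftP ord0 j) => [j'|] ->; rewrite ?eqxx ?vconsS//.
Qed.

Lemma iter_functional_zero k (Ks : 'I_k -> set C) Js i F :
  (forall j, functional (@cdist R) (Ks j) (Js j)) ->
  iter_functional (fun j => if j == i then fun=> 0 else Js j) F = 0.
Proof.
elim: k Ks Js i F => [|k IH] Ks Js i F hJ; first by case: i.
have [i'|] := unliftP ord0 i => ->{i} /=; rewrite ?eqxx//.
apply: (functional_eq0 (hJ ord0)) => z0 K0.
rewrite -[RHS](IH (fun j => Ks (lift ord0 j)) (fun j => Js (lift ord0 j)) i'
  (fun z => F (vcons z0 z)))//.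
Qed.

Lemma iter_functional_eq0 k (Ks : 'I_k -> set C) Js i F :
  (forall j, functional (@cdist R) (Ks j) (Js j)) ->
  totally_bounded (Ks i) ->
  good (@ffdist R k) (boxset Ks) F ->
  (forall z, (forall j, j != i -> Ks j (z j)) ->
    Js i (fun w => F (upd z i w)) = 0) ->
  iter_functional Js F = 0.
Proof.
move=> hJ tb gF h.
rewrite (iter_functional_replace (J' := fun=> 0) hJ (functional_zero _ _) tb gF h).
exact: iter_functional_zero hJ.
Qed.

Lemma vcons_tperm k z0 (z : 'I_k -> C) (i j : 'I_k) :
  vcons z0 (fun l => z (tperm i j l)) =
  (fun l => vcons z0 z (tperm (lift ord0 i) (lift ord0 j) l)).
Proof.
apply/funext => l; case: (unliftP ord0 l) => [l'|] ->.
  rewrite vconsS; case: tpermP => [->|->|/eqP li /eqP lj]; rewrite ?tpermL ?tpermR ?vconsS//.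
  by rewrite tpermD ?vconsS// (inj_eq lift_inj) eq_sym.
by rewrite tpermD 1?eq_sym ?neq_lift// !vcons0.
Qed.

(** By Fubini's theorem the exchange of the two neighbouring slots does not change the
    value, while antisymmetry changes its sign. *)
Lemma iter_functional_antisym k (Ks : 'I_k -> set C) Js (i j : 'I_k) F :
  (forall j, functional (@cdist R) (Ks j) (Js j)) ->
  val j = i.+1 -> Js i = Js j -> Ks i = Ks j -> totally_bounded (Ks i) ->
  good (@ffdist R k) (boxset Ks) F ->
  (forall z, boxset Ks z -> F (fun l => z (tperm i j l)) = - F z) ->
  iter_functional Js F = 0.
Proof.
elim: k Ks Js i j F => [|k IH] Ks Js i j F; first by case: i.
move=> hJ; have [i'|] := unliftP ord0 i => ->{i}; last first.
  case: k IH Ks Js j F hJ => [|k] _ Ks Js j F hJ; first by case: j => -[].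
  move=> j1; have {j j1} -> : j = lift ord0 ord0 by exact: val_inj.
  move=> eqJ eqK tb gF aF /=; rewrite -eqJ.
  set I := iter_functional _; set K := Ks ord0 in eqK tb gF *; set J := Js ord0 in eqJ *.
  have hI : functional (@ffdist R k) (boxset (fun i => Ks (lift ord0 (lift ord0 i)))) I.
    exact: iter_functionalP.
  have hJ0 : functional (@cdist R) K J := hJ ord0.
  pose Phi z0 z1 := I (fun z => F (vcons z0 (vcons z1 z))).
  have aPhi z0 z1 : K z0 -> K z1 -> Phi z0 z1 = - Phi z1 z0.
    move=> K0 K1; rewrite -mulN1r -(functionalZ hI).
      apply: (functional_ext hI) => z Kz; rewrite mulN1r -aF.
        congr F; apply/funext => l; case: (unliftP ord0 l) => [l'|] ->; last first.
          by rewrite tpermL vcons0 vconsS vcons0.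
        rewrite vconsS; case: (unliftP ord0 l') => [l''|] ->; last first.
          by rewrite tpermR !vcons0.
        rewrite tpermD ?vconsS// ?neq_lift//.
      apply: boxset_vcons => //; apply: boxset_vcons => //.
      by rewrite -[Ks _]eqK.
    have g1 := good_slice2 (F := fun z0 z => F (vcons z0 z)) cdist_xx (good_vcons gF) K1.
    have := good_slice2 (F := fun z1 z => F (vcons _ (vcons z1 z))) cdist_xx (good_vcons g1).
    by apply; rewrite -[Ks _]eqK.
  have gPhi : good (pdist (@cdist R) (@cdist R)) (K `*` K) (fun p => Phi p.1 p.2).
    apply: (good_functional (d1 := pdist (@cdist R) (@cdist R)) (d2 := @ffdist R k)
      (F := fun p z => F (vcons p.1 (vcons p.2 z))) _ _ _ hI).
    - by move=> [x y]; rewrite /pdist/= !cdist_xx addr0.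
    - exact: ffdist_xx.
    - apply: (good_comp (h := fun p : (C * C) * ('I_k -> C) =>
        vcons p.1.1 (vcons p.1.2 p.2)) _ _ gF).
        move=> [[z0 z1] z] [[/= K0 K1] Kz]; apply: boxset_vcons => //.
        by apply: boxset_vcons => //; rewrite -[Ks _]eqK.
      by move=> [[z0 z1] z] [[w0 w1] w] _ _; rewrite ffdist_vcons /pdist/= ffdist_vcons /pdist/= addrA.
  have X : J (fun z0 => J (Phi z0)) = - J (fun z0 => J (Phi z0)).
    rewrite [LHS](fubini_functional cdist_xx tb hJ0 hJ0 gPhi).
    have gJ z0 : K z0 -> good (@cdist R) K (Phi z0).
      exact: (good_slice2 cdist_xx gPhi).
    rewrite -mulN1r -(functionalZ hJ0); last first.
      exact: (good_functional (F := Phi) cdist_xx cdist_xx gPhi hJ0).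
    apply: (functional_ext hJ0) => z1 K1; rewrite -(functionalZ hJ0); last exact: gJ.
    by apply: (functional_ext hJ0) => z0 K0; rewrite mulN1r aPhi.
  apply/eqP; rewrite -(@mulIr_eq0 _ 2%:R); last first.
    by apply/mulIf; rewrite pnatr_eq0.
  by rewrite mulr_natr mulr2n {1}[J _]X addNr.
have [j'|] := unliftP ord0 j => ->{j}; last by [].
rewrite !lift0 => -[ji] eqJ eqK tb gF aF /=; apply: (functional_eq0 (hJ ord0)) => z0 K0.
apply: (IH (fun j => Ks (lift ord0 j)) _ i' j') => //.
- exact: (good_slice2 (F := fun z0 z => F (vcons z0 z)) cdist_xx (good_vcons gF)).
- by move=> z Kz; rewrite vcons_tperm aF//; exact: boxset_vcons.
Qed.

End iterated_functionals.

(** * Functionals on rational functions *)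

Section rational_functions.
Context (R : realType).
Local Notation C := (R[i]).

(** The distance to [K] is bounded below rather than positive, as required to invert
    [z - p] among the good functions. *)
Definition far (K : set C) (p : C) :=
  exists2 c, 0 < c & forall z, K z -> c <= cnorm (z - p).

Lemma far_neq K p z : far K p -> K z -> z - p != 0.
Proof. by move=> [c c0 h] /h hz; rewrite -cnorm_gt0 (lt_le_trans c0). Qed.

Definition poles_prod (ps : seq C) (z : C) : C := \prod_(p <- ps) (z - p).

Lemma poles_prod_cat ps qs z :
  poles_prod (ps ++ qs) z = poles_prod ps z * poles_prod qs z.
Proof. exact: big_cat. Qed.

Section integration.
Context (K : set C) (J : (C -> C) -> C).
Hypothesis bK : exists B, forall z, K z -> cnorm z <= B.
Hypothesis hJ : functional (@cdist R) K J.
Hypothesis JX : forall m, J (fun z => z ^+ m) = 0.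
Hypothesis JV : forall p m, far K p -> J (fun z => ((z - p) ^+ m.+2)^-1) = 0.

Lemma good_polyX (h : {poly C}) : good (@cdist R) K (fun z => h.[z]).
Proof.
apply: good_ext (good_sum (P := xpredT) (index_enum 'I_(size h))
  (f := fun i z => h`_i * z ^+ i) _).
  by move=> z _; rewrite horner_coef.
by move=> i _; apply: good_scale; apply: good_exp; exact: good_id.
Qed.

Lemma good_subp p : good (@cdist R) K (fun z => z - p).
Proof. by apply: good_sub; [exact: good_id|exact: good_cst]. Qed.

Lemma good_poles_prodV ps : {in ps, forall p, far K p} ->
  good (@cdist R) K (fun z => (poles_prod ps z)^-1).
Proof.
elim: ps => [|p ps IH] h.
  by apply: good_ext (good_cst _ _ 1) => z _; rewrite /poles_prod big_nil invr1.
have [c c0 hc] := h p (mem_head _ _).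
apply: good_ext (good_mul (good_inv c0 hc (good_subp p)) (IH _)).
  by move=> z _; rewrite /poles_prod big_cons invfM.
by move=> p' p's; apply: h; rewrite in_cons p's orbT.
Qed.

Lemma functional_poly (h : {poly C}) : J (fun z => h.[z]) = 0.
Proof.
under eq_fun do rewrite horner_coef.
rewrite (functional_sum hJ) => [|i]; last first.
  by apply: good_scale; apply: good_exp; exact: good_id.
rewrite big1// => i _; rewrite (functionalZ hJ) ?JX ?mulr0//.
by apply: good_exp; exact: good_id.
Qed.

(** Two distinct poles are separated by partial fractions, and the two contributions cancel
    because simple poles all have the same value [c]; a single multiple pole is killed by
    [JV]. *)
Lemma functional_poles_prodV c ps : (2 <= size ps)%N ->
  {in ps, forall p, far K p /\ J (fun z => (z - p)^-1) = c} ->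
  J (fun z => (poles_prod ps z)^-1) = 0.
Proof.
have [n] := ubnP (size ps); elim: n ps => // n IH ps /ltnSE sn s2 h.
case: ps sn s2 h => [//|p [//|p1 ps]] sn _ h.
have [/allP eqp|/allPn[p' p's pp']] := boolP (all (pred1 p) (p1 :: ps)).
  have Fp : far K p by have [] := h p (mem_head _ _).
  rewrite -[RHS](JV (size ps) Fp); congr J; apply/funext => z.
  rewrite /poles_prod big_cons (eq_big_seq (fun=> z - p)); last first.
    by move=> i /eqp/eqP ->.
  by rewrite big_const_seq count_predT iter_mulr_1 -exprS.
have p'0 : p - p' != 0 by rewrite subr_eq0 eq_sym.
set qs := rem p' (p1 :: ps).
have pqs : perm_eq (p :: p1 :: ps) [:: p, p' & qs] by rewrite perm_cons perm_to_rem.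
have sqs : size [:: p, p' & qs] = (size ps).+2 by rewrite -(perm_size pqs).
have hq : {in [:: p, p' & qs], forall p, far K p /\ J (fun z => (z - p)^-1) = c}.
  by move=> x; rewrite -(perm_mem pqs); exact: h.
have h1 : {in p :: qs, forall p, far K p /\ J (fun z => (z - p)^-1) = c}.
  by move=> x; rewrite in_cons => xq; apply: hq; rewrite !in_cons; case: eqP xq => //= _ ->; rewrite orbT.
have h2 : {in p' :: qs, forall p, far K p /\ J (fun z => (z - p)^-1) = c}.
  by move=> x xq; apply: hq; rewrite in_cons xq orbT.
have E : J (fun z => (poles_prod (p :: p1 :: ps) z)^-1) =
    J (fun z => (p - p')^-1 * ((poles_prod (p :: qs) z)^-1 - (poles_prod (p' :: qs) z)^-1)).
  apply: (functional_ext hJ) => z Kz; rewrite /poles_prod (perm_big _ pqs)/= !big_cons.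
  have zp : z - p != 0 by apply: (far_neq _ Kz); apply: (h1 _ (mem_head _ _)).1.
  have zp' : z - p' != 0 by apply: (far_neq _ Kz); apply: (h2 _ (mem_head _ _)).1.
  have zq : \prod_(j <- qs) (z - j) != 0.
    rewrite prodf_seq_neq0; apply/allP => j jq /=.
    by apply: (far_neq (h1 _ _).1 Kz); rewrite in_cons jq orbT.
  by field; rewrite zp zp' zq p'0.
have g1 : good (@cdist R) K (fun z => (poles_prod (p :: qs) z)^-1).
  by apply: good_poles_prodV => x /h1[].
have g2 : good (@cdist R) K (fun z => (poles_prod (p' :: qs) z)^-1).
  by apply: good_poles_prodV => x /h2[].
rewrite E (functionalZ hJ); last exact: good_sub.
rewrite (functionalB hJ)//; case: qs {pqs E g1 g2} sqs hq h1 h2 => [|q qs] sqs hq h1 h2.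
  rewrite /poles_prod; under eq_fun do rewrite big_cons big_nil mulr1.
  under [X in _ - J X]eq_fun do rewrite big_cons big_nil mulr1.
  by rewrite (h1 _ (mem_head _ _)).2 (h2 _ (mem_head _ _)).2 subrr mulr0.
rewrite !IH// ?subrr ?mulr0//; by move: sqs sn => /= -> // [->].
Qed.

(** Partial fractions by long division: if every simple pole contributes [c],
only the leading behaviour at infinity is seen. *)
Lemma functional_rational c (h : {poly C}) ps :
  {in ps, forall p, far K p /\ J (fun z => (z - p)^-1) = c} ->
  c = 0 \/ (size h <= size ps)%N ->
  J (fun z => h.[z] / poles_prod ps z) = c * h`_(size ps).-1.
Proof.
elim: ps h => [|p ps IH] h hp hc.
  rewrite /poles_prod; under eq_fun do rewrite big_nil invr1 mulr1.
  rewrite functional_poly; case: hc => [->|]; first by rewrite mul0r.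
  by rewrite leqn0 size_poly_eq0 => /eqP ->; rewrite coef0 mulr0.
have [Fp Jp] := hp p (mem_head _ _).
have hps : {in ps, forall p, far K p /\ J (fun z => (z - p)^-1) = c}.
  by move=> x xs; apply: hp; rewrite in_cons xs orbT.
have [h1 Eh] : exists h1, h = h1 * ('X - p%:P) + (h.[p])%:P.
  have /factor_theorem[h1 E] : root (h - (h.[p])%:P) p by rewrite /root !hornerE subrr.
  by exists h1; rewrite -E subrK.
have gV s : {in s, forall p, far K p /\ J (fun z => (z - p)^-1) = c} ->
    good (@cdist R) K (fun z => (poles_prod s z)^-1).
  by move=> hs; apply: good_poles_prodV => x /hs[].
have E : J (fun z => h.[z] / poles_prod (p :: ps) z) =
    J (fun z => h.[p] * (poles_prod (p :: ps) z)^-1 + h1.[z] / poles_prod ps z).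
  apply: (functional_ext hJ) => z Kz; rewrite {1}Eh !hornerE /poles_prod !big_cons.
  have zp : z - p != 0 by exact: (far_neq _ Kz).
  have zq : \prod_(j <- ps) (z - j) != 0.
    rewrite prodf_seq_neq0; apply/allP => j jq /=.
    by apply: (far_neq _ Kz); apply: (hps _ _).1.
  by field; rewrite zp zq.
have s1 : c = 0 \/ (size h1 <= size ps)%N.
  case: hc => [|hs]; [by left|right]; have [->|h10] := eqVneq h1 0; first by rewrite size_poly0.
  have : size (h - (h.[p])%:P) = (size h1).+1.
    by rewrite {1}Eh addrK size_Mmonic ?monicXsubC// size_XsubC addn2.
  have := size_polyD h (- (h.[p])%:P); rewrite size_polyN => /leq_trans le1 E1.
  rewrite -ltnS -E1; apply: le1; rewrite geq_max hs/=.
  by rewrite (leq_trans (size_polyC_leq1 _)).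
rewrite E (functional_lin hJ); [|exact: gV|by apply: good_mul; [exact: good_polyX|exact: gV]].
rewrite IH//; case: ps IH hp hps gV E s1 {hc} => [|p' ps] IH hp hps gV E s1.
  rewrite /poles_prod; under eq_fun do rewrite big_cons big_nil mulr1.
  rewrite Jp /= mulrC.
  case: s1 => [->|]; first by rewrite !mul0r addr0.
  rewrite leqn0 size_poly_eq0 => /eqP h10.
  by rewrite h10 coef0 mulr0 addr0 Eh h10 mul0r add0r hornerC coefC.
rewrite (functional_poles_prodV (c := c))// mulr0 add0r /=.
case: s1 => [->|s1]; first by rewrite !mul0r.
rewrite [in RHS]Eh coefD coefC/= addr0 mulrBr coefB coefMX/= coefMC.
by rewrite [X in _ - X * _]nth_default// mul0r subr0.
Qed.

End integration.

(** The poles are listed with multiplicity and not required to be minimal: sums and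
    products then only concatenate the lists. *)
Definition rational_on (P : C -> Prop) (K : set C) (f : C -> C) :=
  exists (h : {poly C}) ps, (forall p, p \in ps -> P p) /\
    forall z, K z -> f z = h.[z] / poles_prod ps z.

Section rational_closure.
Context (P : C -> Prop) (K : set C).
Hypothesis PK : forall p z, P p -> K z -> z != p.

Lemma rational_ext f g : (forall z, K z -> g z = f z) ->
  rational_on P K f -> rational_on P K g.
Proof. by move=> fg [h [ps [hp E]]]; exists h, ps; split => // z Kz; rewrite fg// E. Qed.

Lemma rational_poly (h : {poly C}) : rational_on P K (fun z => h.[z]).
Proof. by exists h, [::]; split => // z _; rewrite /poles_prod big_nil divr1. Qed.

Lemma rational_cst c : rational_on P K (fun=> c).
Proof. by apply: rational_ext (rational_poly c%:P) => z _; rewrite hornerC. Qed.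

Lemma rational_id : rational_on P K id.
Proof. by apply: rational_ext (rational_poly 'X) => z _; rewrite hornerX. Qed.

Lemma rational_pole p : P p -> rational_on P K (fun z => (z - p)^-1).
Proof.
move=> Pp; exists 1, [:: p]; split; first by move=> p'; rewrite inE => /eqP ->.
by move=> z _; rewrite /poles_prod big_seq1 hornerC mul1r.
Qed.

Lemma poles_prod_neq0 ps z : (forall p, p \in ps -> P p) -> K z -> poles_prod ps z != 0.
Proof.
move=> hp Kz; rewrite /poles_prod prodf_seq_neq0; apply/allP => p /hp Pp /=.
by rewrite subr_eq0; exact: PK.
Qed.

Lemma rational_mul f g : rational_on P K f -> rational_on P K g ->
  rational_on P K (fun z => f z * g z).
Proof.
move=> [h [ps [hp E]]] [h' [ps' [hp' E']]]; exists (h * h'), (ps ++ ps'); split.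
  by move=> p; rewrite mem_cat => /orP[/hp|/hp'].
move=> z Kz; rewrite E// E'// poles_prod_cat hornerM invfM; ring.
Qed.

Lemma rational_add f g : rational_on P K f -> rational_on P K g ->
  rational_on P K (fun z => f z + g z).
Proof.
move=> [h [ps [hp E]]] [h' [ps' [hp' E']]].
pose D s := \prod_(p <- s) ('X - p%:P) : {poly C}.
have hD s z : (D s).[z] = poles_prod s z.
  by rewrite horner_prod; apply: eq_bigr => p _; rewrite !hornerE.
exists (h * D ps' + h' * D ps), (ps ++ ps'); split.
  by move=> p; rewrite mem_cat => /orP[/hp|/hp'].
move=> z Kz; rewrite E// E'// !hornerE !hD poles_prod_cat.
have := poles_prod_neq0 hp Kz; have := poles_prod_neq0 hp' Kz => h2 h1.
by field; rewrite h1 h2.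
Qed.

Lemma rational_prod (I : Type) (s : seq I) (Q : pred I) (f : I -> C -> C) :
  (forall i, Q i -> rational_on P K (f i)) ->
  rational_on P K (fun z => \prod_(i <- s | Q i) f i z).
Proof.
move=> h; elim: s => [|i s IH].
  by apply: rational_ext (rational_cst 1) => x _; rewrite big_nil.
case Pi : (Q i).
  by apply: rational_ext (rational_mul (h _ Pi) IH) => x _; rewrite big_cons Pi.
by apply: rational_ext IH => x _; rewrite big_cons Pi.
Qed.

End rational_closure.

Lemma functional_rational_on (K : set C) J (P : C -> Prop) f :
  (exists B, forall z, K z -> cnorm z <= B) ->
  functional (@cdist R) K J ->
  (forall m, J (fun z => z ^+ m) = 0) ->
  (forall p m, far K p -> J (fun z => ((z - p) ^+ m.+2)^-1) = 0) ->
  (forall p, P p -> far K p /\ J (fun z => (z - p)^-1) = 0) ->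
  rational_on P K f -> J f = 0.
Proof.
move=> bK hJ JX JV JP [h [ps [hp E]]].
rewrite (functional_ext hJ E) (functional_rational bK hJ JX JV (c := 0)) ?mul0r//.
  by move=> p /hp/JP.
by left.
Qed.

End rational_functions.

(** * Piecewise continuous functions *)

Section complex_limits.
Context (R : realType).
Local Notation C := (R[i]).
Local Notation mu := (@lebesgue_measure R).

Lemma cvgC_distP (T : Type) (F : set_system T) {FF : Filter F}
    (f : T -> C^o) (l : C^o) :
  f @ F --> l <-> forall e : R, 0 < e -> \forall x \near F, cnorm (l - f x) < e.
Proof.
split => [/cvgrPdist_lt h e e0|h].
  have := h e%:C; rewrite ltcR => /(_ e0); apply: filterS => x.
  by rewrite cnorm_normE ltcR.
apply/cvgrPdist_lt => e e0.
have [e1 Ee] : exists e1, e = e1%:C.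
  by exists (complex.Re e); case: e e0 => a b; rewrite ltcE/= => /andP[/eqP ->].
move: e0; rewrite Ee ltcR => /h; apply: filterS => x.
by rewrite cnorm_normE ltcR.
Qed.

Lemma cvg_Re (T : Type) (F : set_system T) {FF : Filter F} (f : T -> C^o) (l : C^o) :
  f @ F --> l -> (fun x => complex.Re (f x)) @ F --> complex.Re l.
Proof.
move=> /cvgC_distP h; apply/cvgrPdist_lt => e /h; apply: filterS => x.
by apply: le_lt_trans; rewrite -raddfB; exact: cnorm_Re.
Qed.

Lemma cvg_Im (T : Type) (F : set_system T) {FF : Filter F} (f : T -> C^o) (l : C^o) :
  f @ F --> l -> (fun x => complex.Im (f x)) @ F --> complex.Im l.
Proof.
move=> /cvgC_distP h; apply/cvgrPdist_lt => e /h; apply: filterS => x.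
by apply: le_lt_trans; rewrite -raddfB; exact: cnorm_Im.
Qed.

Lemma within_continuous_Re (A : set R) (f : R -> C^o) : {within A, continuous f} ->
  {within A, continuous (fun x => complex.Re (f x))}.
Proof.
move=> /subspace_continuousP cf; apply/subspace_continuousP => x Ax.
by apply: cvg_Re; exact: cf.
Qed.

Lemma within_continuous_Im (A : set R) (f : R -> C^o) : {within A, continuous f} ->
  {within A, continuous (fun x => complex.Im (f x))}.
Proof.
move=> /subspace_continuousP cf; apply/subspace_continuousP => x Ax.
by apply: cvg_Im; exact: cf.
Qed.

Lemma within_continuous_good (A : set R) (K : set C) (g : R -> C^o) (f : C -> C^o) :
  {within A, continuous g} -> (forall s, A s -> K (g s)) ->
  good (@cdist R) K f -> {within A, continuous (fun s => f (g s))}.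
Proof.
move=> /subspace_continuousP cg AK [uf _]; apply/subspace_continuousP => x Ax.
apply/cvgC_distP => e e0; have [r r0 hr] := uf (e / 2) (divr_gt0 e0 (ltr0n _ 2)).
have /cvgC_distP/(_ _ r0) := cg x Ax; rewrite !near_withinE; apply: filterS => y h Ay.
have := hr _ _ (AK _ Ax) (AK _ Ay) (h Ay) => /le_lt_trans; apply.
by rewrite ltr_pdivrMr// ltr_pMr// ltr1n.
Qed.

Lemma within_continuousMr (A : set R) (f h : R -> R) :
  {within A, continuous f} -> {within A, continuous h} ->
  {within A, continuous (fun x => f x * h x)}.
Proof. by move=> cf ch x; apply: cvgM; [exact: cf|exact: ch]. Qed.

Lemma within_continuous_bounded (f : R -> R) a b : {within `[a, b], continuous f} ->
  exists B, forall x, a <= x <= b -> `|f x| <= B.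
Proof.
move=> cf; have [ab|ba] := leP a b; last first.
  by exists 0 => x /andP[ax xb]; have := le_lt_trans (le_trans ax xb) ba; rewrite ltxx.
have [c _ hc] := EVT_max ab cf; have [d _ hd] := EVT_min ab cf.
exists (`|f c| + `|f d|) => x xab; have xi : x \in `[a, b] by rewrite in_itv.
rewrite ler_norml; apply/andP; split.
  rewrite (le_trans _ (hd x xi))// lerNl (le_trans (ler_norm _))// normrN.
  by rewrite lerDr.
by rewrite (le_trans (hc x xi))// (le_trans (ler_norm _))// lerDl.
Qed.

Lemma within_continuous_measurable (f : R -> R) a b :
  {within `[a, b], continuous f} -> measurable_fun `[a, b] f.
Proof.
move=> cf; have /integrableP[] := continuous_compact_integrable (@segment_compact _ a b) cf.
by move=> /measurable_EFinP.
Qed.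

Definition measurable_bounded (a b : R) (h : R -> R) :=
  measurable_fun `[a, b] h /\ exists B, forall x, a <= x <= b -> `|h x| <= B.

Lemma measurable_boundedW a b h : measurable_bounded a b h ->
  mu.-integrable `[a, b] (EFin \o h).
Proof.
move=> [mh [B hB]]; apply: measurable_bounded_integrable => //.
  exact: (compact_finite_measure (@segment_compact _ a b)).
exists B; split; first exact: num_real.
by move=> M BM x /=; rewrite in_itv/= => /hB /le_trans; apply; exact: ltW.
Qed.

Lemma measurable_bounded_continuous a b h : {within `[a, b], continuous h} ->
  measurable_bounded a b h.
Proof.
by move=> ch; split; [exact: within_continuous_measurable|exact: within_continuous_bounded].
Qed.

Lemma measurable_boundedM a b f h : measurable_bounded a b f ->
  measurable_bounded a b h -> measurable_bounded a b (fun x => f x * h x).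
Proof.
move=> [mf [B hB]] [mh [B' hB']]; split; first exact: measurable_funM.
exists (B * B') => x xab; rewrite normrM ler_pM// ?hB ?hB'//.
Qed.

Lemma measurable_boundedB a b f h : measurable_bounded a b f ->
  measurable_bounded a b h -> measurable_bounded a b (fun x => f x - h x).
Proof.
move=> [mf [B hB]] [mh [B' hB']]; split; first exact: measurable_funB.
by exists (B + B') => x xab; rewrite (le_trans (ler_normB _ _))// lerD// ?hB ?hB'.
Qed.

Lemma measurable_boundedD a b f h : measurable_bounded a b f ->
  measurable_bounded a b h -> measurable_bounded a b (fun x => f x + h x).
Proof.
move=> [mf [B hB]] [mh [B' hB']]; split; first exact: measurable_funD.
by exists (B + B') => x xab; rewrite (le_trans (ler_normD _ _))// lerD// ?hB ?hB'.
Qed.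

(** The values at the end points are unconstrained: one-sided limits of the derivative of a
    curve need not be its values there. *)
Lemma measurable_bounded_piece a b (h c : R -> R) : a < b ->
  {within `[a, b], continuous c} -> (forall x, a < x < b -> h x = c x) ->
  measurable_bounded a b h.
Proof.
move=> ab cc hc; split; last first.
  have [B hB] := within_continuous_bounded cc.
  exists (`|B| + `|h a| + `|h b|) => x /andP[].
  rewrite le_eqVlt => /predU1P[<- _|ax]; first by rewrite addrAC lerDr addr_ge0.
  rewrite le_eqVlt => /predU1P[->|xb]; first by rewrite lerDr addr_ge0.
  rewrite hc ?ax// -addrA (le_trans (hB x _)) ?(ltW ax) ?(ltW xb)//.
  by rewrite (le_trans (ler_norm _))// lerDl addr_ge0.
apply/measurable_fun_itv_bndo_bndcP/measurable_fun_itv_obnd_cbndP.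
apply: (eq_measurable_fun c) => [x|].
  by rewrite inE/= in_itv/= => /hc.
apply: measurable_funS (within_continuous_measurable cc) => //.
exact: subset_itv_oo_cc.
Qed.

Lemma measurable_bounded_cat a b c h : a < b -> b < c ->
  measurable_bounded a b h -> measurable_bounded b c h -> measurable_bounded a c h.
Proof.
move=> ab bc [mf [B hB]] [mh [B' hB']]; split.
  rewrite (@itv_bndbnd_setU _ _ _ (BRight b)) ?bnd_simp ?ltW//.
  apply/measurable_funU => //; split => //; exact/measurable_fun_itv_obnd_cbndP.
exists (`|B| + `|B'|) => x /andP[ax xc]; have [xb|bx] := leP x b.
  rewrite (le_trans (hB x _)) ?ax//.
  by rewrite (le_trans (ler_norm _))// lerDl.
rewrite (le_trans (hB' x _)) ?(ltW bx)//.
by rewrite (le_trans (ler_norm _))// lerDr.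
Qed.

(** The fundamental theorem of calculus applies to the continuous extension [c] of the
    derivative, which agrees with [h] in the interior. *)
Lemma Rintegral_piece a b (H h c : R -> R) : a < b ->
  {within `[a, b], continuous c} -> (forall x, a < x < b -> h x = c x) ->
  {within `[a, b], continuous H} ->
  (forall x, a < x < b -> is_derive x 1 H (h x)) ->
  \int[mu]_(x in `[a, b]) h x = H b - H a.
Proof.
move=> ab cc hc cH dH; rewrite /Rintegral.
have moo (f : R -> R) : {within `[a, b], continuous f} -> measurable_fun `]a, b[ f.
  move=> cf; apply: measurable_funS (within_continuous_measurable cf) => //.
  exact: subset_itv_oo_cc.
rewrite (@eq_integral_itv_bounded _ _ _ c)//.
- rewrite (@continuous_FTC2 _ c H a b ab cc)//; first last.
  + move=> x; rewrite in_itv/= => xab; rewrite derive1E -hc//.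
    by apply: derive_val; exact: dH.
  + have /(continuous_within_itvP _ ab)[_ Ha Hb] := cH.
    by split => // x; rewrite in_itv/= => /dH [].
- apply: (eq_measurable_fun c); last exact: moo.
  by move=> x; rewrite inE/= in_itv/= => /hc.
- exact: moo.
Qed.

Lemma Rintegral_cat a b c h : a < b -> b < c -> measurable_bounded a c h ->
  \int[mu]_(x in `[a, c]) h x =
  \int[mu]_(x in `[a, b]) h x + \int[mu]_(x in `[b, c]) h x.
Proof.
move=> ab bc mh; have ih := measurable_boundedW mh.
apply/eqP; rewrite addrC -subr_eq; apply/eqP.
rewrite Rintegral_itvB ?bnd_simp ?ltW// Rintegral_itv_obnd_cbnd//.
apply: integrableS ih => //; apply: subset_itvr; rewrite bnd_simp; exact: ltW.
Qed.

End complex_limits.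

(** * Integration along piecewise smooth curves *)

Section piecewise.
Context (R : realType).
Local Notation C := (R[i]).
Local Notation mu := (@lebesgue_measure R).
Context (g : R -> C^o).
Hypothesis hg : piecewise_C1 g.

Definition smooth_piece (a b : R) :=
  (forall x, a < x < b -> cderivable g x) /\
  exists c1 c2 : R -> R, [/\ {within `[a, b], continuous c1},
    {within `[a, b], continuous c2} &
    forall x, a < x < b -> complex.Re (cderive g x) = c1 x /\
                           complex.Im (cderive g x) = c2 x].

Lemma piece_extension (a b : R) (h : R -> R) (la lb : R) : a < b ->
  (forall x : R, a < x < b -> h y @[y --> x] --> h x) ->
  h x @[x --> a^'+] --> la -> h x @[x --> b^'-] --> lb ->
  exists2 c : R -> R, {within `[a, b], continuous c} &
    forall x, a < x < b -> h x = c x.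
Proof.
move=> ab ch hla hlb.
pose c x := if x <= a then la else if b <= x then lb else h x.
have hc x : a < x < b -> h x = c x.
  by move=> /andP[ax xb]; rewrite /c leNgt ax/= leNgt xb.
have ca : c a = la by rewrite /c lexx.
have cb : c b = lb by rewrite /c leNgt ab/= lexx.
exists c => //; apply/continuous_within_itvP => //; split.
- move=> x; rewrite in_itv/= => xab; rewrite /continuous_at -hc//.
  apply: cvg_trans (ch x xab); apply: near_eq_cvg.
  have := @near_in_itvoo R a b x; rewrite in_itv/= => /(_ xab); apply: filterS => y.
  by rewrite in_itv/=; exact: hc.
- rewrite ca; apply: cvg_trans hla; apply: near_eq_cvg.
  by near=> y; apply: hc; apply/andP; split; near: y; [exact: nbhs_right_gt|exact: nbhs_right_lt].
- rewrite cb; apply: cvg_trans hlb; apply: near_eq_cvg.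
  by near=> y; apply: hc; apply/andP; split; near: y; [exact: nbhs_left_gt|exact: nbhs_left_lt].
Unshelve. all: by end_near. Qed.

(** The number of exceptional points inside an interval decreases when it is cut at one of
    them; this replaces an ordered subdivision of [[0, 1]]. *)
Lemma piecewise_ind (P : R -> R -> Prop) :
  (forall a b, 0 <= a -> a < b -> b <= 1 -> smooth_piece a b -> P a b) ->
  (forall a b c, 0 <= a -> a < b -> b < c -> c <= 1 -> P a b -> P b c -> P a c) ->
  P 0 1.
Proof.
case: hg => _ [s hs] hr hl Pp Pc.
suff H n (a b : R) : (count (fun u => (a < u < b)%R) s < n)%N -> 0 <= a -> a < b -> b <= 1 -> P a b.
  exact: (H (count (fun u => 0 < u < 1) s).+1).
elim: n a b => // n IH a b; rewrite ltnS => cn a0 ab b1.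
have [/hasP[u us /andP[au ub]]|/hasPn nos] := boolP (has (fun u => a < u < b) s).
  have lt_count (p1 p2 : pred R) : subpred p1 p2 -> p2 u -> ~~ p1 u ->
      (count p1 s < count p2 s)%N.
    move=> p12 p2u p1u; rewrite -(size_filter p2 s) -(count_predC p1) !count_filter.
    rewrite -addn1 leq_add//.
      rewrite (@eq_count _ (predI p1 p2) p1)// => x /=.
      by case p1x : (p1 x) => //=; rewrite p12.
    by rewrite -has_count; apply/hasP; exists u => //=; rewrite p1u.
  have u0 : 0 <= u by rewrite ltW// (le_lt_trans a0).
  have u1 : u <= 1 by rewrite ltW// (lt_le_trans ub).
  apply: (Pc a u b) => //; apply: IH => //; apply: leq_trans cn; apply: lt_count; rewrite ?au ?ub ?ltxx//.
    by move=> x /= /andP[-> /lt_trans]; exact.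
  by move=> x /= /andP[/(lt_trans au)-> ->].
have in01 x : a < x < b -> 0 < x < 1.
  by move=> /andP[ax xb]; rewrite (le_lt_trans a0 ax) (lt_le_trans xb b1).
have nsx x : a < x < b -> x \notin s.
  by move=> xab; apply/negP => /nos; rewrite xab.
apply: Pp => //; split => [x xab|]; first exact: (hs x (in01 x xab) (nsx x xab)).1.
have cvA : cvg (cderive g v @[v --> a^'+]) by apply: hr; rewrite a0 (lt_le_trans ab).
have cvB : cvg (cderive g v @[v --> b^'-]) by apply: hl; rewrite b1 (le_lt_trans a0).
have [c1 cc1 h1] : exists2 c : R -> R, {within `[a, b], continuous c} &
    forall x, a < x < b -> complex.Re (cderive g x) = c x.
  apply: (piece_extension ab _ (cvg_Re cvA) (cvg_Re cvB)) => x xab.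
  exact: cvg_Re (hs x (in01 x xab) (nsx x xab)).2.
have [c2 cc2 h2] : exists2 c : R -> R, {within `[a, b], continuous c} &
    forall x, a < x < b -> complex.Im (cderive g x) = c x.
  apply: (piece_extension ab _ (cvg_Im cvA) (cvg_Im cvB)) => x xab.
  exact: cvg_Im (hs x (in01 x xab) (nsx x xab)).2.
by exists c1, c2; split => // x xab; split; [exact: h1|exact: h2].
Qed.

Lemma cderive_measurable_bounded :
  measurable_bounded 0 1 (fun s => complex.Re (cderive g s)) /\
  measurable_bounded 0 1 (fun s => complex.Im (cderive g s)).
Proof.
pose P a b := measurable_bounded a b (fun s => complex.Re (cderive g s)) /\
  measurable_bounded a b (fun s => complex.Im (cderive g s)).
suff : P 0 1 by []; apply: piecewise_ind => [a b a0 ab b1 [_ [c1 [c2 [cc1 cc2 h]]]]|].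
  by split; [apply: (measurable_bounded_piece ab cc1)|apply: (measurable_bounded_piece ab cc2)] => x /h[].
move=> a b c _ ab bc _ [? ?] [? ?].
by split; apply: (measurable_bounded_cat ab bc).
Qed.

Lemma trace_itv s : 0 <= s <= 1 -> trace g (g s).
Proof. by move=> s01; exists s => //=; rewrite in_itv. Qed.

Lemma curve_within : {within `[0, 1], continuous g}.
Proof. by case: hg. Qed.

Lemma within_good_curve f : good (@cdist R) (trace g) f ->
  {within `[0, 1], continuous (fun s => complex.Re (f (g s)))} /\
  {within `[0, 1], continuous (fun s => complex.Im (f (g s)))}.
Proof.
move=> gf; have cf := @within_continuous_good R `[0, 1] (trace g) g f curve_within _ gf.
have {}cf : {within `[0, 1], continuous (fun s => f (g s) : C^o)}.
  by apply: cf => s s01; exact: trace_itv.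
by split; [exact: within_continuous_Re cf|exact: within_continuous_Im cf].
Qed.

Lemma complexReD (x y : C) : complex.Re (x + y) = complex.Re x + complex.Re y.
Proof. by case: x y => [a b] [c d]. Qed.

Lemma complexImD (x y : C) : complex.Im (x + y) = complex.Im x + complex.Im y.
Proof. by case: x y => [a b] [c d]. Qed.

Lemma complexReN (x : C) : complex.Re (- x) = - complex.Re x.
Proof. by case: x. Qed.

Lemma complexImN (x : C) : complex.Im (- x) = - complex.Im x.
Proof. by case: x. Qed.

Lemma complexReM (x y : C) :
  complex.Re (x * y) = complex.Re x * complex.Re y - complex.Im x * complex.Im y.
Proof. by case: x y => [a b] [c d]. Qed.

Lemma complexImM (x y : C) :
  complex.Im (x * y) = complex.Re x * complex.Im y + complex.Im x * complex.Re y.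
Proof. by case: x y => [a b] [c d]. Qed.

Lemma integrand_measurable_bounded f : good (@cdist R) (trace g) f ->
  measurable_bounded 0 1 (fun s => complex.Re (f (g s) * cderive g s)) /\
  measurable_bounded 0 1 (fun s => complex.Im (f (g s) * cderive g s)).
Proof.
move=> /within_good_curve[/measurable_bounded_continuous m1 /measurable_bounded_continuous m2].
have [d1 d2] := cderive_measurable_bounded.
split; under eq_fun do rewrite (complexReM, complexImM).
- by apply: measurable_boundedB; exact: measurable_boundedM.
- by apply: measurable_boundedD; exact: measurable_boundedM.
Qed.

Lemma Rintegral_bound h (B : R) : measurable_bounded 0 1 h ->
  (forall s, 0 <= s <= 1 -> `|h s| <= B) -> `|\int[mu]_(s in `[0, 1]) h s| <= B.
Proof.
move=> mh hB; have ih := measurable_boundedW mh.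
rewrite (le_trans (le_normr_Rintegral _ ih))//.
have mc : mu.-integrable `[0, 1] (EFin \o cst B).
  apply: measurable_boundedW; apply: measurable_bounded_continuous.
  by move=> x; exact: cvg_cst.
rewrite (le_trans (@le_Rintegral _ _ _ mu _ _ (cst B) _ _ mc _))//.
  exact: (integrable_norm ih).
rewrite Rintegral_cst// (_ : fine _ = 1) ?mulr1//.
by rewrite [X in fine X](_ : _ = 1%E)//= lebesgue_measure_itv/= lte01 sube0.
Qed.

Lemma contour_integral_functional :
  functional (@cdist R) (trace g) (contour_integral g).
Proof.
split.
- move=> f f' ff'; rewrite /contour_integral.
  have E s : s \in `[0%R, 1%R]%classic -> f (g s) = f' (g s).
    by rewrite inE/= in_itv/= => s01; apply: ff'; exact: trace_itv.
  by congr (_ +i* _); apply: eq_Rintegral => s /E ->.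
- move=> c f f' gf gf'.
  have [m1 m2] := integrand_measurable_bounded gf.
  have [m1' m2'] := integrand_measurable_bounded gf'.
  have mc k : measurable_bounded 0 1 (fun=> k : R).
    by apply: measurable_bounded_continuous => x; exact: cvg_cst.
  rewrite /contour_integral.
  have Ec : c = complex.Re c +i* complex.Im c by case: c.
  rewrite [in RHS]Ec; apply/eqP; rewrite eq_complex; apply/andP; split; apply/eqP => /=.
    rewrite -!RintegralZl ?measurable_boundedW// -RintegralB -?RintegralD//;
      try (by apply: measurable_boundedW; do ?[exact: measurable_boundedM|apply: measurable_boundedB]).
    apply: eq_Rintegral => s _; rewrite mulrDl raddfD/= -mulrA complexReM//.
  rewrite -!RintegralZl ?measurable_boundedW// -RintegralD -?RintegralD//;
    try (by apply: measurable_boundedW; do ?[exact: measurable_boundedM|apply: measurable_boundedD]).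
  by apply: eq_Rintegral => s _; rewrite mulrDl raddfD/= -mulrA complexImM.
- have [[_ [B1 hB1]] [_ [B2 hB2]]] := cderive_measurable_bounded.
  exists ((`|B1| + `|B2|) *+ 2); first by rewrite mulrn_wge0 ?addr_ge0.
  move=> f B B0 gf hf; have [m1 m2] := integrand_measurable_bounded gf.
  have hb s : 0 <= s <= 1 -> cnorm (f (g s) * cderive g s) <= (`|B1| + `|B2|) * B.
    move=> s01; rewrite cnormM mulrC ler_pM ?cnorm_ge0//; last exact/hf/trace_itv.
    rewrite (le_trans (cnorm_ReIm _))// lerD//.
      by rewrite (le_trans (hB1 _ s01))// ler_norm.
    by rewrite (le_trans (hB2 _ s01))// ler_norm.
  rewrite (le_trans (cnorm_ReIm _))//= mulrnAl mulr2n lerD//.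
    apply: Rintegral_bound m1 _ => s /hb; apply: le_trans; exact: cnorm_Re.
  apply: Rintegral_bound m2 _ => s /hb; apply: le_trans; exact: cnorm_Im.
Qed.

Definition is_cderive (f : R -> C) (s : R) (df : C) :=
  is_derive s 1 (fun u => complex.Re (f u)) (complex.Re df) /\
  is_derive s 1 (fun u => complex.Im (f u)) (complex.Im df).

(** The increments of [F] along the smooth pieces telescope. *)
Lemma contour_integral_FTC (F f : C -> C) :
  good (@cdist R) (trace g) F -> good (@cdist R) (trace g) f ->
  (forall s, 0 < s < 1 -> cderivable g s ->
     is_cderive (fun u => F (g u)) s (f (g s) * cderive g s)) ->
  contour_integral g f = F (g 1) - F (g 0).
Proof.
move=> gF gf dF.
have [cF1 cF2] := within_good_curve gF.
have [cf1 cf2] := within_good_curve gf.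
have [m1 m2] := integrand_measurable_bounded gf.
have sub01 a b : 0 <= a -> b <= 1 -> `[a, b] `<=` `[0%R, 1%R].
  by move=> a0 b1; apply: subset_itvScc; rewrite bnd_simp.
have mS a b (h : R -> R) : 0 <= a -> b <= 1 -> measurable_bounded 0 1 h -> measurable_bounded a b h.
  move=> a0 b1 [mh [B hB]]; split; first by apply: measurable_funS mh => //; exact: sub01.
  by exists B => x /andP[ax xb]; apply: hB; rewrite (le_trans a0 ax) (le_trans xb b1).
pose P a b := \int[mu]_(x in `[a, b]) complex.Re (f (g x) * cderive g x) =
    complex.Re (F (g b)) - complex.Re (F (g a)) /\
  \int[mu]_(x in `[a, b]) complex.Im (f (g x) * cderive g x) =
    complex.Im (F (g b)) - complex.Im (F (g a)).
have [E1 E2] : P 0 1; last first.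
  rewrite /contour_integral E1 E2; by case: (F _) => ? ?; case: (F _) => ? ?.
apply: piecewise_ind => [a b a0 ab b1 [dg [c1 [c2 [cc1 cc2 hc]]]]|]; last first.
  move=> a b c a0 ab bc c1 [h1 h2] [h3 h4]; split.
    by rewrite (Rintegral_cat ab bc (mS a c _ a0 c1 m1)) h1 h3; ring.
  by rewrite (Rintegral_cat ab bc (mS a c _ a0 c1 m2)) h2 h4; ring.
have cS (h : R -> R) : {within `[0, 1], continuous h} -> {within `[a, b], continuous h}.
  by apply: continuous_subspaceW; exact: sub01.
have in01 x : a < x < b -> 0 < x < 1.
  by move=> /andP[ax xb]; rewrite (le_lt_trans a0 ax) (lt_le_trans xb b1).
split.
- apply: (Rintegral_piece (c := fun x => complex.Re (f (g x)) * c1 x - complex.Im (f (g x)) * c2 x)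
    (H := fun x => complex.Re (F (g x)))) => //.
  + by apply: within_continuousB; apply: within_continuousMr => //; exact: cS.
  + by move=> x xab; have [<- <-] := hc x xab; rewrite complexReM.
  + exact: cS.
  + by move=> x xab; have [] := dF x (in01 x xab) (dg x xab).
- apply: (Rintegral_piece (c := fun x => complex.Re (f (g x)) * c2 x + complex.Im (f (g x)) * c1 x)
    (H := fun x => complex.Im (F (g x)))) => //.
  + by apply: within_continuousD; apply: within_continuousMr => //; exact: cS.
  + by move=> x xab; have [<- <-] := hc x xab; rewrite complexImM.
  + exact: cS.
  + by move=> x xab; have [] := dF x (in01 x xab) (dg x xab).
Qed.

End piecewise.

(** * Compact sets of complex numbers *)

Section compact_plane_sets.
Context (R : realType).
Local Notation C := (R[i]).
Implicit Types K : set C^o.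

Lemma open_distP (U : set C^o) :
  open U <-> forall w, U w -> exists2 r : R, 0 < r & forall w', cnorm (w - w') < r -> U w'.
Proof.
rewrite openE; split => [h w /h /nbhs_ballP[e /= e0 he]|h w /h[r r0 hr]].
  exists (complex.Re e); first by move: e0; rewrite ltcE => /andP[].
  move=> w' ww'; apply: he; rewrite /ball/= cnorm_normE.
  by case: e e0 ww' => a b; rewrite ltcE/= => /andP[/eqP -> _]; rewrite ltcR.
apply/nbhs_ballP; exists r%:C; first by rewrite /= ltcR.
by move=> w'; rewrite /ball/= cnorm_normE ltcR; exact: hr.
Qed.

Lemma compact_totally_bounded K : compact K -> totally_bounded K.
Proof.
rewrite compact_cover => cK r r0.
have [//||D DK KD] := cK C^o K (fun p => ball p r%:C).
- by move=> p _; exact: ball_open.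
- by move=> z Kz; exists z => //; apply: ballxx; rewrite ltcR.
exists #|` D|, (fun i => nth 0 (enum_fset D) i); split => [i|z /KD[p /= pD]].
  by apply/set_mem/DK; rewrite mem_nth.
rewrite /ball/= cnorm_normE ltcR cnormB => zp.
have pi : (index p (enum_fset D) < #|` D|)%N by rewrite index_mem.
by exists (Ordinal pi); rewrite /= nth_index.
Qed.

Lemma compact_cnorm_bounded K : compact K -> exists B, forall z, K z -> cnorm z <= B.
Proof.
move=> /compact_totally_bounded/(_ _ ltr01)[n [p [_ hp]]].
exists (\sum_i cnorm (p i) + 1) => z /hp[i /ltW zi].
rewrite -[z](subrK (p i)) (le_trans (cnormD _ _))// addrC lerD//.
by rewrite (bigD1 i)//= lerDl sumr_ge0// => *; exact: cnorm_ge0.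
Qed.

(** The image of the product of the two compact sets by [z - q w] is closed and misses [0]. *)
Lemma compact_separated K K' (q : C) : compact K -> compact K' ->
  (forall z w, K z -> K' w -> z != q * w) ->
  exists2 c, 0 < c & forall z w, K z -> K' w -> c <= cnorm (z - q * w).
Proof.
move=> cK cK' h.
pose f (p : C^o * C^o) : C^o := p.1 - q *: p.2.
have cf : continuous f.
  move=> p; apply: cvgB; first exact: cvg_fst.
  by apply: cvgZr; exact: cvg_snd.
have /compact_closed : compact (f @` (K `*` K')).
  by apply: continuous_compact; [exact: continuous_subspaceT|exact: compact_setX].
move=> /(_ (@norm_hausdorff _ _)) /closed_openC /open_distP/(_ 0)[].
  move=> [[z w] [/= Kz Kw]] /eqP; rewrite /f/= subr_eq0.
  by apply/negP; exact: h.
move=> r r0 hr; exists r => // z w Kz Kw; rewrite leNgt; apply/negP => zw.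
apply: (hr (z - q * w)); first by rewrite sub0r cnormN.
by exists (z, w).
Qed.

Lemma compact_far K p : compact K -> ~ K p -> far K p.
Proof.
move=> cK Kp; have [|c c0 hc] := @compact_separated K [set p] 1 cK (@compact_set1 _ p).
  by move=> z w Kz ->; rewrite mul1r; apply/eqP => zp; apply: Kp; rewrite -zp.
by exists c => // z Kz; have := hc z p Kz erefl; rewrite mul1r.
Qed.

Lemma cvg_scaleC (T : Type) (F : set_system T) {FF : Filter F} (f : T -> C^o) (l : C^o) (c : C) :
  f @ F --> l -> (fun x => f x * c : C^o) @ F --> (l * c : C^o).
Proof.
by move=> fl; rewrite mulrC; under eq_fun do rewrite mulrC; exact: (cvgZr fl).
Qed.

(** The half line from [p] in the direction away from the origin. *)
Definition ray (p : C) : set C^o := [set z | exists2 s : R, 1 <= s & z = s%:C * p].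

Lemma ray_connected p : connected (ray p).
Proof.
have -> : ray p = (fun s : R => s%:C * p : C^o) @` `[1, +oo[.
  apply/seteqP; split => z; first by move=> [s s1 ->]; exists s => //=; rewrite in_itv/= s1.
  by move=> [s /=]; rewrite in_itv/= andbT => s1 <-; exists s.
apply: connected_continuous_connected.
  by apply/connected_intervalP; exact: interval_is_interval.
apply: continuous_subspaceT => s; apply: cvg_scaleC; apply/cvgC_distP => e e0.
near=> s'; rewrite -rmorphB cnormR; near: s'.
exact: (@cvgr_dist_lt _ _ _ _ _ id s).
Unshelve. all: by end_near. Qed.

End compact_plane_sets.

(** * Winding numbers *)

Section closed_curves.
Context (R : realType).
Local Notation C := (R[i]).
Context (g : R -> C^o).
Hypothesis hg : piecewise_C1 g.
Hypothesis g01 : g 0 = g 1.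
Local Notation K := (trace g).
Local Notation J := (contour_integral g).

Lemma trace_compact : compact (trace g).
Proof.
apply: continuous_compact; last exact: segment_compact.
by case: hg.
Qed.

Lemma trace_connected : connected (trace g).
Proof.
apply: connected_continuous_connected; last by case: hg.
exact: segment_connected.
Qed.

Let hJ : functional (@cdist R) K J := contour_integral_functional hg.
Let bK := compact_cnorm_bounded trace_compact.

Lemma is_cderive_ext (f : R -> C) s d d' : d = d' -> is_cderive f s d -> is_cderive f s d'.
Proof. by move=> ->. Qed.

Lemma is_cderive_curve s : cderivable g s -> is_cderive g s (cderive g s).
Proof.
move=> [d1 d2]; split; rewrite /cderive/= derive1E; exact/derivableP.
Qed.

Lemma is_cderive_cst (c : C) s : is_cderive (fun=> c) s 0.
Proof. by split; exact: is_derive_cst. Qed.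

Lemma is_cderiveB (f h : R -> C) s df dh : is_cderive f s df -> is_cderive h s dh ->
  is_cderive (fun u => f u - h u) s (df - dh).
Proof.
move=> [f1 f2] [h1 h2]; split.
  under eq_fun do rewrite complexReD complexReN.
  by rewrite complexReD complexReN; exact: is_deriveB.
under eq_fun do rewrite complexImD complexImN.
by rewrite complexImD complexImN; exact: is_deriveB.
Qed.

Lemma is_cderiveM (f h : R -> C) s df dh : is_cderive f s df -> is_cderive h s dh ->
  is_cderive (fun u => f u * h u) s (f s * dh + df * h s).
Proof.
move=> [f1 f2] [h1 h2]; split.
  under eq_fun do rewrite complexReM.
  apply: is_derive_eq (is_deriveB (is_deriveM f1 h1) (is_deriveM f2 h2)) _.
  by rewrite complexReD !complexReM /GRing.scale/=; ring.
under eq_fun do rewrite complexImM.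
apply: is_derive_eq (is_deriveD (is_deriveM f1 h2) (is_deriveM f2 h1)) _.
by rewrite complexImD !complexImM /GRing.scale/=; ring.
Qed.

Lemma is_cderiveV (f : R -> C) s df : f s != 0 -> is_cderive f s df ->
  is_cderive (fun u => (f u)^-1) s (- (f s)^-1 ^+ 2 * df).
Proof.
move=> fs [f1 f2].
pose n u := complex.Re (f u) * complex.Re (f u) + complex.Im (f u) * complex.Im (f u).
have ns : n s != 0.
  rewrite /n -!expr2 paddr_eq0 ?sqr_ge0// !expf_eq0/=; apply/negP => /andP[/eqP a /eqP b].
  by move: fs; rewrite [f s]complexE a b mulr0 addr0 eqxx.
have dn := is_deriveD (is_deriveM f1 f1) (is_deriveM f2 f2).
have dV := is_deriveV (f := n) ns dn.
have key1 (a b a' b' : R) : a * a + b * b != 0 ->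
    a * (- ((a * a + b * b) ^- 2) * (a * a' + a * a' + (b * b' + b * b'))) +
      (a * a + b * b)^-1 * a' =
    - ((a / (a * a + b * b) * (a / (a * a + b * b)) -
       b * - (a * a + b * b)^-1 * (b * - (a * a + b * b)^-1)) * a' -
      (a / (a * a + b * b) * (b * - (a * a + b * b)^-1) +
       b * - (a * a + b * b)^-1 * (a / (a * a + b * b))) * b').
  by move=> h; field.
have key2 (a b a' b' : R) : a * a + b * b != 0 ->
    b * - (- ((a * a + b * b) ^- 2) * (a * a' + a * a' + (b * b' + b * b'))) +
      - (a * a + b * b)^-1 * b' =
    - ((a / (a * a + b * b) * (a / (a * a + b * b)) -
       b * - (a * a + b * b)^-1 * (b * - (a * a + b * b)^-1)) * b' +
      (a / (a * a + b * b) * (b * - (a * a + b * b)^-1) +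
       b * - (a * a + b * b)^-1 * (a / (a * a + b * b))) * a').
  by move=> h; field.
have ReV u : complex.Re (f u)^-1 = complex.Re (f u) * (n u)^-1.
  by rewrite /n; case: (f u) => a b; rewrite -!expr2.
have ImV u : complex.Im (f u)^-1 = complex.Im (f u) * - (n u)^-1.
  by rewrite /n; case: (f u) => a b; rewrite -!expr2 mulrN.
split.
- under eq_fun do rewrite ReV.
  apply: is_derive_eq (is_deriveM f1 dV) _.
  rewrite mulNr !(complexReN, complexImN) expr2 !(complexReM, complexImM, ReV, ImV) /GRing.scale/=.
  exact: key1 ns.
- under eq_fun do rewrite ImV.
  apply: is_derive_eq (is_deriveM f2 (is_deriveN dV)) _.
  rewrite mulNr !(complexReN, complexImN) expr2 !(complexReM, complexImM, ReV, ImV) /GRing.scale/=.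
  exact: key2 ns.
Qed.

Lemma is_cderiveX (f : R -> C) s df n : is_cderive f s df ->
  is_cderive (fun u => f u ^+ n.+1) s (n.+1%:R * f s ^+ n * df).
Proof.
move=> hf; elim: n => [|n IH].
  by apply: is_cderive_ext hf; rewrite expr0 !mul1r.
have := is_cderiveM hf IH; under eq_fun do rewrite -exprS.
by apply: is_cderive_ext; rewrite !exprS (_ : n.+2%:R = n.+1%:R + 1) ?natr1//; ring.
Qed.

(** The function has a primitive and the curve is closed. *)
Lemma contour_integral_pow m : J (fun z => z ^+ m) = 0.
Proof.
have m0 : m.+1%:R != 0 :> C by rewrite pnatr_eq0.
rewrite (@contour_integral_FTC _ _ hg (fun z => z ^+ m.+1 * m.+1%:R^-1)).
- by rewrite g01 subrr.
- by apply: good_mul; [apply: good_exp; exact: good_id|exact: good_cst].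
- by apply: good_exp; exact: good_id.
move=> s s01 /is_cderive_curve dg.
have := is_cderiveM (is_cderiveX m dg) (is_cderive_cst m.+1%:R^-1 s).
by apply: is_cderive_ext; rewrite mulr0 add0r; move: (m.+1%:R) m0 => c m0; field.
Qed.

Lemma contour_integral_inv_pow p m : far K p -> J (fun z => ((z - p) ^+ m.+2)^-1) = 0.
Proof.
move=> Fp; have m0 : m.+1%:R != 0 :> C by rewrite pnatr_eq0.
have gV : good (@cdist R) K (fun z => (z - p)^-1).
  by have [c c0 hc] := Fp; exact: good_inv c0 hc (good_subp bK p).
rewrite (@contour_integral_FTC _ _ hg (fun z => ((z - p)^-1) ^+ m.+1 * - m.+1%:R^-1)).
- by rewrite g01 subrr.
- by apply: good_mul; [exact: good_exp|exact: good_cst].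
- by apply: good_ext (good_exp m.+2 gV) => z _; rewrite exprVn.
move=> s s01 /is_cderive_curve dg.
have gp : g s - p != 0 by apply: (far_neq Fp); apply: trace_itv; rewrite !ltW//; case/andP: s01.
have dgp : is_cderive (fun u => g u - p) s (cderive g s).
  by have := is_cderiveB dg (is_cderive_cst p s); rewrite subr0.
have := is_cderiveM (is_cderiveX m (is_cderiveV gp dgp)) (is_cderive_cst (- m.+1%:R^-1) s).
apply: is_cderive_ext; rewrite mulr0 add0r -exprVn !exprS.
by move: (m.+1%:R) m0 => c m0; field; rewrite gp m0.
Qed.

Local Notation W w := (J (fun z => (z - w)^-1)).

Lemma trace_far w : ~ K w -> far K w.
Proof. exact: compact_far trace_compact. Qed.

Lemma good_pole w : ~ K w -> good (@cdist R) K (fun z => (z - w)^-1).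
Proof. by move=> /trace_far[c c0 hc]; exact: good_inv c0 hc (good_subp bK w). Qed.

Lemma le0_archi (x M : R) : (forall n, x * n.+1%:R <= M) -> x <= 0.
Proof.
move=> h; rewrite leNgt; apply/negP => x0.
have M0 : 0 <= M / x by rewrite divr_ge0 ?(ltW x0)// (le_trans _ (h 0))// mulr1 ltW.
have := archi_boundP M0; rewrite ltr_pdivrMr// mulrC ltNge => /negP; apply.
by apply: le_trans (h _); rewrite ler_pM2l// ler_nat.
Qed.

(** The difference quotient of [W] at [v] is, up to a term of first order, the integral of
    [(z - v)^-2], which vanishes.  So [W] varies at most quadratically near [w]; cutting a
    segment into [n] parts then bounds its total variation by a multiple of [1 / n]. *)
Lemma winding_locally_constant w : ~ K w ->
  exists2 r : R, 0 < r & forall w', cnorm (w - w') < r -> ~ K w' /\ W w' = W w.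
Proof.
move=> /trace_far[c c0 hc]; have c20 : 0 < c / 2 by rewrite divr_gt0.
have far2 u z : cnorm (w - u) < c / 2 -> K z -> c / 2 <= cnorm (z - u).
  move=> wu Kz; have := hc z Kz; have := cnorm_distD u z w.
  have := cnormB u w; lra.
have nK u : cnorm (w - u) < c / 2 -> ~ K u.
  by move=> wu Ku; have := far2 u u wu Ku; rewrite subrr cnorm0; lra.
have [V V0 hV] := functional_bnd hJ.
pose M := V * ((c / 2)^-1 * (c / 2)^-1 * (c / 2)^-1).
have quad u v : cnorm (w - u) < c / 2 -> cnorm (w - v) < c / 2 ->
    cnorm (W u - W v) <= M * cnorm (u - v) ^+ 2.
  move=> wu wv; have gu := good_pole (nK _ wu); have gv := good_pole (nK _ wv).
  pose f1 z := (u - v) * ((z - v) ^+ 2)^-1.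
  pose f2 z := (u - v) ^+ 2 * ((z - u)^-1 * (z - v)^-1 * (z - v)^-1).
  have gv2 : good (@cdist R) K (fun z => ((z - v) ^+ 2)^-1).
    by apply: good_ext (good_mul gv gv) => z _; rewrite expr2 invfM.
  have gf2 : good (@cdist R) K f2 by apply: good_scale; do 2?apply: good_mul.
  rewrite -(functionalB hJ)//.
  rewrite (functional_ext hJ (g := fun z => f1 z + f2 z)); last first.
    move=> z Kz; have zu : z - u != 0 by rewrite -cnorm_gt0 (lt_le_trans c20)// far2.
    have zv : z - v != 0 by rewrite -cnorm_gt0 (lt_le_trans c20)// far2.
    by rewrite /f1 /f2; field; rewrite zu zv.
  rewrite (functionalD hJ)//; last exact: good_scale.
  rewrite (functionalZ hJ)// contour_integral_inv_pow ?mulr0 ?add0r; last exact/trace_far/nK.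
  rewrite -mulrA; apply: hV => // [|z Kz].
    by rewrite mulr_ge0 ?exprn_ge0 ?cnorm_ge0// !mulr_ge0 ?invr_ge0 ?(ltW c20).
  rewrite cnormM cnormX mulrC ler_wpM2r ?exprn_ge0 ?cnorm_ge0// !cnormM !cnormV.
  have h x : cnorm (w - x) < c / 2 -> (cnorm (z - x))^-1 <= (c / 2)^-1.
    by move=> wx; rewrite lef_pV2 ?posrE ?far2// (lt_le_trans c20)// far2.
  have i0 x : 0 <= (cnorm (z - x))^-1 by rewrite invr_ge0 cnorm_ge0.
  by rewrite ler_pM ?mulr_ge0 ?h// ler_pM ?h.
exists (c / 2) => // w' ww'; split; first exact: nK.
apply/eqP; rewrite -subr_eq0 -cnorm_eq0 eq_le cnorm_ge0 andbT.
(* [p j] below are the points which divide the segment from [w] to [w'] into [n.+1] parts. *)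
apply: (@le0_archi _ (M * cnorm (w - w') ^+ 2)) => n.
have n0 : n.+1%:R != 0 :> C by rewrite pnatr_eq0.
pose p j := w + (j%:R / n.+1%:R) * (w' - w).
have p0 : p 0 = w by rewrite /p !mul0r addr0.
have pn : p n.+1 = w' by rewrite /p divff// mul1r addrC subrK.
have cnat j : cnorm (j%:R : C) = j%:R by rewrite -(rmorph_nat (real_complex R)) cnormR ger0_norm.
have pb j : (j <= n.+1)%N -> cnorm (w - p j) < c / 2.
  move=> jn; apply: le_lt_trans ww'.
  rewrite /p opprD addrA subrr add0r cnormN cnormM cnormB ler_piMl ?cnorm_ge0//.
  by rewrite cnormM cnormV !cnat ler_pdivrMr// mul1r ler_nat.
have step j : (j < n.+1)%N -> cnorm (W (p j.+1) - W (p j)) <= M * cnorm (w - w') ^+ 2 / n.+1%:R ^+ 2.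
  move=> jn; rewrite (le_trans (quad _ _ (pb _ jn) (pb _ (ltnW jn))))//.
  rewrite (_ : p j.+1 - p j = (w' - w) / n.+1%:R); last first.
    by rewrite /p -[j.+1%:R]natr1; move: (n.+1%:R) n0 => m m0; field.
  by rewrite cnormM cnormV cnat expr_div_n (cnormB w') mulrA.
have : cnorm (W w' - W w) <= \sum_(j < n.+1) M * cnorm (w - w') ^+ 2 / n.+1%:R ^+ 2.
  have : W (p n.+1) - W (p 0) = \sum_(j < n.+1) (W (p j.+1) - W (p j)).
    by rewrite -(big_mkord xpredT (fun j => W (p j.+1) - W (p j))) telescope_sumr.
  rewrite pn p0 => ->; by rewrite (le_trans (cnorm_sum _ _ _))// ler_sum// => j _; exact: step.
rewrite sumr_const card_ord; set D := M * cnorm (w - w') ^+ 2.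
rewrite (_ : (D / n.+1%:R ^+ 2) *+ n.+1 = D / n.+1%:R) ?ler_pdivlMr ?ltr0n// -mulr_natr.
have : n.+1%:R != 0 :> R by rewrite pnatr_eq0.
by move: (n.+1%:R) => m m0; field.
Qed.

Lemma winding_connected (B : set C^o) w w' : connected B -> (forall z, B z -> ~ K z) ->
  B w -> B w' -> W w' = W w.
Proof.
move=> cB BK Bw Bw'.
suff : [set z | B z /\ W z = W w] = B by move=> /seteqP[_ /(_ _ Bw')[]].
apply: cB; first by exists w.
- exists [set z | ~ K z /\ W z = W w]; last first.
    by apply/seteqP; split => z /= [Bz]; [split => //; split => //; exact: BK|case].
  apply/open_distP => z [/winding_locally_constant[r r0 hr] <-].
  by exists r => // z' /hr.
- exists (~` [set z | ~ K z /\ W z <> W w]).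
    apply: open_closedC; apply/open_distP => z [/winding_locally_constant[r r0 hr] zw].
    by exists r => // z' /hr[? E] /=; rewrite E.
  apply/seteqP; split => z /= [Bz]; first by move=> zw; split => // -[_]; exact.
  by move=> h; split => //; apply: contrapT => zw; apply: h; split => //; exact: BK.
Qed.

Lemma winding_unbounded (B : set C^o) w : connected B -> (forall z, B z -> ~ K z) ->
  (forall M : R, exists2 z, B z & M < cnorm z) -> B w -> W w = 0.
Proof.
move=> cB BK uB Bw; have [V V0 hV] := functional_bnd hJ; have [D hD] := bK.
apply: (@cnorm_le_eps _ _ V) => e e0; have [z Bz zM] := uB (D + e^-1).
rewrite -(winding_connected cB BK Bw Bz); apply: hV (ltW e0) (good_pole (BK _ Bz)) _ => x Kx.
have := hD _ Kx; have := cnorm_distD x z 0; rewrite !subr0 cnormB => h1 h2.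
have h3 : e^-1 <= cnorm (x - z) by lra.
by rewrite cnormV -[e]invrK lef_pV2 ?posrE ?invr_gt0// (lt_le_trans _ h3)// invr_gt0.
Qed.

Lemma ray_unbounded p (M : R) : p != 0 -> exists2 z, ray p z & M < cnorm z.
Proof.
rewrite -cnorm_gt0 => p0; exists ((1 + `|M| / cnorm p)%:C * p).
  by exists (1 + `|M| / cnorm p) => //; rewrite lerDl divr_ge0// ltW.
have h : 0 <= `|M| / cnorm p by rewrite divr_ge0// ltW.
rewrite cnormM cnormR ger0_norm ?addr_ge0// mulrDl mul1r divfK ?gt_eqF//.
by rewrite (le_lt_trans (ler_norm M))// ltrDr.
Qed.

Lemma winding_ray p : p != 0 -> (forall z, ray p z -> ~ K z) -> W p = 0.
Proof.
move=> p0 h; apply: (@winding_unbounded (ray p) p (@ray_connected R p) h).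
  by move=> M; exact: ray_unbounded.
by exists 1 => //; rewrite mul1r.
Qed.

Lemma not_bounded_setP (A : set C^o) : ~ bounded_set A ->
  forall M : R, exists2 z, A z & M < cnorm z.
Proof.
move=> nb M; apply: contrapT => h; apply: nb; exists M%:C; split.
  by apply/complex_realP; exists M.
move=> M' MM' z Az; apply/ltW/(le_lt_trans _ MM'); rewrite cnorm_normE lecR leNgt.
by apply/negP => Mz; apply: h; exists z.
Qed.

Lemma bounded_setP (A : set C^o) : bounded_set A ->
  exists M : R, forall z, A z -> cnorm z <= M.
Proof.
move=> [M [/complex_realP[x ->] h]]; exists (x + 1) => z Az.
rewrite -lecR -cnorm_normE; apply: h => //.
by rewrite ltcR ltrDl.
Qed.

(** A point neither on the curve nor in its interior lies in an unbounded component, where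
    [W] is constant and tends to [0] at infinity. *)
Lemma winding_exterior w : ~ (trace g `|` contour_interior g) w -> W w = 0.
Proof.
move=> /not_orP[nKw nI].
apply: (@winding_unbounded (connected_component (~` K) w)).
- exact: component_connected.
- by move=> z /connected_component_sub.
- by apply: not_bounded_setP => hb; apply: nI; split.
- exact: connected_component_refl.
Qed.

(** A point of larger modulus than the whole curve escapes to infinity along its ray. *)
Lemma interior_cnorm w (M : R) : (forall z, K z -> cnorm z <= M) ->
  contour_interior g w -> cnorm w <= M.
Proof.
move=> hM [nKw bw]; rewrite leNgt; apply/negP => Mw.
have M0 : 0 <= M by rewrite (le_trans (cnorm_ge0 (g 0)))// hM//; apply: trace_itv; rewrite lexx ler01.
have w0 : w != 0 by rewrite -cnorm_gt0 (le_lt_trans M0).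
have rayC : ray w `<=` connected_component (~` K) w.
  apply: connected_component_max; first by exists 1 => //; rewrite mul1r.
    move=> z [s s1 ->] /hM; rewrite cnormM cnormR ger0_norm ?(le_trans ler01)// leNgt.
    by move=> /negP; apply; rewrite (lt_le_trans Mw)// ler_peMl// cnorm_ge0.
  exact: ray_connected.
have [M' hM'] := bounded_setP bw; have [z /rayC/hM'] := ray_unbounded M' w0.
by rewrite leNgt => /negP.
Qed.

End closed_curves.

(** * The dual system *)

Section states.
Local Open Scope set_scope.
Local Open Scope ring_scope.
Context (N k : nat).
Local Notation state := {ffun 'I_k -> 'I_N.+1}.
Implicit Types n : state.

Definition sorted_state n := [forall i : 'I_k, forall j : 'I_k, (i <= j)%N ==> (n j <= n i)%N].
Definition count_eq n v := #|[set p | n p == v :> nat]|.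
Definition count_ge n v := #|[set p | (v <= n p)%N]|.
(** The last of the particles at level [v] moves down, which keeps the state sorted. *)
Definition dec v n : state :=
  [ffun p : 'I_k => if p.+1 == count_ge n v then inord (n p).-1 else n p].

Lemma count_geS n v : count_ge n v = (count_eq n v + count_ge n v.+1)%N.
Proof.
rewrite /count_ge /count_eq -[RHS]cardsUI (_ : _ :&: _ = finset.set0) ?cards0 ?addn0.
  by apply: eq_card => p; rewrite !inE leq_eqVlt eq_sym.
by apply/finset.setP => p; rewrite !inE; apply/andP => -[/eqP -> ]; rewrite ltnn.
Qed.

Lemma count_ge_le n v w : (v <= w)%N -> (count_ge n w <= count_ge n v)%N.
Proof.
move=> vw; apply: subset_leq_card; apply/fintype.subsetP => p; rewrite !inE.
exact: leq_trans.
Qed.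

Lemma count_ge0 n : count_ge n 0 = k.
Proof. by rewrite /count_ge (_ : [set p | _] = [set: _]) ?cardsT ?card_ord//; apply/finset.setP => p; rewrite !inE. Qed.

Section sorted.
Context (n : state).
Hypothesis sn : sorted_state n.

Lemma sortedP (i j : 'I_k) : (i <= j)%N -> (n j <= n i)%N.
Proof. by move: sn => /forallP/(_ i)/forallP/(_ j)/implyP; exact. Qed.

(** The particles at level at least [v] form an initial segment of a sorted state; counting
    them therefore locates each group of equal levels ([state_eq]). *)
Lemma lt_count_ge (p : 'I_k) v : (p < count_ge n v)%N = (v <= n p)%N.
Proof.
apply/idP/idP => [|vp]; last first.
  have : [set i : 'I_k | (i < p.+1)%N] \subset [set i | (v <= n i)%N].
    apply/fintype.subsetP => i; rewrite !inE ltnS => ip.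
    exact: leq_trans vp (sortedP ip).
  move=> /subset_leq_card; apply: leq_trans.
  rewrite (_ : [set i : 'I_k | _] = [set widen_ord (ltn_ord p) i | i in [set: 'I_p.+1]]).
    by rewrite card_imset ?cardsT ?card_ord// => i j /(congr1 val)/= ij; exact: val_inj.
  apply/finset.setP => i; rewrite inE; apply/idP/imsetP => [ip|[j _ ->]/=]; last exact: ltn_ord.
  by exists (Ordinal ip) => //; apply: val_inj.
apply: contraLR; rewrite -leqNgt -ltnNge => pv.
have : [set i | (v <= n i)%N] \subset [set i : 'I_k | (i < p)%N].
  apply/fintype.subsetP => i; rewrite !inE => vi; rewrite ltnNge; apply/negP => pi.
  by have := leq_trans vi (sortedP pi); rewrite leqNgt pv.
move=> /subset_leq_card /leq_trans; apply.
rewrite (_ : [set i : 'I_k | _] = [set widen_ord (ltnW (ltn_ord p)) i | i in [set: 'I_p]]).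
  by rewrite card_imset ?cardsT ?card_ord// => i j /(congr1 val)/= ij; exact: val_inj.
apply/finset.setP => i; rewrite inE; apply/idP/imsetP => [ip|[j _ ->]/=]; last exact: ltn_ord.
by exists (Ordinal ip) => //; apply: val_inj.
Qed.

Lemma state_eq (p : 'I_k) v : (n p == v :> nat) = (count_ge n v.+1 <= p < count_ge n v)%N.
Proof. by rewrite lt_count_ge leqNgt lt_count_ge -leqNgt eqn_leq. Qed.

Lemma last_position v : (0 < count_eq n v)%N ->
  exists2 p : 'I_k, p.+1 = count_ge n v & n p = v :> nat.
Proof.
move=> y0; have lt : ((count_ge n v).-1 < k)%N.
  have : (count_ge n v <= k)%N by rewrite -[leqRHS](card_ord k) max_card.
  by have := count_geS n v; lia.
exists (Ordinal lt) => /=; first by have := count_geS n v; lia.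
by apply/eqP; rewrite state_eq/=; have := count_geS n v; lia.
Qed.

End sorted.

Section dec.
Context (n : state) (v : nat).
Hypotheses (sn : sorted_state n) (v0 : (0 < count_eq n v.+1)%N).

Lemma decE (p : 'I_k) : dec v.+1 n p = (if p.+1 == count_ge n v.+1 then v else n p) :> nat.
Proof.
rewrite ffunE; case: eqP => // pE; have [p' p'E np'] := last_position sn v0.
have -> : p = p' by apply: val_inj; apply: succn_inj; rewrite pE p'E.
by rewrite np'/= inordK// -np' (leq_trans (ltnW (ltn_ord _))).
Qed.

Lemma dec_ge w (p : 'I_k) : (w <= dec v.+1 n p)%N =
  (w <= n p)%N && ~~ ((w == v.+1) && (p.+1 == count_ge n v.+1)).
Proof.
rewrite decE; case: eqP => pE; rewrite ?andbF ?andbT//.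
have -> : n p = v.+1 :> nat.
  have [p' p'E <-] := last_position sn v0.
  by congr (val (n _)); apply: val_inj; apply: succn_inj; rewrite pE p'E.
by case: eqP => [->|]; [rewrite ltnn andbF|move=> ?; rewrite andbT; lia].
Qed.

Lemma dec_sorted : sorted_state (dec v.+1 n).
Proof.
apply/forallP => i; apply/forallP => j; apply/implyP => ij.
rewrite !decE; have := sortedP sn ij.
have := lt_count_ge sn i v.+1; have := lt_count_ge sn j v.+1.
by case: eqP => jE; case: eqP => iE; lia.
Qed.

Lemma count_ge_dec w : w != v.+1 -> count_ge (dec v.+1 n) w = count_ge n w.
Proof.
by move=> wv; apply: eq_card => p; rewrite !inE dec_ge (negPf wv) andbT.
Qed.

Lemma count_eq_dec : (0 < count_eq (dec v.+1 n) v)%N.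
Proof.
have [p pE np] := last_position sn v0.
by apply/card_gt0P; exists p; rewrite inE decE pE eqxx.
Qed.

End dec.

Section dual.
Context (F : fieldType) (q : F) (a : 'I_N -> F) (rR rL : F).

Definition rate_at (v : nat) : F := if insub v is Some i then a i else 0.

Lemma rate_atE (i : 'I_N) : rate_at i = a i.
Proof. by rewrite /rate_at valK. Qed.

(** The particle at level [v] chosen by [dec] either stays or descends one level at a time;
    each level [v'] which it enters with [m] particles already there costs a factor [q ^- m].
    On the integrals the combination is the division by the last variable of the group of
    level [v] ([left_terms_integral]), on monomials the division by [u_v], up to a factor
    linear in the [u_i] ([left_terms_prod]). *)
Fixpoint left_terms v n : seq (F * state) :=
  if v is v'.+1 then
    ((rate_at v')^-1, n) ::
      [seq (q ^- count_eq n v' * cm.1, cm.2) | cm <- left_terms v' (dec v n)]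
  else [::].

Arguments left_terms : simpl never.

Definition right_terms v n : seq (F * state) :=
  [:: (1, dec v n); (-1, n)].

Definition dual_terms n : seq (F * state) :=
  flatten [seq if (0 < count_eq n v.+1)%N then
     [seq (rR * a v * (1 - q ^+ count_eq n v.+1) * cm.1, cm.2) | cm <- right_terms v.+1 n] ++
     [seq (rL * (q ^- count_eq n v.+1 - 1) * cm.1, cm.2) | cm <- left_terms v.+1 n]
   else [::] | v : 'I_N <- enum 'I_N].

Definition apply_terms (s : seq (F * state)) (h : state -> F) := \sum_(cm <- s) cm.1 * h cm.2.

(** The generator of the dual particle system, as a formal sum of pairs of a coefficient
    and a state.  The explicit list serves three purposes: the states reached are sorted
    ([dual_terms_sorted]), the sum of the moduli of the coefficients bounds the operator,
    and the coefficients can be sent from the reals to the complex numbers. *)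
Definition dual h n := apply_terms (dual_terms n) h.

Lemma apply_terms_scale c s h :
  apply_terms [seq (c * cm.1, cm.2) | cm <- s] h = c * apply_terms s h.
Proof. by rewrite /apply_terms big_map mulr_sumr; apply: eq_bigr => -[x m] _ /=; rewrite mulrA. Qed.

Lemma apply_left_termsS v n h : apply_terms (left_terms v.+1 n) h =
  (rate_at v)^-1 * h n + q ^- count_eq n v * apply_terms (left_terms v (dec v.+1 n)) h.
Proof. by rewrite -apply_terms_scale /apply_terms big_cons. Qed.

Lemma dualE h n : dual h n = \sum_(v < N | (0 < count_eq n v.+1)%N)
  (rR * a v * (1 - q ^+ count_eq n v.+1) * (h (dec v.+1 n) - h n) +
   rL * (q ^- count_eq n v.+1 - 1) * apply_terms (left_terms v.+1 n) h).
Proof.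
rewrite /dual /apply_terms big_flatten big_map big_enum [RHS]big_mkcond; apply: eq_bigr => v _.
case: ifP => _; last by rewrite big_nil.
rewrite big_cat -!/(apply_terms _ h) !apply_terms_scale; congr (_ * _ + _).
by rewrite /apply_terms !big_cons big_nil /= addr0 mul1r mulN1r.
Qed.

Lemma left_terms_sorted v n : sorted_state n -> (0 < count_eq n v)%N ->
  all (fun cm => sorted_state cm.2) (left_terms v n).
Proof.
elim: v n => [//|v IH] n sn v0; rewrite [left_terms _ _]/left_terms -/left_terms/= sn all_map/=.
by apply: IH; [exact: dec_sorted|exact: count_eq_dec].
Qed.

Lemma dual_terms_sorted n : sorted_state n ->
  all (fun cm => sorted_state cm.2) (dual_terms n).
Proof.
move=> sn; apply/allP => cm /flattenP[s /mapP[v _ ->]]; case: ifP => // v0.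
rewrite mem_cat => /orP[] /mapP[cm' + ->] /=.
  by rewrite !inE => /orP[]/eqP -> //=; exact: dec_sorted.
by move=> cm'n; exact: (allP (left_terms_sorted sn v0) _ cm'n).
Qed.

Section product_functions.
Context (u : nat -> F).
Hypotheses (un0 : forall v, (0 < v <= N)%N -> u v != 0) (q0 : q != 0).

Definition prod_state n := \prod_(p < k) u (n p).

Lemma prod_state_dec v n : (v < N)%N -> sorted_state n -> (0 < count_eq n v.+1)%N ->
  prod_state (dec v.+1 n) = u v / u v.+1 * prod_state n.
Proof.
move=> vN sn v0; have [p pE np] := last_position sn v0.
rewrite /prod_state (bigD1 p)//= [in RHS](bigD1 p)//= np decE// pE eqxx.
rewrite mulrA divfK ?un0//; congr (_ * _); apply: eq_bigr => p' p'p.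
rewrite decE// -pE eqSS; case: eqP => // /val_inj pp; by rewrite pp eqxx in p'p.
Qed.

Lemma left_terms_prod v n : (v <= N)%N -> sorted_state n -> (0 < count_eq n v)%N ->
  apply_terms (left_terms v n) prod_state =
  prod_state n * (u v)^-1 *
    \sum_(i < v) (rate_at i)^-1 * q ^- (count_ge n i.+1 - count_ge n v) * u i.+1.
Proof.
elim: v n => [|v IH] n vN sn v0; first by rewrite /apply_terms big_nil big_ord0 mulr0.
rewrite apply_left_termsS IH ?(ltnW vN)//; [|exact: dec_sorted|exact: count_eq_dec].
rewrite big_ord_recr/= subnn expr0 invr1 mulr1 prod_state_dec// mulrDr addrC; congr (_ + _); last first.
  by rewrite mulrC -!mulrA; congr (_ * _); rewrite mulrCA mulVf ?mulr1// un0.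
case: v IH vN v0 => [|v] IH vN v0; first by rewrite !big_ord0 !mulr0.
have uv : u v.+1 != 0 by rewrite un0//= ltnW.
have uv' : u v.+2 != 0 by rewrite un0.
rewrite !mulr_sumr; apply: eq_bigr => i _.
rewrite !count_ge_dec// ?ltn_eqF//; try by have := ltn_ord i; lia.
have -> : q ^- (count_ge n i.+1 - count_ge n v.+2) =
    q ^- count_eq n v.+1 * q ^- (count_ge n i.+1 - count_ge n v.+1).
  rewrite -invfM -exprD; congr (_ ^- _).
  have := count_geS n v.+1; have := count_ge_le n (ltn_ord i); lia.
move: ((rate_at i)^-1) => ra; field; by rewrite uv uv' !expf_neq0.
Qed.

(** The virtual particle at minus infinity has [u] infinite, hence inverse [0]. *)
Definition invu v := if (v <= N)%N then (u v)^-1 else 0.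

(** The left part of [dual] is a sum over [i <= j] of the increments of [B j], the power of
    [q] counting the particles between the levels [i] and [j], times [u_(i+1) / u_(j+1)].
    A summation by parts moves the increment from [B] to [1 / u_(j+1)]; this is the form in
    which the generator of the process appears. *)
Lemma dual_prod n : sorted_state n ->
  dual prod_state n =
  prod_state n * (\sum_(v < N) rR * a v * (1 - u v / u v.+1) * (q ^+ count_eq n v.+1 - 1) +
  \sum_(i < N) rL * (a i)^-1 * \sum_(j < N | (i <= j)%N)
    u i.+1 * (invu j.+1 - invu j.+2) * (q ^- (count_ge n i.+1 - count_ge n j.+2) - 1)).
Proof.
move=> sn; rewrite dualE big_split/= mulrDr; congr (_ + _).
  rewrite mulr_sumr big_mkcond/=; apply: eq_bigr => v _.
  case: ifP => [v0|]; first by rewrite prod_state_dec//; ring.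
  by move=> /negbT; rewrite -leqNgt leqn0 => /eqP ->; rewrite expr0 subrr !mulr0.
pose A i j := (a i)^-1 * u i.+1 * (u j.+1)^-1 *
  (q ^- (count_ge n i.+1 - count_ge n j.+2) - q ^- (count_ge n i.+1 - count_ge n j.+1)).
transitivity (prod_state n * (rL * \sum_(i < N) \sum_(j < N | (i <= j)%N) A i j)).
  rewrite (exchange_big_dep xpredT)//= !mulr_sumr big_mkcond/=; apply: eq_bigr => j _.
  case: ifP => [j0|]; last first.
    move=> /negbT; rewrite -leqNgt leqn0 => /eqP yj; rewrite big1 ?mulr0// => i ij.
    by rewrite /A (count_geS n j.+1) yj add0n subrr !mulr0.
  rewrite left_terms_prod// (big_ord_widen N (fun i => (rate_at i)^-1 *
    q ^- (count_ge n i.+1 - count_ge n j.+1) * u i.+1))//.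
  rewrite !mulr_sumr; apply: eq_bigr => i ij; rewrite /A rate_atE.
  have -> : q ^- (count_ge n i.+1 - count_ge n j.+2) =
      q ^- count_eq n j.+1 * q ^- (count_ge n i.+1 - count_ge n j.+1).
    rewrite -invfM -exprD; congr (_ ^- _).
    have := count_geS n j.+1; have : (i.+1 <= j.+1)%N by []; move=> /(count_ge_le n); lia.
  by ring.
congr (_ * _); rewrite mulr_sumr; apply: eq_bigr => i _.
rewrite -mulrA; congr (_ * _); rewrite /A.
have sumge (G : nat -> F) : \sum_(j < N | (i <= j)%N) G j = \sum_(i <= j < N) G j.
  by rewrite big_geq_mkord; apply: eq_bigl.
pose B j := q ^- (count_ge n i.+1 - count_ge n j.+1) : F.
have -> : \sum_(j < N | (i <= j)%N) (a i)^-1 * u i.+1 * (u j.+1)^-1 * (B j.+1 - B j) =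
  (a i)^-1 * (u i.+1 * \sum_(i <= j < N) (u j.+1)^-1 * (B j.+1 - B j)).
  rewrite -sumge !mulr_sumr; apply: eq_bigr => j _; ring.
congr (_ * _); rewrite (sumge (fun j => u i.+1 * (invu j.+1 - invu j.+2) * (B j.+1 - 1))).
under [RHS]eq_bigr do rewrite -mulrA.
rewrite -mulr_sumr; congr (_ * _).
have Bi : B i = 1 by rewrite /B subnn expr0 invr1.
have tele (m : nat) : (i <= m <= N)%N ->
    \sum_(i <= j < m) invu j.+1 * (B j.+1 - B j) =
    \sum_(i <= j < m) (invu j.+1 - invu j.+2) * (B j.+1 - 1) + invu m.+1 * (B m - 1).
  elim: m => [|m IH] /andP[im mN].
    by move: im; rewrite leqn0 => /eqP i0; rewrite !big_geq ?i0//; rewrite -i0 Bi subrr mulr0 addr0.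
  move: im; rewrite leq_eqVlt => /predU1P[<-|im]; first by rewrite !big_geq// Bi subrr mulr0 addr0.
  have imN : (i <= m <= N)%N by rewrite -ltnS im ltnW.
  by rewrite !big_nat_recr//= (IH imN); ring.
have invN : invu N.+1 = 0 by rewrite /invu ltnn.
have := tele N; rewrite invN mul0r addr0 (ltnW (ltn_ord i)) leqnn => /(_ isT) <-.
by apply: eq_big_nat => j /andP[_ jN]; rewrite /invu jN.
Qed.

End product_functions.
End dual.
End states.

(** * The integrands *)

Section integrands.
Context (R : realType) (N k : nat).
Local Notation C := (R[i]).
Context (q : C) (a : 'I_N -> C).

(** Only two consequences of being a Laurent polynomial are kept: boundedness and uniform
    continuity away from zero, and rationality with no pole but [0] in each variable. *)
Definition laurent (S : ('I_k -> C) -> C) :=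
  (forall Ks : 'I_k -> set C^o, (forall A, compact (Ks A)) -> (forall A, ~ Ks A 0) ->
     good (@ffdist R k) (boxset Ks) S) /\
  (forall l z (K : set C), ~ K 0 -> rational_on (fun p => p = 0) K (fun w => S (upd z l w))).

Lemma good_coord (Ks : 'I_k -> set C^o) A : (forall A, compact (Ks A)) ->
  good (@ffdist R k) (boxset Ks) (fun z => z A).
Proof.
move=> cK; apply: (good_comp (h := fun z : 'I_k -> C => z A) (K' := Ks A) _ _
  (good_id (compact_cnorm_bounded (cK A)))) => //.
move=> z w _ _; rewrite /ffdist (bigD1 A)//= lerDl sumr_ge0// => *; exact: cnorm_ge0.
Qed.

Lemma laurent_cst c : laurent (fun=> c).
Proof. by split => *; [exact: good_cst|exact: rational_cst]. Qed.

Lemma zero_neq (K : set C) : ~ K 0 -> forall p z, p = 0 -> K z -> z != p.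
Proof. by move=> K0 p z -> Kz; apply/eqP => z0; apply: K0; rewrite -z0. Qed.

Lemma laurent_coord A : laurent (fun z => z A).
Proof.
split=> [Ks cK K0|l z K K0]; first exact: good_coord.
rewrite /upd; case: eqP => _; [exact: rational_id|exact: rational_cst].
Qed.

Lemma laurent_coordV A : laurent (fun z => (z A)^-1).
Proof.
split=> [Ks cK K0|l z K K0].
  have [c c0 hc] := compact_far (cK A) (K0 A).
  apply: (good_inv c0 _ (good_coord A cK)) => z /(_ A)/hc.
  by rewrite subr0.
rewrite /upd; case: eqP => _; last exact: rational_cst.
by apply: rational_ext (rational_pole _ (erefl (0 : C))) => w _; rewrite subr0.
Qed.

Lemma laurentM S S' : laurent S -> laurent S' -> laurent (fun z => S z * S' z).
Proof.
move=> [g r] [g' r']; split => [Ks cK K0|l z K K0].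
  by apply: good_mul; [exact: g|exact: g'].
by apply: rational_mul; [exact: r|exact: r'].
Qed.

Lemma laurentD S S' : laurent S -> laurent S' -> laurent (fun z => S z + S' z).
Proof.
move=> [g r] [g' r']; split => [Ks cK K0|l z K K0].
  by apply: good_add; [exact: g|exact: g'].
by apply: rational_add; [exact: zero_neq|exact: r|exact: r'].
Qed.

Lemma laurentZ c S : laurent S -> laurent (fun z => c * S z).
Proof. by move=> hS; apply: laurentM => //; exact: laurent_cst. Qed.

Lemma laurentB S S' : laurent S -> laurent S' -> laurent (fun z => S z - S' z).
Proof.
move=> hS hS'; have := laurentD hS (laurentZ (-1) hS').
by congr laurent; apply/funext => z; rewrite mulN1r.
Qed.

Lemma laurent_sum (I : Type) (s : seq I) (f : I -> ('I_k -> C) -> C) :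
  (forall i, laurent (f i)) -> laurent (fun z => \sum_(i <- s) f i z).
Proof.
move=> h; elim: s => [|i s IH].
  by under eq_fun do rewrite big_nil; exact: laurent_cst.
by under eq_fun do rewrite big_cons; exact: laurentD.
Qed.

Lemma laurentX S m : laurent S -> laurent (fun z => S z ^+ m).
Proof.
move=> hS; elim: m => [|m IH]; first by under eq_fun do rewrite expr0; exact: laurent_cst.
by under eq_fun do rewrite exprS; exact: laurentM.
Qed.

Definition cross (Q : pred ('I_k * 'I_k)) (z : 'I_k -> C) : C :=
  \prod_(p : 'I_k * 'I_k | (p.1 < p.2)%N && Q p) ((z p.1 - z p.2) / (z p.1 - q * z p.2)).

Definition phi (m : nat) (z : C) : C := \prod_(i < N | (i < m)%N) (a i / (a i - z)).

(** [Q] selects the pairs whose cross factor is present, so that a single factor can be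
    removed once its denominator is cancelled. *)
Definition integrand Q (n : 'I_k -> nat) S (z : 'I_k -> C) : C :=
  cross Q z * (\prod_(j < k) (phi (n j) (z j) / z j)) * S z.

Lemma integrand_good (Ks : 'I_k -> set C^o) (Q : pred ('I_k * 'I_k)) (n : 'I_k -> nat) S :
  (forall A, compact (Ks A)) -> (forall A, ~ Ks A 0) -> (forall A i, ~ Ks A (a i)) ->
  (forall p : 'I_k * 'I_k, (p.1 < p.2)%N -> Q p ->
    forall z w, Ks p.1 z -> Ks p.2 w -> z != q * w) ->
  laurent S -> good (@ffdist R k) (boxset Ks) (integrand Q n S).
Proof.
move=> cK K0 Ka sep [gS _]; apply: good_mul; last exact: gS.
have gc A := good_coord A cK.
apply: good_mul; apply: good_prod.
- move=> [A B] /andP[/= AB QAB]; apply: good_mul; first exact: good_sub.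
  have [c c0 hc] := compact_separated (cK A) (cK B) (sep (A, B) AB QAB).
  apply: (good_inv c0); first by move=> z Kz; exact: hc.
  by apply: good_sub => //; exact: good_scale.
- move=> j _; apply: good_mul; last exact: (laurent_coordV j).1.
  apply: good_prod => i _; apply: good_scale.
  have [c c0 hc] := compact_far (cK j) (Ka j i).
  apply: (good_inv c0); first by move=> z Kz; rewrite cnormB; exact: hc.
  by apply: good_sub => //; exact: good_cst.
Qed.

Lemma rational_on_sub (P P' : C -> Prop) (K : set C) f : (forall p, P p -> P' p) ->
  rational_on P K f -> rational_on P' K f.
Proof. by move=> PP' [h [ps [hp E]]]; exists h, ps; split => // p /hp/PP'. Qed.

(** In one variable the poles are the [0] of [1 / z_l], the [a_i] of the factor [phi], and
    those of the cross factors, at [q z_B] for the inner and at [z_A / q] for the outer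
    contours. *)
Lemma integrand_rational (P : C -> Prop) (K : set C) (l : 'I_k) z (Q : pred ('I_k * 'I_k))
    (n : 'I_k -> nat) S :
  q != 0 -> laurent S -> ~ K 0 -> P 0 -> (forall i : 'I_N, (i < n l)%N -> P (a i)) ->
  (forall B : 'I_k, (l < B)%N -> Q (l, B) -> P (q * z B)) ->
  (forall A : 'I_k, (A < l)%N -> Q (A, l) -> P (z A / q)) ->
  rational_on P K (fun w => integrand Q n S (upd z l w)).
Proof.
move=> q0 [_ rS] K0 P0 Pa PB PA.
have updE w : upd z l w l = w by rewrite /upd eqxx.
have updN w j : j != l -> upd z l w j = z j by rewrite /upd => /negPf ->.
apply: rational_mul; last by apply: rational_on_sub (rS l z K K0) => p ->.
apply: rational_mul; apply: rational_prod.
- move=> [A B] /andP[/= AB QAB].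
  have [Al|Al] := eqVneq A l.
    have Bl : B != l by rewrite -Al gt_eqF.
    subst A; apply: (@rational_ext _ _ _ (fun w => (w + - z B) * (w - q * z B)^-1)).
      by move=> w _; rewrite updE updN.
    apply: rational_mul; last by apply: rational_pole; exact: PB.
    by apply: rational_ext (rational_poly _ _ ('X - (z B)%:P)) => w _; rewrite !hornerE.
  have [Bl|Bl] := eqVneq B l.
    subst B; apply: (@rational_ext _ _ _ (fun w => (z A - w) * - q^-1 * (w - z A / q)^-1)).
      move=> w _; rewrite updE updN//.
      rewrite -mulrA; congr (_ * _); rewrite -[z A in LHS](divfK q0).
      by rewrite mulrC -mulrBr invfM -opprB invrN mulrN mulNr.
    apply: rational_mul; last by apply: rational_pole; exact: PA.
    apply: rational_mul; last exact: rational_cst.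
    by apply: rational_ext (rational_poly _ _ ((z A)%:P - 'X)) => w _; rewrite !hornerE.
  apply: rational_ext (rational_cst _ _ ((z A - z B) / (z A - q * z B))) => w _.
  by rewrite !updN.
- move=> j _; have [jl|jl] := eqVneq j l; last first.
    by apply: rational_ext (rational_cst _ _ (phi (n j) (z j) / z j)) => w _; rewrite updN.
  subst j; apply: (@rational_ext _ _ _ (fun w => phi (n l) w * (w - 0)^-1)).
    by move=> w _; rewrite updE subr0.
  apply: rational_mul; last exact: rational_pole.
  apply: rational_prod => i il.
  apply: (@rational_ext _ _ _ (fun w => - a i * (w - a i)^-1)).
    by move=> w _; rewrite -opprB invrN mulrN mulNr.
  by apply: rational_mul; [exact: rational_cst|apply: rational_pole; exact: Pa].
Qed.

(** Transposing two neighbours permutes the remaining cross factors, as no other pair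
    changes its order. *)
Lemma cross_tperm (Q : pred ('I_k * 'I_k)) (i j : 'I_k) z : val j = i.+1 -> (forall p, Q p = (p != (i, j))) ->
  cross Q (fun l => z (tperm i j l)) = cross Q z.
Proof.
move=> ji EQ; rewrite /cross.
pose s (p : 'I_k * 'I_k) := (tperm i j p.1, tperm i j p.2).
have sK : involutive s by move=> [A B]; rewrite /s/= !tpermK.
rewrite [RHS](reindex_inj (inv_inj sK))/=; apply: eq_bigl => -[A B] /=.
have tE x : tperm i j x = (if x == i :> nat then i.+1 else if x == i.+1 :> nat then i : nat else x) :> nat.
  case: tpermP => [->|->|/eqP xi /eqP xj]; rewrite ?eqxx//.
    by rewrite ji eqxx gtn_eqF.
  by move: xi xj; rewrite -!val_eqE /= ji => /negPf -> /negPf ->.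
rewrite !EQ /s/= !xpair_eqE -!val_eqE /= !tE ji.
by do !case: eqP => ?; lia.
Qed.

End integrands.

Section winding_numbers.
Context (R : realType).
Local Notation C := (R[i]).

Definition period : C := 2%:R * pi%:C * 'i%C.

Lemma period_neq0 : period != 0.
Proof.
rewrite !mulf_neq0 ?pnatr_eq0//.
  by apply/eqP => -[/eqP]; rewrite gt_eqF// pi_gt0.
by apply/eqP => -[/eqP]; rewrite oner_eq0.
Qed.

Lemma winding_interior (g : R -> C^o) w : contour g -> contour_interior g w ->
  contour_integral g (fun z => (z - w)^-1) = period.
Proof.
move=> [_ _ _ h] /h; rewrite /winding_number -/period => /(congr1 (fun x => period * x)).
by rewrite mulrA divff ?period_neq0// mul1r mulr1.
Qed.

Lemma cnorm_continuous : continuous (fun z : C^o => cnorm z).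
Proof.
move=> z; apply/(@cvgrPdist_lt _ _ _ _ (nbhs_filter z)) => e e0.
apply/nbhs_ballP; exists e%:C; first by rewrite /= ltcR.
move=> w; rewrite /ball/= cnorm_normE ltcR; apply: le_lt_trans.
have := cnorm_distD z w 0; have := cnorm_distD w z 0; rewrite !subr0 (cnormB w) => h1 h2.
by rewrite ler_norml; apply/andP; split; lra.
Qed.

(** A curve that encloses [q] times another one lies, divided by [q], outside the latter:
    its point of largest modulus can be joined to infinity.  By connectedness of the
    curve the same holds for its other points. *)
Lemma winding_outer (g g' : R -> C^o) (q : C) : q != 0 ->
  piecewise_C1 g -> piecewise_C1 g' -> g' 0 = g' 1 ->
  ~ trace g 0 -> (forall z, trace g' z -> contour_interior g (q * z)) ->
  forall z, trace g z -> ~ trace g' (z / q) /\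
    contour_integral g' (fun x => (x - z / q)^-1) = 0.
Proof.
move=> q0 hg hg' g'01 g0 nest.
have off z : trace g z -> ~ trace g' (z / q).
  by move=> gz /nest[]; rewrite mulrC divfK.
pose B : set C^o := (fun z => z / q) @` trace g.
have cB : connected B.
  apply: connected_continuous_connected; first exact: trace_connected.
  by apply: continuous_subspaceT => z; apply: (@cvg_scaleC R _ (nbhs z) (nbhs_filter z)); exact: cvg_id.
have Boff z : B z -> ~ trace g' z by move=> [x gx <-]; exact: off.
have [z0 gz0 maxz0] : exists2 z0, trace g z0 & forall z, trace g z -> cnorm z <= cnorm z0.
  have [||| z0 /set_mem ? h] := @compact_EVT_max _ R (fun z : C^o => cnorm z) (trace g).
  - by exists (g 0); apply: trace_itv; rewrite lexx ler01.
  - exact: trace_compact.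
  - by apply: continuous_subspaceT; exact: cnorm_continuous.
  - by exists z0 => // z gz; apply: h; exact: mem_set.
have z00 : z0 != 0 by apply/eqP => z00; apply: g0; rewrite -z00.
have W0 : contour_integral g' (fun x => (x - z0 / q)^-1) = 0.
  apply: winding_ray => //; first by rewrite mulf_neq0// invr_eq0.
  move=> _ [s s1 ->] /nest.
  have -> : q * (s%:C * (z0 / q)) = s%:C * z0 by rewrite mulrCA [q * _]mulrC divfK.
  have [->|s_neq1] := eqVneq s 1; first by rewrite mul1r => -[].
  move=> /(interior_cnorm maxz0); rewrite cnormM cnormR ger0_norm ?(le_trans ler01)//.
  rewrite -[leRHS]mul1r ler_pM2r ?cnorm_gt0// => s1'.
  by move/eqP: s_neq1; apply; apply/eqP; rewrite eq_le s1 s1'.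
move=> z gz; split; first exact: off.
by rewrite -W0; apply: (winding_connected hg' g'01 cB Boff); [exists z0|exists z].
Qed.

End winding_numbers.

(** * Nested contours *)

Section nested.
Context (R : realType) (N k : nat).
Local Notation C := (R[i]).
Context (q : R) (a : 'I_N -> R) (g : 'I_k -> R -> C^o).
Hypothesis q01 : 0 < q < 1.
Hypothesis hg : nested_contours q a g.
Local Notation qc := (q%:C).
Local Notation ac := (fun i => (a i)%:C).
Local Notation K A := (trace (g A)).
Local Notation J A := (contour_integral (g A)).

Lemma qc_neq0 : qc != 0.
Proof. by apply/eqP => -[/eqP]; rewrite gt_eqF//; case/andP: q01. Qed.

Lemma nested_piecewise A : piecewise_C1 (g A).
Proof. by case: hg => /(_ A)[]. Qed.

Lemma nested_closed A : g A 0 = g A 1.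
Proof. by case: hg => /(_ A)[]. Qed.

Lemma nested_functional A : functional (@cdist R) (K A) (J A).
Proof. exact/contour_integral_functional/nested_piecewise. Qed.

Lemma nested_compact A : compact (K A).
Proof. exact/trace_compact/nested_piecewise. Qed.

Lemma nested_0 A : ~ K A 0.
Proof. by case: hg => _ _ _ /(_ A) h KA; apply: h; left. Qed.

Lemma nested_a A i : ~ K A (a i)%:C.
Proof. by case: hg => _ /(_ A i)[]. Qed.

Lemma nested_inside (A B : 'I_k) z : (A < B)%N -> K B z -> ~ K A (qc * z).
Proof. by case: hg => _ _ h _ AB /(h _ _ AB)[]. Qed.

Lemma winding_0 A : J A (fun z => (z - 0)^-1) = 0.
Proof.
case: (hg) => _ _ _ /(_ A); apply: winding_exterior; first exact: nested_piecewise.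
exact: nested_closed.
Qed.

Lemma winding_a A i : J A (fun z => (z - (a i)%:C)^-1) = period R.
Proof. by case: (hg) => /(_ A) h1 /(_ A i) h2 _ _; exact: winding_interior. Qed.

Lemma winding_inside (A B : 'I_k) z : (A < B)%N -> K B z ->
  J A (fun x => (x - qc * z)^-1) = period R.
Proof.
case: (hg) => /(_ A) h1 _ h _ AB Kz; apply: winding_interior => //; exact: h Kz.
Qed.

Lemma winding_outside (A B : 'I_k) z : (A < B)%N -> K A z ->
  ~ K B (z / qc) /\ J B (fun x => (x - z / qc)^-1) = 0.
Proof.
move=> AB; case: (hg) => _ _ h _.
apply: (winding_outer qc_neq0 (nested_piecewise A) (nested_piecewise B)
  (nested_closed B) (@nested_0 A)).
exact: h.
Qed.

Local Notation integrand := (@integrand R N k qc ac).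

Definition moment_integral (n : 'I_k -> nat) S :=
  iter_functional (fun A => J A) (integrand predT n S).

Lemma nested_sep (p : 'I_k * 'I_k) : (p.1 < p.2)%N ->
  forall z w, K p.1 z -> K p.2 w -> z != qc * w.
Proof.
by move=> AB z w Kz Kw; apply/eqP => zw; apply: (nested_inside AB Kw); rewrite -zw.
Qed.

Lemma nested_integrand_good Q n S : laurent S ->
  good (@ffdist R k) (boxset (fun A => K A)) (integrand Q n S).
Proof.
apply: integrand_good => [A|A|A i|p AB _ z w].
- exact: nested_compact.
- exact: nested_0.
- exact: nested_a.
- exact: nested_sep.
Qed.

Lemma moment_integral_functional :
  functional (@ffdist R k) (boxset (fun A => K A)) (iter_functional (fun A => J A)).
Proof. exact/iter_functionalP/nested_functional. Qed.

Lemma moment_integral_ext n n' S S' :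
  (forall z, boxset (fun A => K A) z -> integrand predT n S z = integrand predT n' S' z) ->
  moment_integral n S = moment_integral n' S'.
Proof. by move=> h; apply: (functional_ext moment_integral_functional h). Qed.

Lemma moment_integralD n S S' : laurent S -> laurent S' ->
  moment_integral n (fun z => S z + S' z) = moment_integral n S + moment_integral n S'.
Proof.
move=> hS hS'; rewrite /moment_integral.
rewrite -(functionalD moment_integral_functional); try exact: nested_integrand_good.
by congr iter_functional; apply/funext => z; rewrite /integrand mulrDr.
Qed.

Lemma moment_integralZ n c S : laurent S ->
  moment_integral n (fun z => c * S z) = c * moment_integral n S.
Proof.
move=> hS; rewrite /moment_integral.
rewrite -(functionalZ moment_integral_functional); last exact: nested_integrand_good.
by congr iter_functional; apply/funext => z; rewrite /integrand mulrCA.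
Qed.

Lemma moment_integral_sum n (I : Type) (s : seq I) f : (forall i, laurent (f i)) ->
  moment_integral n (fun z => \sum_(i <- s) f i z) = \sum_(i <- s) moment_integral n (f i).
Proof.
move=> hf; rewrite -(functional_sum moment_integral_functional) => [|i].
  by congr iter_functional; apply/funext => z; rewrite /integrand mulr_sumr.
exact: nested_integrand_good.
Qed.

Let JX A := contour_integral_pow (nested_piecewise A) (nested_closed A).
Let JV A := contour_integral_inv_pow (nested_piecewise A) (nested_closed A).
Let bK A := compact_cnorm_bounded (@nested_compact A).

(** With [n l = 0] there is no pole at the [a_i], and the poles [z_A / q] of the outer
    variables lie outside the innermost contour. *)
Lemma moment_integral_eq0 n S (l : 'I_k) : val l = k.-1 -> n l = 0%N -> laurent S ->
  moment_integral n S = 0.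
Proof.
move=> lk nl hS.
apply: (iter_functional_eq0 (i := l) nested_functional
  (compact_totally_bounded (@nested_compact l)) (nested_integrand_good _ _ hS)) => z Kz.
pose P p := far (K l) p /\ J l (fun x => (x - p)^-1) = 0.
apply: (@functional_rational_on _ (K l) _ P) => //; first exact: nested_functional.
  by move=> p m; exact: JV.
apply: integrand_rational; first exact: qc_neq0.
- exact: hS.
- exact: nested_0.
- by split; [exact: compact_far (@nested_compact l) (@nested_0 l)|exact: winding_0].
- by move=> i; rewrite nl.
- by move=> B; have := ltn_ord B; rewrite lk; lia.
- move=> A Al _; have Alne : A != l by rewrite -val_eqE ltn_eqF.
  have [h1 h2] := winding_outside Al (Kz A Alne).
  by split => //; exact: compact_far (@nested_compact l) h1.
Qed.

(** For neighbours with [n i = n j], the factor [z i - q * z j] cancels the only pole which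
    separates the two contours.  All the other poles are either inside both or outside
    both, so that the contour of [z i] may be replaced by that of [z j]; the integrand is
    then antisymmetric in the two variables. *)
Lemma moment_integral_boundary n S (i j : 'I_k) : val j = i.+1 -> n i = n j ->
  laurent S -> (forall z, S (fun l => z (tperm i j l)) = S z) ->
  moment_integral n (fun z => (z i - qc * z j) * S z) = 0.
Proof.
move=> ji nij hS symS; have ij : (i < j)%N by rewrite ji.
have ij_neq : i != j by rewrite -val_eqE ltn_eqF.
pose Q : pred ('I_k * 'I_k) := fun p => p != (i, j).
pose S' (z : 'I_k -> C) := (z i - z j) * S z.
have hS' : laurent S'.
  by apply: laurentM => //; apply: laurentB; exact: laurent_coord.
pose G := integrand Q n S'.
have -> : moment_integral n (fun z => (z i - qc * z j) * S z) = iter_functional (fun A => J A) G.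
  apply: (functional_ext moment_integral_functional) => z Kz.
  rewrite /G /integrand /S' /cross [in LHS](bigD1 (i, j)) ?ij//=.
  have zij : z i - qc * z j != 0 by rewrite subr_eq0; exact: (@nested_sep (i, j)).
  set X := \prod_(p | _) _; set Y := \prod_(l < k) _; set X' := \prod_(p | _) _.
  have -> : X = X' by apply: eq_bigl => p; rewrite andbT.
  by field.
pose Kij := K i `|` K j : set C^o.
(* During the deformation [z i] ranges over the union of the two traces. *)
pose Ks A : set C^o := if A == i then Kij else K A.
have KsK A : K A `<=` Ks A by rewrite /Ks; case: eqP => [->|_]; [left|].
have cKs A : compact (Ks A).
  by rewrite /Ks; case: eqP => _; [apply: compactU|]; exact: nested_compact.
have Ks_or A z : Ks A z -> exists2 A', (A' == A) || ((A == i) && (A' == j)) & K A' z.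
  rewrite /Ks; case: eqP => [->|_]; last by exists A => //; rewrite eqxx.
  by move=> [Kz|Kz]; [exists i|exists j] => //; rewrite eqxx// orbT.
have Ks0 A : ~ Ks A 0 by move=> /Ks_or[A' _]; exact: nested_0.
have Ksa A l : ~ Ks A (a l)%:C by move=> /Ks_or[A' _]; exact: nested_a.
have gG : good (@ffdist R k) (boxset Ks) G.
  apply: integrand_good hS' => // -[A B] /= AB QAB z w /Ks_or[A' hA Kz] /Ks_or[B' hB Kw].
  apply: (@nested_sep (A', B')) => //=.
  move: hA hB QAB AB; rewrite /Q xpair_eqE -!val_eqE /= ji.
  by lia.
have fKs A : functional (@cdist R) (Ks A) (J A).
  by apply: (functional_sub_set (nested_functional A)); exact: KsK.
have Ksi : Ks i = Kij by rewrite /Ks eqxx.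
have fJi : functional (@cdist R) (Ks i) (J i) := fKs i.
have fJj : functional (@cdist R) (Ks i) (J j).
  by apply: (functional_sub_set (nested_functional j)) => z; rewrite Ksi; right.
rewrite (iter_functional_replace fKs fJj (compact_totally_bounded (cKs i)) gG); last first.
  move=> z Kz; apply/eqP; rewrite -subr_eq0; apply/eqP.
  pose D f := J i f - J j f.
  pose P p := far (Ks i) p /\ D (fun x => (x - p)^-1) = 0.
  apply: (@functional_rational_on _ (Ks i) D P).
  - exact: compact_cnorm_bounded.
  - exact: functional_sub.
  - by move=> m; rewrite /D !JX subrr.
  - move=> p m [c c0 hc]; rewrite /D !JV ?subrr//.
      by exists c => // x Kx; apply: hc; rewrite Ksi; right.
    by exists c => // x Kx; apply: hc; rewrite Ksi; left.
  - by move=> p [].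
  have KzK A : A != i -> K A (z A) by move=> Ai; have := Kz A Ai; rewrite /Ks (negPf Ai).
  have farP p : ~ K i p -> ~ K j p -> far (Ks i) p.
    by move=> hi hj; apply: compact_far => //; rewrite Ksi => -[].
  apply: integrand_rational; first exact: qc_neq0.
  - exact: hS'.
  - exact: Ks0.
  - split; first exact: compact_far (cKs i) (Ks0 i).
    by rewrite /D !winding_0 subrr.
  - move=> l _; split; first exact: compact_far (cKs i) (Ksa i l).
    by rewrite /D !winding_a subrr.
  - move=> B iB; rewrite /Q xpair_eqE eqxx/= -val_eqE/= ji => Bj.
    have jB : (j < B)%N by rewrite ji; lia.
    have KB : K B (z B) by apply: KzK; rewrite -val_eqE gtn_eqF.
    split; first by apply: farP; exact: nested_inside KB.
    by rewrite /D (winding_inside iB KB) (winding_inside jB KB) subrr.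
  - move=> A Ai _; have Aj : (A < j)%N by rewrite ji; lia.
    have KA : K A (z A) by apply: KzK; rewrite -val_eqE ltn_eqF.
    have [h1 h2] := winding_outside Ai KA; have [h3 h4] := winding_outside Aj KA.
    by split; [exact: farP|rewrite /D h2 h4 subrr].
pose Ks' A : set C^o := if A == i then K j else K A.
pose Js' A := if A == i then J j else J A.
have fKs' A : functional (@cdist R) (Ks' A) (Js' A).
  by rewrite /Ks' /Js'; case: eqP => _; exact: nested_functional.
have eJ : Js' i = Js' j by rewrite /Js' eqxx eq_sym (negPf ij_neq).
have eK : Ks' i = Ks' j by rewrite /Ks' eqxx eq_sym (negPf ij_neq).
have tb : totally_bounded (Ks' i).
  by rewrite /Ks' eqxx; exact/compact_totally_bounded/nested_compact.
have gG' : good (@ffdist R k) (boxset Ks') G.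
  by apply: good_sub_set gG => z Kz A; have := Kz A; rewrite /Ks /Ks'; case: eqP => // _; right.
refine (iter_functional_antisym fKs' ji eJ eK tb gG' _).
move=> z _; rewrite /G /integrand (cross_tperm _ z ji)//.
rewrite /S' symS tpermL tpermR -[z j - z i]opprB mulNr mulrN; congr (- (_ * _ * _)).
rewrite [LHS](reindex_inj (@perm_inj _ (tperm i j)))/=; apply: eq_bigr => l _.
by rewrite tpermK; congr (phi _ _ _ / _); case: tpermP => [->|->|].
Qed.

End nested.

(** * The integrals solve the dual equations *)

Section dual_recursion.
Context (R : realType) (N k : nat).
Local Notation C := (R[i]).
Context (q : R) (a : 'I_N -> R) (rR rL : R) (g : 'I_k -> R -> C^o).
Hypothesis q01 : 0 < q < 1.
Hypothesis a0 : forall i, 0 < a i.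
Hypothesis hg : nested_contours q a g.
Local Notation qc := (q%:C).
Local Notation ac := (fun i => (a i)%:C).
Local Notation K A := (trace (g A)).
Local Notation state := {ffun 'I_k -> 'I_N.+1}.
Local Notation box := (boxset (fun A => K A)).
Local Notation state_integrand n S := (@integrand R N k qc ac predT (fun p => n p : nat) S).

Definition state_integral (n : state) S := moment_integral q a g (fun p => n p : nat) S.
Local Notation I := state_integral.

Definition symmetric_fun (S : ('I_k -> C) -> C) :=
  forall i j z, S (fun l => z (tperm i j l)) = S z.

Context (S : ('I_k -> C) -> C).
Hypotheses (hS : laurent S) (symS : symmetric_fun S).

Let q0 : qc != 0 := qc_neq0 q01.

Lemma box_neq0 z l : box z -> z l != 0.
Proof. by move=> /(_ l) h; apply/eqP => z0; apply: (nested_0 hg (A := l)); rewrite -z0. Qed.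

Lemma box_neq_a z l i : box z -> (a i)%:C - z l != 0.
Proof.
move=> /(_ l) h; rewrite subr_eq0; apply/eqP => za.
by apply: (nested_a hg (A := l) (i := i)); rewrite za.
Qed.

Lemma laurent_coordM l : laurent (fun z : 'I_k -> C => z l * S z).
Proof. by apply: laurentM => //; exact: laurent_coord. Qed.

Lemma laurent_coordVM l : laurent (fun z : 'I_k -> C => (z l)^-1 * S z).
Proof. by apply: laurentM => //; exact: laurent_coordV. Qed.

(** The relation [moment_integral_boundary], applied to [S] and to [S / (z l * z l')]. *)
Lemma cluster_step (n : state) (l l' : 'I_k) : val l' = l.+1 -> n l = n l' ->
  I n (fun z => z l * S z) = qc * I n (fun z => z l' * S z) /\
  I n (fun z => (z l)^-1 * S z) = qc^-1 * I n (fun z => (z l')^-1 * S z).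
Proof.
move=> ll' nll'; have nn : nat_of_ord (n l) = n l' by rewrite nll'.
have E (S1 S2 S' : ('I_k -> C) -> C) c : laurent S1 -> laurent S2 -> laurent S' ->
    (forall z, S' (fun m => z (tperm l l' m)) = S' z) ->
    (forall z, box z -> (z l - qc * z l') * S' z = S1 z - c * S2 z) ->
    I n S1 = c * I n S2.
  move=> h1 h2 h' s' e; have := moment_integral_boundary (n := fun p => nat_of_ord (n p)) q01 hg ll' nn h' s'.
  have -> : moment_integral q a g (fun p => n p : nat) (fun z => (z l - qc * z l') * S' z) =
      I n (fun z => S1 z + - c * S2 z).
    by apply: (moment_integral_ext hg) => z Kz; rewrite /integrand e// mulNr.
  rewrite /I (moment_integralD hg)//; last exact: laurentZ.
  by rewrite (moment_integralZ hg)// mulNr => /eqP; rewrite subr_eq0 => /eqP.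
split.
  apply: (E _ _ S) => //; [exact: laurent_coordM|exact: laurent_coordM|].
  by move=> z _; ring.
apply: (mulfI q0); rewrite mulVKf//; apply/esym.
apply: (E _ _ (fun z => (z l)^-1 * (z l')^-1 * S z)).
- exact: laurent_coordVM.
- exact: laurent_coordVM.
- by apply: laurentM => //; apply: laurentM; exact: laurent_coordV.
- by move=> z; rewrite symS tpermL tpermR [_^-1 * _^-1]mulrC.
- move=> z Kz; have := box_neq0 l Kz; have := box_neq0 l' Kz => h h'.
  by field; rewrite h h'.
Qed.

Lemma cluster_reduce (n : state) v (l p : 'I_k) : sorted_state n -> n l = v :> nat ->
  p.+1 = count_ge n v ->
  I n (fun z => z l * S z) = qc ^+ (count_ge n v - l.+1) * I n (fun z => z p * S z) /\
  I n (fun z => (z l)^-1 * S z) = qc^-1 ^+ (count_ge n v - l.+1) * I n (fun z => (z p)^-1 * S z).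
Proof.
move=> sn nl pE; have [m mE] : exists m, (count_ge n v - l.+1)%N = m by eexists.
elim: m l mE nl => [|m IH] l mE nl; rewrite mE.
  have -> : l = p; last by rewrite !expr0 !mul1r.
  apply: val_inj; have := lt_count_ge sn l v; rewrite nl leqnn => ltl /=; lia.
have ltk : (l.+1 < k)%N by have := ltn_ord p; lia.
pose l' := Ordinal ltk.
have nl' : n l' = v :> nat.
  apply/eqP; rewrite (state_eq sn) /=; move/eqP: nl; rewrite (state_eq sn) => /andP[]; lia.
have [|-> ->] := @cluster_step n l l' erefl; first by apply: val_inj; rewrite /= nl nl'.
have mE' : (count_ge n v - l'.+1)%N = m by rewrite /=; lia.
by have [-> ->] := IH l' mE' nl'; rewrite mE' !exprS !mulrA.
Qed.

Lemma phiS (z : C) v (vN : (v < N)%N) : (a (Ordinal vN))%:C - z != 0 ->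
  phi ac v z = (1 - z / (a (Ordinal vN))%:C) * phi ac v.+1 z.
Proof.
move=> az; have av0 : (a (Ordinal vN))%:C != 0.
  by apply/eqP => -[/eqP]; rewrite gt_eqF.
rewrite /phi [in RHS](bigD1 (Ordinal vN)) ?ltnSn//= mulrA.
rewrite (_ : (1 - _) * _ = 1) ?mul1r; last by field; rewrite av0 az.
apply: eq_bigl => i; rewrite ltnS -val_eqE /=; lia.
Qed.

Lemma integrand_dec (n : state) v (vN : (v < N)%N) (p : 'I_k) S' z : sorted_state n ->
  (0 < count_eq n v.+1)%N -> p.+1 = count_ge n v.+1 -> box z ->
  state_integrand (dec v.+1 n) S' z =
  (1 - z p / (a (Ordinal vN))%:C) * state_integrand n S' z.
Proof.
move=> sn v0 pE Kz; rewrite /integrand mulrA [_ * (_ * _)]mulrCA; congr (_ * _ * _).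
rewrite (bigD1 p)//= [in RHS](bigD1 p)//= mulrA; congr (_ * _).
  have [p' p'E np] := last_position sn v0.
  have pp' : p = p' by apply: val_inj; apply: succn_inj; rewrite pE p'E.
  rewrite decE// pE eqxx pp' np mulrA -phiS//.
  exact: box_neq_a.
apply: eq_bigr => j jp; rewrite decE// -pE eqSS; case: eqP => // /val_inj jp'.
by rewrite jp' eqxx in jp.
Qed.

Lemma state_integral_dec (n : state) v (vN : (v < N)%N) (p : 'I_k) S' : laurent S' -> sorted_state n ->
  (0 < count_eq n v.+1)%N -> p.+1 = count_ge n v.+1 ->
  I (dec v.+1 n) S' = I n S' - ((a (Ordinal vN))%:C)^-1 * I n (fun z => z p * S' z).
Proof.
move=> hS' sn v0 pE; set av := (a _)%:C.
have lp : laurent (fun z : 'I_k -> C => z p * S' z) by apply: laurentM => //; exact: laurent_coord.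
rewrite /I -mulNr -(moment_integralZ hg)// -(moment_integralD hg)//; last exact: laurentZ.
apply: (moment_integral_ext hg) => z Kz; rewrite (integrand_dec vN _ sn v0 pE Kz).
rewrite /integrand -/av; ring.
Qed.

(** By induction on [v]: [1 / z_p = (1 / z_p) (1 - z_p / a_v) + 1 / a_v], where the first
    term belongs to the state lowered at [p]; there [p] is the first particle of the group
    of level [v - 1], and [cluster_reduce] passes to the last one.  At level [0] the
    integral vanishes. *)
Lemma left_terms_integral v (n : state) (p : 'I_k) : (v <= N)%N -> sorted_state n ->
  (0 < count_eq n v)%N -> p.+1 = count_ge n v ->
  I n (fun z => (z p)^-1 * S z) = apply_terms (left_terms qc ac v n) (fun m => I m S).
Proof.
elim: v n p => [|v IH] n p vN sn v0 pE.
  rewrite /apply_terms big_nil; apply: (moment_integral_eq0 q01 hg (l := p)).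
  - by move: pE; rewrite count_ge0 => e; apply: succn_inj; rewrite e prednK// -e.
  - by apply/eqP; rewrite (state_eq sn); have := count_geS n 0; lia.
  - exact: laurent_coordVM.
have [p1 p1E np1] := last_position (dec_sorted sn v0) (count_eq_dec sn v0).
have cdec : count_ge (dec v.+1 n) v = count_ge n v.
  by rewrite count_ge_dec// ltn_eqF.
have ndp : dec v.+1 n p = v :> nat by rewrite decE// pE eqxx.
have [_ E2] := cluster_reduce (dec_sorted sn v0) ndp p1E.
rewrite apply_left_termsS -(IH _ p1)//; [|exact: ltnW|exact: dec_sorted|exact: count_eq_dec].
have -> : qc ^- count_eq n v = qc^-1 ^+ (count_ge (dec v.+1 n) v - p.+1).
  rewrite exprVn cdec pE; congr (_ ^- _); have := count_geS n v; lia.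
rewrite -E2 (state_integral_dec vN (p := p))//; last exact: laurent_coordVM.
have -> : rate_at ac v = (a (Ordinal vN))%:C by rewrite -(rate_atE ac (Ordinal vN)).
rewrite [X in _ - _ * X](_ : _ = I n S); first by rewrite addrC subrK.
apply: (moment_integral_ext hg) => z Kz; rewrite /integrand; congr (_ * _).
by rewrite mulVKf// box_neq0.
Qed.

(** The geometric sum over a group of equal levels: this is the origin of the rates
    [1 - q ^ y] and [q ^ - y - 1] of the dual system. *)
Lemma cluster_sum (F : fieldType) (x : F) (n : state) v : sorted_state n ->
  (x - 1) * \sum_(l < k | n l == v :> nat) x ^+ (count_ge n v - l.+1) = x ^+ count_eq n v - 1.
Proof.
move=> sn; rewrite subrX1; congr (_ * _).
under eq_bigl do rewrite (state_eq sn).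
have cS := count_geS n v; have ck : (count_ge n v <= k)%N.
  by rewrite -[leqRHS](card_ord k) max_card.
rewrite (eq_bigl (fun l : 'I_k => (count_ge n v.+1 <= l)%N && (l < count_ge n v)%N)); last by [].
rewrite -(big_ord_widen_cond k (fun l => count_ge n v.+1 <= l)%N (fun l => x ^+ (count_ge n v - l.+1)))//.
rewrite -(big_mkord (fun l => count_ge n v.+1 <= l)%N (fun l => x ^+ (count_ge n v - l.+1))).
rewrite (big_cat_nat (n := count_ge n v.+1))//=; last by lia.
rewrite big_nat_cond big1 ?add0r => [|l]; last by lia.
rewrite -{1}[count_ge n v.+1]add0n big_addn big_mkcond/= big_mkord.
rewrite (_ : (count_ge n v - count_ge n v.+1)%N = count_eq n v); last by lia.
rewrite (reindex_inj rev_ord_inj)/=; apply: eq_bigr => i _.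
rewrite leq_addl; congr (_ ^+ _); have := ltn_ord i; lia.
Qed.

Definition weight (z : C) : C := rR%:C * (qc - 1) * z + rL%:C * (qc^-1 - 1) * z^-1.

Lemma weight_laurent : laurent (fun z : 'I_k -> C => \sum_(l < k) weight (z l)).
Proof.
apply: laurent_sum => l; apply: laurentD; apply: laurentZ.
  exact: laurent_coord.
exact: laurent_coordV.
Qed.

Lemma weight_symmetric : symmetric_fun (fun z => \sum_(l < k) weight (z l)).
Proof.
move=> i j z; rewrite [LHS](reindex_inj (@perm_inj _ (tperm i j)))/=.
by apply: eq_bigr => l _; rewrite tpermK.
Qed.

(** The sum over the variables is grouped by level.  In each group [cluster_reduce] reduces
    to the last variable [z_p], with a geometric sum as coefficient; multiplication by
    [z_p] is a difference of integrals by [state_integral_dec], division by [z_p] is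
    [left_terms_integral]. *)
Lemma dual_integral (n : state) : sorted_state n ->
  I n (fun z => (\sum_(l < k) weight (z l)) * S z) =
  dual qc ac rR%:C rL%:C (fun m => I m S) n.
Proof.
move=> sn; rewrite dualE.
have -> : I n (fun z => (\sum_(l < k) weight (z l)) * S z) = \sum_(l < k)
    (rR%:C * (qc - 1) * I n (fun z => z l * S z) +
     rL%:C * (qc^-1 - 1) * I n (fun z => (z l)^-1 * S z)).
  transitivity (I n (fun z => \sum_(l < k) (rR%:C * (qc - 1) * (z l * S z) +
      rL%:C * (qc^-1 - 1) * ((z l)^-1 * S z)))).
    congr (I n _); apply/funext => z; rewrite mulr_suml; apply: eq_bigr => l _.
    by rewrite /weight mulrDl !mulrA.
  rewrite /I (moment_integral_sum hg) => [|l]; last first.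
    by apply: laurentD; apply: laurentZ; [exact: laurent_coordM|exact: laurent_coordVM].
  apply: eq_bigr => l _; rewrite (moment_integralD hg).
  - by rewrite !(moment_integralZ hg)//; [exact: laurent_coordVM|exact: laurent_coordM].
  - by apply: laurentZ; exact: laurent_coordM.
  - by apply: laurentZ; exact: laurent_coordVM.
rewrite (partition_big (fun l => n l) xpredT)//= big_ord_recl big1 ?add0r => [|l /eqP nl]; last first.
  have v0 : (0 < count_eq n 0)%N by apply/card_gt0P; exists l; rewrite inE nl.
  have [p pE np] := last_position sn v0.
  have pk : val p = k.-1 by move: pE; rewrite count_ge0 => e; apply: succn_inj; rewrite e prednK// -e.
  rewrite /I !(moment_integral_eq0 q01 hg pk np) ?mulr0 ?addr0//.
    exact: laurent_coordVM.
  exact: laurent_coordM.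
rewrite [RHS]big_mkcond/=; apply: eq_bigr => v _.
rewrite (eq_bigl (fun l => n l == v.+1 :> nat)); last by move=> l; rewrite -val_eqE.
case: ifP => [v0|/negbT]; last first.
  rewrite -leqNgt leqn0 cards_eq0 => /eqP/setP e; rewrite big1// => l nl.
  by have := e l; rewrite !inE nl.
have [p pE np] := last_position sn v0.
transitivity (rR%:C * ((qc - 1) * \sum_(l < k | n l == v.+1 :> nat) qc ^+ (count_ge n v.+1 - l.+1)) *
    I n (fun z => z p * S z) +
  rL%:C * ((qc^-1 - 1) * \sum_(l < k | n l == v.+1 :> nat) qc^-1 ^+ (count_ge n v.+1 - l.+1)) *
    I n (fun z => (z p)^-1 * S z)).
  rewrite !mulr_sumr !mulr_suml -big_split/=; apply: eq_bigr => l /eqP nl.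
  by have [-> ->] := cluster_reduce sn nl pE; rewrite !mulrA.
rewrite !cluster_sum// (left_terms_integral _ sn v0 pE)//.
have vE : Ordinal (ltn_ord v) = v by exact: val_inj.
rewrite (state_integral_dec (ltn_ord v) hS sn v0 pE) vE exprVn; congr (_ + _).
have av0 : (a v)%:C != 0 by apply/eqP => -[/eqP]; rewrite gt_eqF.
by field.
Qed.

End dual_recursion.

(** * The integrals at time zero *)

Section normalization.
Context (R : realType) (N : nat) (q : R) (a : 'I_N -> R).
Local Notation C := (R[i]).
Hypothesis q01 : 0 < q < 1.
Hypothesis a0 : forall i, 0 < a i.
Hypothesis N0 : (0 < N)%N.
Local Notation qc := (q%:C).
Local Notation ac := (fun i => (a i)%:C).

Let q0 : qc != 0 := qc_neq0 q01.

Lemma cross_double k (z : 'I_k -> C) : cross qc predT z =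
  \prod_(A < k) \prod_(B < k | (A < B)%N) ((z A - z B) / (z A - qc * z B)).
Proof. by rewrite pair_big_dep /cross; apply: eq_bigl => p; rewrite andbT. Qed.

Lemma cross_vcons k z0 (z : 'I_k -> C) : cross qc predT (vcons z0 z) =
  \prod_(B < k) ((z0 - z B) / (z0 - qc * z B)) * cross qc predT z.
Proof.
rewrite !cross_double big_ord_recl; congr (_ * _).
  rewrite big_mkcond big_ord_recl/= mul1r; apply: eq_bigr => B _.
  by rewrite vcons0 vconsS.
apply: eq_bigr => A _; rewrite big_mkcond big_ord_recl/= mul1r [RHS]big_mkcond.
by apply: eq_bigr => B _; rewrite !vconsS ltnS.
Qed.

Lemma nested_behead k (g : 'I_k.+1 -> R -> C^o) : nested_contours q a g ->
  nested_contours q a (fun i => g (lift ord0 i)).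
Proof.
move=> [h1 h2 h3 h4]; split => [A|A i|A B AB|A]; [exact: h1|exact: h2| |exact: h4].
by apply: h3; rewrite !lift0 ltnS.
Qed.

(** Outside the outermost contour the only pole is [0]; since the integrand is [O(1/w^2)]
    at infinity, its residue there gives the whole integral. *)
Lemma outermost_integral k (g : 'I_k.+1 -> R -> C^o) (n0 : nat) (z : 'I_k -> C) :
  nested_contours q a g -> (0 < n0)%N ->
  (forall B, trace (g (lift ord0 B)) (z B)) ->
  contour_integral (g ord0) (fun w =>
    \prod_(B < k) ((w - z B) / (w - qc * z B)) * (phi ac n0 w / w)) =
  - period R * qc ^- k.
Proof.
move=> hg n00 Kz; set K := trace (g ord0); set J := contour_integral (g ord0).
have hJ : functional (@cdist R) K J := nested_functional hg ord0.
have cK : compact (K : set C^o) := nested_compact hg (A := ord0).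
have bK := compact_cnorm_bounded cK.
have g01 := nested_closed hg ord0; have pg := nested_piecewise hg ord0.
have JX m := contour_integral_pow pg g01 m.
have JV p m := @contour_integral_inv_pow _ _ pg g01 p m.
have zB0 B : z B != 0.
  apply/eqP => z0; apply: (nested_0 hg (A := lift ord0 B)).
  by rewrite -z0; exact: Kz.
pose ps1 := [seq qc * z B | B <- enum 'I_k].
pose ps2 := [seq (a i)%:C | i : 'I_N <- [seq i : 'I_N <- enum 'I_N | (i < n0)%N]].
pose ps := ps1 ++ ps2.
have E1 w : poles_prod ps1 w = \prod_(B < k) (w - qc * z B).
  by rewrite /poles_prod big_map big_enum.
have E2 w : poles_prod ps2 w = \prod_(i < N | (i < n0)%N) (w - (a i)%:C).
  by rewrite /poles_prod big_map big_filter big_enum_cond; apply: eq_bigl => i; rewrite inE.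
have hps : {in ps, forall p, far K p /\ J (fun w => (w - p)^-1) = period R}.
  move=> p; rewrite mem_cat => /orP[/mapP[B _ ->]|/mapP[i _ ->]].
    split; first by apply: compact_far => //; exact: (nested_inside hg (A := ord0) (B := lift ord0 B)).
    exact: (winding_inside hg (A := ord0) (B := lift ord0 B)).
  split; first by apply: compact_far => //; exact: (nested_a hg).
  exact: (winding_a hg).
pose hh : {poly C} := (\prod_(B < k) ('X - (z B)%:P)) * (\prod_(i < N | (i < n0)%N) (- (a i)%:C))%:P.
pose D : {poly C} := \prod_(p <- ps) ('X - p%:P).
have DE w : D.[w] = poles_prod ps w.
  by rewrite horner_prod; apply: eq_bigr => p _; rewrite !hornerE.
have sD : size D = (size ps).+1 by rewrite size_prod_XsubC.
have Dlead : D`_(size ps) = 1.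
  by have /monicP := monic_prod_XsubC ps xpredT id; rewrite /lead_coef sD.
have F1 w : K w -> \prod_(B < k) ((w - z B) / (w - qc * z B)) * (phi ac n0 w / w) =
    hh.[w] / poles_prod ps w / w.
  move=> Kw; rewrite mulrA; congr (_ / _).
  rewrite /hh hornerM hornerC horner_prod poles_prod_cat invfM E1 E2 mulrACA; congr (_ * _).
    rewrite -prodf_div; apply: eq_bigr => B _; by rewrite !hornerE.
  rewrite -prodf_div; apply: eq_bigr => i _.
  by rewrite -[in RHS]opprB invrN mulrNN.
(* The residue at [0]; [h1] is what remains after subtracting this pole. *)
pose r0 := hh.[0] / poles_prod ps 0.
have ps0 : poles_prod ps 0 != 0.
  rewrite poles_prod_cat E1 E2 mulf_neq0//; apply/prodf_neq0 => i _; rewrite sub0r oppr_eq0.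
    by rewrite mulf_neq0.
  by apply/eqP => -[/eqP]; rewrite gt_eqF.
have r0E : r0 = qc ^- k.
  rewrite /r0 /hh hornerM hornerC horner_prod poles_prod_cat invfM E1 E2 mulrACA -!prodf_div.
  rewrite [X in _ * X]big1 ?mulr1 => [|i _]; last first.
    by rewrite sub0r divff// oppr_eq0; apply/eqP => -[/eqP]; rewrite gt_eqF.
  rewrite (eq_bigr (fun=> qc^-1)) => [|B _]; last first.
    rewrite !hornerE -mulrN; have := zB0 B => zB; rewrite invfM mulrCA divff ?mulr1 ?oppr_eq0//.
  by rewrite prodr_const card_ord exprVn.
have [h1 h1E] : exists h1, hh - r0 *: D = h1 * 'X.
  have /factor_theorem[h1 E] : root (hh - r0 *: D) 0.
    by rewrite /root hornerD hornerN hornerZ DE /r0 divfK// subrr.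
  by exists h1; rewrite E subr0.
have sps : (k.+1 <= size ps)%N.
  rewrite /ps /ps1 /ps2 size_cat !size_map -enumT size_enum_ord -addn1 leq_add2l size_filter.
  rewrite -has_count; apply/hasP; exists (Ordinal N0); first by rewrite mem_enum.
  by [].
have shh : (size hh <= size ps)%N.
  apply: leq_trans sps; rewrite /hh mulrC mul_polyC (leq_trans (size_scale_leq _ _))//.
  by rewrite size_prod_XsubC /index_enum -enumT size_enum_ord.
have sh1 : (size h1 <= size ps)%N.
  have [->|h10] := eqVneq h1 0; first by rewrite size_poly0.
  have := size_mulX h10; rewrite -h1E => e.
  rewrite -ltnS -e (leq_trans (size_polyD _ _))// geq_max (leq_trans shh)//= size_polyN.
  by rewrite (leq_trans (size_scale_leq _ _))// sD.
have nw w : K w -> w != 0.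
  by move=> Kw; apply/eqP => w0; apply: (nested_0 hg (A := ord0)); rewrite -w0.
have F2 w : K w -> hh.[w] / poles_prod ps w / w = r0 * (w - 0)^-1 + h1.[w] / poles_prod ps w.
  move=> Kw; have w0 := nw w Kw; have pw : poles_prod ps w != 0.
    rewrite /poles_prod prodf_seq_neq0; apply/allP => p /hps[Fp _] /=.
    exact: far_neq Fp Kw.
  have -> : hh.[w] = r0 * poles_prod ps w + h1.[w] * w.
    have : (hh - r0 *: D).[w] = (h1 * 'X).[w] by rewrite h1E.
    rewrite !hornerE DE => /eqP; rewrite subr_eq addrC => /eqP ->.
    by rewrite addrC.
  by rewrite subr0; field; rewrite w0 pw.
have gps : good (@cdist R) K (fun w => (poles_prod ps w)^-1).
  by apply: good_poles_prodV => // p /hps[].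
rewrite (functional_ext hJ (g := fun w => r0 * (w - 0)^-1 + h1.[w] / poles_prod ps w)); last first.
  by move=> w Kw; rewrite F1// F2.
have g0 : good (@cdist R) K (fun w => (w - 0)^-1).
  exact: (good_pole pg (nested_0 hg (A := ord0))).
rewrite (functional_lin hJ)//; last by apply: good_mul => //; exact: good_polyX.
have W0 : J (fun w => (w - 0)^-1) = 0 := winding_0 hg ord0.
rewrite W0 mulr0 add0r.
rewrite (functional_rational bK hJ JX JV hps); last by right.
have -> : h1`_(size ps).-1 = (h1 * 'X)`_(size ps).
  by rewrite coefMX; case: (size ps) sps.
rewrite -h1E coefB coefZ Dlead mulr1 nth_default// sub0r r0E.
by rewrite mulrN mulNr.
Qed.

(** The outermost variable is integrated first, by Fubini's theorem; the result does not
    depend on the inner variables. *)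
Lemma moment_integral_step k (g : 'I_k -> R -> C^o) (n : 'I_k -> nat) :
  nested_contours q a g -> (forall j, 0 < n j)%N ->
  moment_integral q a g n (fun=> 1) = (- period R) ^+ k * qc ^- 'C(k, 2).
Proof.
elim: k g n => [|k IH] g n hg n0.
  rewrite /moment_integral /= /integrand /cross big1 => [|[[]]//].
  by rewrite big1 => [|[]//]; rewrite !mul1r expr0 ?bin0n ?expr0 ?mul1r ?invr1.
have hg' := nested_behead hg.
pose Ks i := trace (g (lift ord0 i)).
pose I := iter_functional (fun i => contour_integral (g (lift ord0 i))).
have hI : functional (@ffdist R k) (boxset Ks) I := moment_integral_functional hg'.
have gG := good_vcons (nested_integrand_good hg predT n (laurent_cst k.+1 (1 : C))).
rewrite /moment_integral /=.
rewrite (fubini_functional (F := fun z0 z => integrand qc ac predT n (fun=> 1) (vcons z0 z))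
  (@ffdist_xx R k) (compact_totally_bounded (nested_compact hg (A := ord0)))
  (nested_functional hg ord0) hI gG).
pose n' (j : 'I_k) := n (lift ord0 j).
have gI : good (@ffdist R k) (boxset Ks) (integrand qc ac predT n' (fun=> 1)).
  exact: (nested_integrand_good hg' predT n' (laurent_cst k (1 : C))).
rewrite (functional_ext hI (g := fun z => - period R * qc ^- k * integrand qc ac predT n' (fun=> 1) z)); last first.
  move=> z Kz; rewrite -(outermost_integral hg (n0 ord0) Kz).
  have g1 := good_slice1 (F := fun z0 z => integrand qc ac predT n (fun=> 1) (vcons z0 z))
    (@ffdist_xx R k) gG Kz.
  have E w : integrand qc ac predT n (fun=> 1) (vcons w z) =
      integrand qc ac predT n' (fun=> 1) z * (\prod_(B < k) ((w - z B) / (w - qc * z B)) * (phi ac (n ord0) w / w)).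
    rewrite /integrand cross_vcons big_ord_recl vcons0 !mulr1.
    have -> : \prod_(i < k) (phi ac (n (lift ord0 i)) (vcons w z (lift ord0 i)) / vcons w z (lift ord0 i)) =
        \prod_(j < k) (phi ac (n' j) (z j) / z j) by apply: eq_bigr => j _; rewrite vconsS.
    by ring.
  have [i0|i0] := eqVneq (integrand qc ac predT n' (fun=> 1) z) 0.
    rewrite i0 mulr0; apply: (functional_eq0 (nested_functional hg ord0)) => w Kw.
    by rewrite E i0 mul0r.
  rewrite mulrC -(functionalZ (nested_functional hg ord0)); last first.
    apply: good_ext (good_scale (integrand qc ac predT n' (fun=> 1) z)^-1 g1) => w _.
    by rewrite E mulKf.
  by congr contour_integral; apply/funext => w; rewrite E.
rewrite (functionalZ hI)//.
have -> : I (integrand qc ac predT n' (fun=> 1)) = (- period R) ^+ k * qc ^- 'C(k, 2).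
  by apply: IH => // j; exact: n0.
rewrite exprS binS bin1 exprD invfM; ring.
Qed.

End normalization.

(** * Euler's scheme for the exponential *)

Section complex_exponential.
Context (R : realType).
Local Notation C := (R[i]).

Lemma cexpD (u v : C) : cexp (u + v) = cexp u * cexp v.
Proof.
case: u v => [a b] [c d]; rewrite /cexp/= expRD cosD sinD.
by apply/eqP; rewrite eq_complex/=; apply/andP; split; apply/eqP; ring.
Qed.

Lemma cexp0 : cexp (0 : C) = 1.
Proof. by rewrite /cexp/= expR0 cos0 sin0 mul1r. Qed.

Lemma cexp_neq0 (u : C) : cexp u != 0.
Proof.
apply/eqP => u0; have := cexpD u (- u); rewrite u0 mul0r subrr cexp0.
by move=> /eqP; rewrite oner_eq0.
Qed.

Lemma cexpN (u : C) : cexp (- u) = (cexp u)^-1.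
Proof.
by apply: (mulfI (cexp_neq0 u)); rewrite -cexpD subrr cexp0 divff// cexp_neq0.
Qed.

Lemma cexp_sum (I : Type) (s : seq I) (f : I -> C) :
  cexp (\sum_(i <- s) f i) = \prod_(i <- s) cexp (f i).
Proof.
elim: s => [|i s IH]; first by rewrite !big_nil cexp0.
by rewrite !big_cons cexpD IH.
Qed.

Lemma cexpMn (u : C) n : cexp (u *+ n) = cexp u ^+ n.
Proof. by elim: n => [|n IH]; rewrite ?mulr0n ?cexp0// mulrS cexpD IH exprS. Qed.

Lemma cnorm_cexp (u : C) : cnorm (cexp u) = expR (complex.Re u).
Proof.
rewrite /cexp cnormM cnormR ger0_norm ?expR_ge0// (_ : cnorm _ = 1) ?mulr1//=.
by rewrite cos2Dsin2 sqrtr1.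
Qed.

Lemma sin_mvt (y : R) : exists2 c, `|c| <= `|y| & sin y = cos c * y.
Proof.
have dsin (x : R) : is_derive x 1 (@sin R) (cos x) by exact: is_derive_sin.
have csin a b : {within `[a, b], continuous (@sin R)}.
  by apply: continuous_subspaceT => x; exact: continuous_sin.
have [y0|y0|<-] := ltgtP 0 y.
- have [c] := @MVT R sin cos 0 y y0 (fun x _ => dsin x) (csin _ _).
  rewrite in_itv/= => /andP[c0 cy] e; exists c; first by rewrite !gtr0_norm// ltW.
  by move: e; rewrite sin0 !subr0.
- have [c] := @MVT R sin cos y 0 y0 (fun x _ => dsin x) (csin _ _).
  rewrite in_itv/= => /andP[c0 cy] e; exists c; first by rewrite !ltr0_norm// lerN2 ltW.
  by move: e; rewrite sin0 !sub0r mulrN => /oppr_inj.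
- by exists 0 => //; rewrite sin0 mulr0.
Qed.

Lemma norm_sin_le (y : R) : `|sin y| <= `|y|.
Proof.
have [c _ ->] := sin_mvt y; rewrite normrM ler_piMl//.
by rewrite ler_norml cos_geN1 cos_le1.
Qed.

Lemma norm_cosB1_le (y : R) : `|cos y - 1| <= y ^+ 2 / 2.
Proof.
have E : cos y - 1 = - (sin (y / 2) ^+ 2 *+ 2).
  have -> : cos y = cos (y / 2 + y / 2) by rewrite -splitr.
  by rewrite cosD -!expr2 cos2sin2 mulr2n; ring.
have h : sin (y / 2) ^+ 2 <= (y / 2) ^+ 2.
  by rewrite -(real_normK (num_real (sin _))) -(real_normK (num_real (y / 2))) lerXn2r ?nnegrE// norm_sin_le.
rewrite E normrN ger0_norm ?mulrn_wge0 ?sqr_ge0// -mulr_natr.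
by move: h; rewrite expr_div_n; lra.
Qed.

(** From [1 - x <= expR (- x)] follows the upper bound [1 / (1 - x)]. *)
Lemma expR_quadratic (x : R) : `|x| <= 1 / 2 -> 0 <= expR x - 1 - x <= 2 * x ^+ 2.
Proof.
rewrite ler_norml => /andP[x1 x2]; have h1 := expR_ge1Dx x.
apply/andP; split; first by lra.
have h2 := expR_ge1Dx (- x); rewrite expRN in h2.
have e0 := expR_gt0 x.
have h3 : expR x * (1 - x) <= 1.
  by have := ler_wpM2l (ltW e0) h2; rewrite divff ?gt_eqF.
have x22 := sqr_ge0 x.
have h4 : (1 + x + 2 * x ^+ 2) * (1 - x) >= 1.
  have -> : (1 + x + 2 * x ^+ 2) * (1 - x) = 1 + x ^+ 2 * (1 - 2 * x) by ring.
  by rewrite lerDl mulr_ge0//; lra.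
have : expR x <= 1 + x + 2 * x ^+ 2.
  rewrite -(@ler_pM2r _ (1 - x)); last by lra.
  exact: le_trans h4.
lra.
Qed.

Lemma cexp_quadratic (u : C) : cnorm u <= 1 / 2 -> cnorm (cexp u - 1 - u) <= 10 * cnorm u ^+ 2.
Proof.
move=> u1; have hx := le_trans (cnorm_Re u) u1; have hy := le_trans (cnorm_Im u) u1.
set x := complex.Re u in hx *; set y := complex.Im u in hy *.
have xx : x ^+ 2 <= cnorm u ^+ 2.
  by rewrite -(real_normK (num_real x)) lerXn2r ?nnegrE ?cnorm_ge0// cnorm_Re.
have yy : y ^+ 2 <= cnorm u ^+ 2.
  by rewrite -(real_normK (num_real y)) lerXn2r ?nnegrE ?cnorm_ge0// cnorm_Im.
have xy : `|x| * `|y| <= cnorm u ^+ 2.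
  by rewrite expr2 ler_pM// ?cnorm_Re ?cnorm_Im.
have /andP[e1 e2] := expR_quadratic hx.
have ex0 := expR_gt0 x.
have ex3 : expR x <= 2.
  move: hx; rewrite ler_norml => /andP[x1 x2].
  have : x ^+ 2 <= (1 / 2) ^+ 2.
    by rewrite -(real_normK (num_real x)) lerXn2r ?nnegrE// ?ler_norml ?x1 ?x2//; lra.
  lra.
have hc := norm_cosB1_le y.
have hs : `|sin y - y| <= y ^+ 2 / 2.
  have [c cy ->] := sin_mvt y; rewrite -[X in _ - X]mul1r -mulrBl normrM.
  have cc := norm_cosB1_le c.
  have c2 : c ^+ 2 <= y ^+ 2.
    by rewrite -(real_normK (num_real c)) -(real_normK (num_real y)) lerXn2r ?nnegrE.
  have : `|cos c - 1| * `|y| <= y ^+ 2 / 2 * 1.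
    by rewrite ler_pM//; lra.
  by rewrite mulr1.
rewrite (le_trans (cnorm_ReIm _))//.
have -> : complex.Re (cexp u - 1 - u) = (expR x - 1 - x) + expR x * (cos y - 1).
  by rewrite /cexp /x /y; case: (u) => a b /=; ring.
have -> : complex.Im (cexp u - 1 - u) = expR x * (sin y - y) + (expR x - 1 - x) * y + x * y.
  by rewrite /cexp /x /y; case: (u) => a b /=; ring.
have a1 : `|expR x - 1 - x + expR x * (cos y - 1)| <= 2 * x ^+ 2 + 2 * (y ^+ 2 / 2).
  rewrite (le_trans (ler_normD _ _))// lerD//; first by rewrite ger0_norm.
  by rewrite normrM ler_pM// gtr0_norm.
have a2 : `|expR x * (sin y - y) + (expR x - 1 - x) * y + x * y| <=
    2 * (y ^+ 2 / 2) + 2 * x ^+ 2 * (1 / 2) + `|x| * `|y|.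
  rewrite (le_trans (ler_normD _ _))// normrM lerD//.
  rewrite (le_trans (ler_normD _ _))// !normrM lerD//.
    by rewrite ler_pM// gtr0_norm.
  by rewrite ler_pM// ger0_norm.
lra.
Qed.

Lemma cnorm_subX (x y : C) (b : R) n : cnorm x <= b -> cnorm y <= b ->
  cnorm (x ^+ n - y ^+ n) <= n%:R * cnorm (x - y) * b ^+ n.-1.
Proof.
move=> xb yb; have b0 : 0 <= b := le_trans (cnorm_ge0 x) xb.
case: n => [|n]; first by rewrite !expr0 subrr cnorm0 !mul0r.
rewrite subrXX cnormM mulrC [leRHS]mulrAC ler_wpM2r ?cnorm_ge0//.
rewrite (le_trans (cnorm_sum _ _ _))//= -[n.+1 in leRHS]card_ord mulr_natl.
rewrite -sumr_const ler_sum// => i _.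
rewrite cnormM !cnormX -[in leRHS](subnK (ltn_ord i : i <= n)%N) exprD.
by rewrite ler_pM ?exprn_ge0 ?cnorm_ge0// lerXn2r ?nnegrE ?cnorm_ge0// subSS.
Qed.

(** With [v = w / n], both [cexp v] and [1 + v] have modulus at most [expR (B / n)] and they
    differ by [O(n^-2)]; the difference of the powers telescopes into [n] such terms. *)
Lemma cexp_euler (B : R) : 0 <= B -> exists2 D, 0 <= D &
  forall n (w : C), (2 * B < n%:R) -> cnorm w <= B ->
    cnorm (cexp w - (1 + w / n%:R) ^+ n) <= D / n%:R.
Proof.
move=> B0; exists (10 * B ^+ 2 * expR B); first by rewrite !mulr_ge0 ?expR_ge0 ?sqr_ge0.
move=> n w nB wB; have n0 : 0 < n%:R :> R by rewrite (le_lt_trans _ nB)// mulr_ge0.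
have nC : cnorm (n%:R : C) = n%:R by rewrite -(rmorph_nat (real_complex R)) cnormR ger0_norm// ltW.
have nC0 : n%:R != 0 :> C by rewrite -cnorm_gt0 nC.
set v := w / n%:R; have vB : cnorm v <= B / n%:R.
  by rewrite /v cnormM cnormV nC ler_pM2r ?invr_gt0.
have -> : cexp w = cexp v ^+ n by rewrite -cexpMn -[v *+ n]mulr_natr divfK.
have v2 : cnorm v <= 1 / 2.
  by rewrite (le_trans vB)// ler_pdivrMr//; lra.
have b1 : cnorm (cexp v) <= expR (B / n%:R).
  rewrite cnorm_cexp ler_expR (le_trans _ vB)//.
  by rewrite (le_trans (ler_norm _))// cnorm_Re.
have b2 : cnorm (1 + v) <= expR (B / n%:R).
  rewrite (le_trans (cnormD _ _))// cnorm1 (le_trans _ (expR_ge1Dx _))// lerD2l.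
  exact: vB.
rewrite (le_trans (cnorm_subX _ b1 b2))//.
have e1 : expR (B / n%:R) ^+ n.-1 <= expR B.
  rewrite -expRM_natl ler_expR mulrA ler_pdivrMr// mulrC ler_wpM2l//.
  by rewrite ler_nat leq_pred.
have e2 : n%:R * cnorm (cexp v - (1 + v)) <= 10 * B ^+ 2 / n%:R.
  rewrite opprD addrA; apply: (@le_trans _ _ (n%:R * (10 * (B / n%:R) ^+ 2))).
    rewrite ler_pM2l// (le_trans (cexp_quadratic v2))// ler_pM2l//.
    by rewrite lerXn2r ?nnegrE ?cnorm_ge0// divr_ge0// ltW.
  rewrite le_eqVlt; apply/orP; left; apply/eqP.
  by move: (n%:R : R) n0 => m m0; field; rewrite gt_eqF.
rewrite [leRHS]mulrAC; apply: ler_pM => //.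
  by rewrite mulr_ge0 ?cnorm_ge0// ltW.
Qed.

End complex_exponential.

(** * Euler's scheme for the integrals *)

Section euler_scheme.
Context (R : realType) (N k : nat).
Local Notation C := (R[i]).
Context (q : R) (a : 'I_N -> R) (rR rL : R) (g : 'I_k -> R -> C^o).
Hypothesis q01 : 0 < q < 1.
Hypothesis a0 : forall i, 0 < a i.
Hypothesis N0 : (0 < N)%N.
Hypothesis hg : nested_contours q a g.
Local Notation qc := (q%:C).
Local Notation ac := (fun i => (a i)%:C).
Local Notation K A := (trace (g A)).
Local Notation state := {ffun 'I_k -> 'I_N.+1}.
Local Notation box := (boxset (fun A => K A)).
Local Notation I := (state_integral q a g).

Definition total_weight (z : 'I_k -> C) := \sum_(l < k) weight q rR rL (z l).
(** This makes the integrals equal to the initial moments at time zero ([euler_init]). *)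
Definition prefactor : C := (-1) ^+ k * qc ^+ ((k * k.-1)./2) / period R ^+ k.

Definition euler_moment (h : C) (j : nat) (n : state) : C :=
  prefactor * I n (fun z => (1 + h * total_weight z) ^+ j).

Lemma euler_laurent h j : laurent (fun z => (1 + h * total_weight z) ^+ j).
Proof.
apply: laurentX; apply: laurentD; first exact: laurent_cst.
by apply: laurentZ; exact: weight_laurent.
Qed.

Lemma euler_symmetric h j : symmetric_fun (fun z => (1 + h * total_weight z) ^+ j).
Proof. by move=> i i' z; congr ((1 + h * _) ^+ j); exact: weight_symmetric. Qed.

Lemma dualZ (F : fieldType) (q' : F) a' r l c (h : state -> F) n :
  dual q' a' r l (fun m => c * h m) n = c * dual q' a' r l h n.
Proof.
rewrite /dual /apply_terms mulr_sumr; apply: eq_bigr => cm _.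
by rewrite mulrCA.
Qed.

Lemma euler_step h j n : sorted_state n ->
  euler_moment h j.+1 n = euler_moment h j n + h * dual qc ac rR%:C rL%:C (euler_moment h j) n.
Proof.
move=> sn; rewrite /euler_moment dualZ.
rewrite -(dual_integral rR rL q01 a0 hg (euler_laurent h j) (euler_symmetric h j) sn).
rewrite mulrCA -mulrDr; congr (_ * _).
have lw : laurent (fun z => total_weight z * (1 + h * total_weight z) ^+ j).
  by apply: laurentM; [exact: weight_laurent|exact: euler_laurent].
rewrite /state_integral -(moment_integralZ hg)// -(moment_integralD hg).
- congr (moment_integral _ _ _ _ _); apply/funext => z.
  by rewrite exprS /total_weight; ring.
- exact: euler_laurent.
- exact: laurentZ.
Qed.

(** For the step configuration [u_v] is [1], except the virtual [u_0 = 0]. *)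
Lemma euler_init h n : sorted_state n ->
  euler_moment h 0 n = prod_state (fun v => if v == 0%N then 0 else 1) n.
Proof.
move=> sn; rewrite /euler_moment; under eq_fun do rewrite expr0.
have [/existsP[l /eqP nl]|/existsPn h0] := boolP [exists l, n l == 0 :> nat].
  have v0 : (0 < count_eq n 0)%N by apply/card_gt0P; exists l; rewrite inE nl.
  have [p pE np] := last_position sn v0.
  have pk : val p = k.-1.
    by move: pE; rewrite count_ge0 => e; apply: succn_inj; rewrite e prednK// -e.
  rewrite /state_integral (moment_integral_eq0 q01 hg pk np) ?mulr0; last exact: laurent_cst.
  by rewrite /prod_state (bigD1 l)//= nl mul0r.
rewrite /state_integral (moment_integral_step q01 a0 N0 hg) => [|j]; last first.
  by rewrite lt0n; exact: h0.
rewrite /prod_state big1 => [|p _]; last by rewrite (negPf (h0 p)).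
rewrite /prefactor bin2 (exprNn (period R)); set e := (_)./2.
have qe : qc ^+ e != 0 by rewrite expf_neq0// qc_neq0.
have pe : period R ^+ k != 0 by rewrite expf_neq0// period_neq0.
have E (x y z : C) : y != 0 -> z != 0 -> x * y / z * (x * z / y) = x * x.
  by move=> y0 z0; field; rewrite y0 z0.
rewrite E//.
by rewrite -exprD addnn -signr_odd odd_double.
Qed.

(** Used for the exponential weight, a uniform limit of the Laurent polynomials of Euler's
    scheme. *)
Lemma good_unif_limit (T : Type) (d : T -> T -> R) (A : set T) (f : T -> C) :
  (forall e : R, 0 < e -> exists2 h, good d A h & forall x, A x -> cnorm (f x - h x) <= e) ->
  good d A f.
Proof.
move=> H; split.
  move=> e e0; have e3 : 0 < e / 3 by rewrite divr_gt0.
  have [h [uh _] fh] := H _ e3; have [r r0 hr] := uh _ e3.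
  exists r => // x y Ax Ay xy.
  have -> : f x - f y = (f x - h x) + (h x - h y) + (h y - f y).
    by ring.
  rewrite (le_trans (cnormD _ _))//.
  have := cnormD (f x - h x) (h x - h y); have := hr x y Ax Ay xy.
  have := fh x Ax; have := fh y Ay; rewrite cnormB; lra.
have [h [_ [B hB]] fh] := H 1 ltr01; exists (1 + B) => x Ax.
by rewrite -[f x](subrK (h x)) (le_trans (cnormD _ _))// lerD ?fh ?hB.
Qed.

Lemma euler_limit (t : R) n : exists2 D, 0 <= D & \forall m \near \oo,
  cnorm (euler_moment (t / m%:R)%:C m n -
    prefactor * I n (fun z => cexp (t%:C * total_weight z))) <= D / m%:R.
Proof.
pose F S := integrand qc ac predT (fun p => n p : nat) S.
have gW : good (@ffdist R k) box total_weight.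
  apply: (@weight_laurent R k q rR rL).1 => A; first exact: (nested_compact hg).
  exact: (nested_0 hg).
have [B B0 hB] := bounded_on_pos gW.2.
have g1 : good (@ffdist R k) box (F (fun=> 1)).
  exact: (nested_integrand_good hg predT _ (laurent_cst k (1 : C))).
have [B1 B10 hB1] := bounded_on_pos g1.2.
have tB0 : 0 <= `|t| * B by rewrite mulr_ge0// ltW.
have [D D0 hD] := cexp_euler tB0.
have [V V0 hV] := functional_bnd (moment_integral_functional hg).
have gE m : good (@ffdist R k) box (F (fun z => (1 + (t / m%:R)%:C * total_weight z) ^+ m)).
  exact: (nested_integrand_good hg predT _ (euler_laurent _ _)).
have bnd m z : 2 * (`|t| * B) < m%:R -> box z ->
    cnorm (F (fun z => cexp (t%:C * total_weight z)) z -
      F (fun z => (1 + (t / m%:R)%:C * total_weight z) ^+ m) z) <= B1 * (D / m%:R).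
  move=> mB Kz; have E S : F S z = F (fun=> 1) z * S z by rewrite /F /integrand mulr1.
  rewrite E [F (fun z => (_ ^+ m)) z]E -mulrBr cnormM ler_pM ?cnorm_ge0// ?hB1//.
  have -> : (t / m%:R)%:C * total_weight z = t%:C * total_weight z / m%:R.
    by rewrite rmorphM fmorphV rmorph_nat/= mulrAC.
  by apply: hD => //; rewrite cnormM cnormR ler_wpM2l// hB.
have near_big x : \forall m \near \oo, x < m%:R :> R by exact: nbhs_infty_gtr.
have gF : good (@ffdist R k) box (F (fun z => cexp (t%:C * total_weight z))).
  apply: good_unif_limit => e e0.
  have [m _ /(_ m (leqnn m))/= [m1 m2]] := filterI (near_big (2 * (`|t| * B))) (near_big (B1 * D / e)).
  exists (F (fun z => (1 + (t / m%:R)%:C * total_weight z) ^+ m)) => // z Kz.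
  have m0 : 0 < m%:R :> R by rewrite (le_lt_trans _ m1)// mulr_ge0.
  rewrite (le_trans (bnd m z m1 Kz))// mulrA ler_pdivrMr// [leRHS]mulrC -ler_pdivrMr//.
  exact: ltW.
exists (cnorm prefactor * V * (B1 * D)); first by rewrite !mulr_ge0 ?cnorm_ge0// ltW.
have := near_big (2 * (`|t| * B)); apply: filterS => m mB.
have m0 : 0 < m%:R :> R by rewrite (le_lt_trans _ mB)// mulr_ge0.
rewrite /euler_moment -mulrBr cnormM -!mulrA ler_wpM2l ?cnorm_ge0//.
rewrite /state_integral /moment_integral -(functionalB (moment_integral_functional hg)) ?gE ?gF//.
apply: hV => [||z Kz]; first by apply: mulr_ge0; [exact: ltW|rewrite divr_ge0// ltW].
  by apply: good_sub; [exact: gE|exact: gF].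
by rewrite cnormB; exact: bnd.
Qed.

End euler_scheme.

(** * Action of the generator on monomials *)

Section configurations.
Context (R : realType) (N : nat) (q : R).
Hypothesis q01 : 0 < q < 1.
Implicit Types x : config N.

Let q_gt0 : 0 < q. Proof. by case/andP: q01. Qed.
Let q_neq0 : q != 0. Proof. by rewrite gt_eqF. Qed.

Definition ordered (y : {ffun 'I_N -> int}) :=
  [forall i : 'I_N, forall j : 'I_N, (i < j)%N ==> (y j < y i)].

Lemma config_lt x (i j : 'I_N) : (i < j)%N -> x j < x i.
Proof. by case: x => y /= /forallP/(_ i)/forallP/(_ j)/implyP. Qed.

Lemma config_gap x (i j : 'I_N) : (i <= j)%N -> (j%:Z - i%:Z <= x i - x j)%R.
Proof.
move=> ij; have [m mE] : exists m, (j - i)%N = m by eexists.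
elim: m j ij mE => [|m IH] j ij mE.
  have -> : j = i by apply: val_inj => /=; lia.
  by rewrite !subrr.
have jk : (j.-1 < N)%N by have := ltn_ord j; lia.
have := IH (Ordinal jk) _ _; rewrite /=.
have := @config_lt x (Ordinal jk) j; rewrite /=; lia.
Qed.

Lemma val_insubd_config x y : ordered y -> insubd x y = y :> {ffun 'I_N -> int}.
Proof. by move=> oy; rewrite val_insubd /= -/(ordered y) oy. Qed.

Lemma insubd_config x y : ~~ ordered y -> insubd x y = x.
Proof. by move=> /negPf oy; apply: val_inj; rewrite val_insubd /= -/(ordered y) oy. Qed.

(** The variables in which the observables are monomials. *)
Definition qpos x (v : nat) : R := qpow q (particle x v + v%:Z%:E)%E.

Lemma qpos0 x : qpos x 0 = 0.
Proof. by []. Qed.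

Lemma qposS x (i : 'I_N) : qpos x i.+1 = q ^ (x i + i.+1%:Z).
Proof. by rewrite /qpos /= valK. Qed.

Lemma qpos_gt0 x v : (0 < v <= N)%N -> 0 < qpos x v.
Proof.
case: v => [//|v] /andP[_ vN]; rewrite (qposS x (Ordinal vN)).
exact: exprz_gt0.
Qed.

Lemma qpos_ge0 x v : 0 <= qpos x v.
Proof. by rewrite /qpos; case: (_ + _)%E => //= r; exact/exprz_ge0/ltW. Qed.

Lemma qpos_neq0 x v : (0 < v <= N)%N -> qpos x v != 0.
Proof. by move=> vN; rewrite gt_eqF// qpos_gt0. Qed.

Lemma exprz_le1 (m : int) : 0 <= m -> q ^ m <= 1.
Proof.
by case: m => // m _; rewrite -exprnP exprn_ile1// ltW//; case/andP: q01.
Qed.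

Lemma qpos_le x v : (v <= N)%N -> qpos x v <= qpos x N.
Proof.
case: v => [|v] vN; first by rewrite qpos0 qpos_ge0.
have N0 : (N.-1 < N)%N by lia.
have NE : N = (Ordinal N0).+1 by rewrite /= prednK//; lia.
rewrite (qposS x (Ordinal vN)) [in leRHS]NE qposS.
have := @config_gap x (Ordinal vN) (Ordinal N0); rewrite /= => h.
set e1 := _ + _; set e2 := _ + _.
have -> : e1 = e2 + (e1 - e2) by ring.
rewrite expfzDr// ler_piMr ?exprz_ge0 ?(ltW q_gt0)// exprz_le1//.
by rewrite /e1 /e2 /=; lia.
Qed.

(** The identity also holds for the first particle, where both sides are [0]. *)
Lemma qpow_gap x (i : 'I_N) : qpow q (gap x i.+1) = qpos x i / qpos x i.+1.
Proof.
rewrite /gap /= valK; case: i => -[|i] iN /=; first by rewrite qpos0 mul0r.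
have iN' := ltnW iN; rewrite (qposS x (Ordinal iN')) (qposS x (Ordinal iN)).
rewrite (_ : insub i = Some (Ordinal iN')); last by rewrite insubT.
by rewrite invr_expz -expfzDr//=; congr (_ ^ _); lia.
Qed.

Lemma qpow_gap_last x : qpow q (gap x N.+1) = 0.
Proof.
rewrite /gap /particle/= insubF ?ltnn//.
move: x; case: N => [|m] x //=; rewrite (_ : insub m = Some ord_max)//.
by exact: (valK (@ord_max m)).
Qed.

Lemma qpos_quo x (i j : 'I_N) :
  q ^ (x i - x j - (j%:Z - i%:Z)) = qpos x i.+1 / qpos x j.+1.
Proof. by rewrite !qposS invr_expz -expfzDr//; congr (_ ^ _); lia. Qed.

Lemma qpow_gap_next x (j : 'I_N) :
  qpow q (gap x j.+2) = qpos x j.+1 * invu N (qpos x) j.+2.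
Proof.
rewrite /invu; case: ltnP => jN; first by rewrite (qpow_gap x (Ordinal jN)).
have -> : j.+2 = N.+1 by have := ltn_ord j; lia.
by rewrite qpow_gap_last mulr0.
Qed.

Lemma qpow_gap01 x (i : 'I_N) : 0 <= qpow q (gap x i.+1) <= 1.
Proof.
rewrite /gap /= valK; case: i => -[|i] iN /=; first by rewrite lexx ler01.
have iN' := ltnW iN; have -> : insub i = Some (Ordinal iN') by rewrite insubT.
rewrite /= exprz_ge0 ?(ltW q_gt0)// exprz_le1//.
by have := @config_lt x (Ordinal iN') (Ordinal iN) (ltnSn i); lia.
Qed.

Lemma qpow_gap_next01 x (j : 'I_N) : 0 <= qpow q (gap x j.+2) <= 1.
Proof.
case: (ltnP j.+1 N) => jN; first exact: (qpow_gap01 x (Ordinal jN)).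
have -> : j.+2 = N.+1 by have := ltn_ord j; lia.
by rewrite qpow_gap_last lexx ler01.
Qed.

Definition right_shift x (i : 'I_N) : {ffun 'I_N -> int} :=
  [ffun m => if m == i then x m + 1 else x m].
Definition left_shift x (i j : 'I_N) : {ffun 'I_N -> int} :=
  [ffun m : 'I_N => if (i <= m <= j)%N then x m - 1 else x m].

Lemma orderedPn (y : {ffun 'I_N -> int}) : ~~ ordered y ->
  exists i j : 'I_N, (i < j)%N /\ y i <= y j.
Proof.
move=> /forallPn[i /forallPn[j]]; rewrite negb_imply -leNgt => /andP[ij yij].
by exists i, j.
Qed.

(** A move which would break the order has rate zero, so that its replacement by the
    identity in [right_move] is harmless; this is where exclusion enters. *)
Lemma right_blocked x i : ~~ ordered (right_shift x i) -> qpow q (gap x i.+1) = 1.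
Proof.
move=> /orderedPn[p [r [pr]]]; rewrite !ffunE => H.
have xpr := config_lt x pr; have gpr := config_gap x (ltnW pr).
have ri : r = i by move: H; case: eqP => // _; case: eqP => // _; lia.
subst r; move: H; rewrite eqxx ifF; last by apply/negP => /eqP pi; rewrite pi ltnn in pr.
move=> H; have pE : p.+1 = i :> nat by lia.
rewrite qpow_gap -[X in qpos x X / _]pE !qposS.
have -> : x p + p.+1%:Z = x i + i.+1%:Z by lia.
by rewrite divff// expfz_neq0.
Qed.

(** The particle [j + 1] is adjacent to [j], and is then pushed with probability one: a move
    of the block ending at [j] has rate zero. *)
Lemma left_blocked x i j : ~~ ordered (left_shift x i j) -> qpow q (gap x j.+2) = 1.
Proof.
move=> /orderedPn[p [r [pr]]]; rewrite !ffunE => H.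
have xpr := config_lt x pr; have gpr := config_gap x (ltnW pr).
have [pj rE xE] : [/\ p = j :> nat, r = j.+1 :> nat & x p = x r + 1].
  move: H; case: ifP => [/andP[p1 p2]|_]; case: ifP => [/andP[r1 r2]|/negbT r1]; try lia.
  by rewrite negb_and -!ltnNge in r1; case/orP: r1 => r1; [lia|split; lia].
rewrite -rE qpow_gap -[X in qpos x X / _](_ : p.+1 = r); last by rewrite rE pj.
rewrite !qposS xE.
have -> : x r + 1 + p.+1%:Z = x r + r.+1%:Z by lia.
by rewrite divff// expfz_neq0.
Qed.

Lemma prod_state_scale k (u u' : nat -> R) (r : R) (c : pred nat) (n : {ffun 'I_k -> 'I_N.+1}) :
  (forall v, (v <= N)%N -> u' v = if c v then r * u v else u v) ->
  prod_state u' n = r ^+ #|[set p | c (n p)]%SET| * prod_state u n.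
Proof.
move=> H; rewrite /prod_state -prodr_const.
rewrite [X in _ = X * _](_ : _ = \prod_p (if c (n p) then r else 1)); last first.
  by rewrite -big_mkcond/=; apply: eq_bigl => p; rewrite inE.
rewrite -big_split/=; apply: eq_bigr => p _; rewrite H -1?ltnS//.
by case: ifP; rewrite ?mul1r.
Qed.

Lemma qpos_right_shift x i v : ordered (right_shift x i) -> (v <= N)%N ->
  qpos (right_move x i) v = if v == i.+1 then q * qpos x v else qpos x v.
Proof.
move=> o; case: v => [|v] vN; first by rewrite !qpos0.
rewrite !(qposS _ (Ordinal vN)) /right_move val_insubd_config// ffunE eqSS -val_eqE/=.
by case: eqP => // _; rewrite -[q in q * _]expr1z -expfzDr//; congr (_ ^ _); lia.
Qed.

Lemma qpos_left_shift x i j v : ordered (left_shift x i j) -> (v <= N)%N ->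
  qpos (left_move x i j) v = if (i < v < j.+2)%N then q^-1 * qpos x v else qpos x v.
Proof.
move=> o; case: v => [|v] vN; first by rewrite !qpos0.
rewrite !(qposS _ (Ordinal vN)) /left_move val_insubd_config// ffunE ltnS ltnS ltnS/=.
by case: ifP => // _; rewrite -exprN1 -expfzDr//; congr (_ ^ _); lia.
Qed.

Context (k : nat) (a : 'I_N -> R) (rR rL : R).
Implicit Types n : {ffun 'I_k -> 'I_N.+1}.

Definition observable n x := prod_state (qpos x) n.

Lemma observable_right_move n x i : ordered (right_shift x i) ->
  observable n (right_move x i) = q ^+ count_eq n i.+1 * observable n x.
Proof.
by move=> o; apply: (@prod_state_scale _ _ _ _ (pred1 i.+1)) => v; exact: qpos_right_shift.
Qed.

Lemma card_between n i j : (i <= j)%N ->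
  #|[set p | (i <= n p < j)%N]%SET| = (count_ge n i - count_ge n j)%N.
Proof.
move=> ij; rewrite /count_ge -cardsDS; last first.
  by apply/fintype.subsetP => p; rewrite !inE; exact: leq_trans.
by apply: eq_card => p; rewrite !inE andbC -ltnNge.
Qed.

Lemma observable_left_move n x (i j : 'I_N) : (i <= j)%N -> ordered (left_shift x i j) ->
  observable n (left_move x i j) =
  q ^- (count_ge n i.+1 - count_ge n j.+2) * observable n x.
Proof.
move=> ij o; rewrite -card_between; last by lia.
rewrite -exprVn; apply: (@prod_state_scale _ _ _ _ (fun v => i < v < j.+2)%N) => v.
exact: qpos_left_shift.
Qed.

(** The duality of the generator: on the monomials in the [qpos x v] the moves of the
    process act by scalars, and [dual_prod] identifies the sum of these scalars with
    the action of the dual generator on the index of the monomial. *)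
Lemma generator_observable n x : sorted_state n ->
  qPushASEP_generator q a rR rL (observable n) x = dual q a rR rL (observable^~ x) n.
Proof.
move=> sn; rewrite [RHS](dual_prod a rR rL (@qpos_neq0 x) q_neq0 sn).
rewrite mulrDr !mulr_sumr; congr (_ + _); apply: eq_bigr => i _.
  rewrite -/(observable n x) -qpow_gap.
  have [or|/right_blocked ->] := boolP (ordered (right_shift x i)).
    by rewrite observable_right_move//; ring.
  by rewrite subrr !(mulr0, mul0r).
rewrite [RHS]mulrCA; congr (_ * _); rewrite mulr_sumr; apply: eq_bigr => j ij.
rewrite -/(observable n x) qpos_quo.
have -> : qpos x i.+1 * (invu N (qpos x) j.+1 - invu N (qpos x) j.+2) =
    qpos x i.+1 / qpos x j.+1 * (1 - qpow q (gap x j.+2)).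
  rewrite qpow_gap_next [RHS]mulrBr mulr1 [in RHS]mulrA divfK ?qpos_neq0 ?ltn_ord//.
  by rewrite mulrBr [in LHS]/invu ltn_ord.
have [or|/left_blocked ->] := boolP (ordered (left_shift x i j)).
  by rewrite observable_left_move//; ring.
by rewrite subrr !(mulr0, mul0r).
Qed.

Local Notation move_index := ('I_N + 'I_N * 'I_N)%type.

Definition move (c : move_index) x :=
  match c with inl i => right_move x i | inr (i, j) => left_move x i j end.

Definition move_rate (c : move_index) x : R :=
  match c with
  | inl i => rR * a i * (1 - qpow q (gap x i.+1))
  | inr (i, j) => if (i <= j)%N then
      rL * (a i)^-1 * (q ^ (x i - x j - (j%:Z - i%:Z)) * (1 - qpow q (gap x j.+2))) else 0
  end.

Definition max_rate (c : move_index) : R :=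
  match c with inl i => rR * a i | inr (i, j) => rL * (a i)^-1 end.

Lemma generatorE f x : qPushASEP_generator q a rR rL f x =
  \sum_c move_rate c x * (f (move c x) - f x).
Proof.
rewrite big_sumType/= /qPushASEP_generator; congr (_ + _).
rewrite [RHS](eq_bigr (fun c : 'I_N * 'I_N => move_rate (inr (c.1, c.2)) x *
  (f (left_move x c.1 c.2) - f x))); last by case.
rewrite -(pair_bigA _ (fun i j => move_rate (inr (i, j)) x * (f (left_move x i j) - f x)))/=.
apply: eq_bigr => i _; rewrite mulr_sumr big_mkcond/=; apply: eq_bigr => j _.
by case: ifP; rewrite ?mul0r// mulrA.
Qed.

Hypotheses (a0 : forall i, 0 < a i) (rR0 : 0 <= rR) (rL0 : 0 <= rL).

Lemma max_rate_ge0 c : 0 <= max_rate c.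
Proof. by case: c => [i|[i j]] /=; rewrite mulr_ge0 ?invr_ge0// ltW. Qed.

Lemma move_rate_bound c x : 0 <= move_rate c x <= max_rate c.
Proof.
have B (r b : R) : 0 <= r -> 0 <= b <= 1 -> 0 <= r * b <= r.
  by move=> r0 /andP[b0 b1]; rewrite mulr_ge0//= ler_piMr.
have C (b : R) : 0 <= b <= 1 -> 0 <= 1 - b <= 1 by lra.
case: c => [i|[i j]] /=; first by rewrite B ?(max_rate_ge0 (inl i))// C// qpow_gap01.
have r0 := max_rate_ge0 (inr (i, j)); case: ifP => ij; last by rewrite lexx.
apply: (B _ _ r0); have /andP[p0 p1] := C _ (qpow_gap_next01 x j).
have e0 := exprz_ge0 (x i - x j - (j%:Z - i%:Z)) (ltW q_gt0).
by rewrite mulr_ge0// mulr_ile1// exprz_le1// subr_ge0 config_gap.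
Qed.

(** A common bound of the monomials which is multiplied by a bounded factor at each move. *)
Definition dominant x := qpos x N ^+ k.

Lemma dominant_ge0 x : 0 <= dominant x.
Proof. exact/exprn_ge0/qpos_ge0. Qed.

Lemma observable_ge0 n x : 0 <= observable n x.
Proof. by apply: prodr_ge0 => p _; exact: qpos_ge0. Qed.

Lemma observable_le n x : observable n x <= dominant x.
Proof.
rewrite /dominant -[X in _ ^+ X](card_ord k) -prodr_const; apply: ler_prod => p _.
by rewrite qpos_ge0 qpos_le// -ltnS.
Qed.

Lemma qpos_move c x : qpos (move c x) N <= q^-1 * qpos x N.
Proof.
have qV : 1 <= q^-1 by rewrite invf_ge1//; case/andP: q01 => _ /ltW.
have q1 : q <= q^-1 by apply: le_trans qV; case/andP: q01 => _ /ltW.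
have u0 := qpos_ge0 x N; have u1 : qpos x N <= q^-1 * qpos x N by rewrite ler_peMl.
case: c => [i|[i j]] /=.
  have [or|o] := boolP (ordered (right_shift x i)); last by rewrite /right_move insubd_config.
  by rewrite qpos_right_shift//; case: ifP => _ //; rewrite ler_wpM2r.
have [or|o] := boolP (ordered (left_shift x i j)); last by rewrite /left_move insubd_config.
by rewrite qpos_left_shift//; case: ifP.
Qed.

Lemma dominant_move c x : dominant (move c x) <= q^-1 ^+ k * dominant x.
Proof. by rewrite /dominant -exprMn lerXn2r ?nnegrE ?mulr_ge0 ?invr_ge0 ?qpos_ge0 ?qpos_move// ltW. Qed.

End configurations.


(** * Truncated Lyapunov functions *)

Section truncation.
Context (R : realType) (T : Type) (I : finType) (rate : I -> T -> R) (mv : I -> T -> T).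
Context (r : I -> R) (V : T -> R) (Q A : R).
Hypotheses (rate_bound : forall c x, 0 <= rate c x <= r c) (V0 : forall x, 0 <= V x).
Hypotheses (Q1 : 1 <= Q) (VQ : forall c x, V (mv c x) <= Q * V x) (A1 : 1 <= A).

Definition jump_generator (f : T -> R) x := \sum_c rate c x * (f (mv c x) - f x).
Definition truncated x := Order.min (V x) A ^+ 2.
Definition cutoff x : R := if V x <= A then 1 else 0.

Let A0 : 0 <= A. Proof. by rewrite (le_trans ler01). Qed.
Let m0 x : 0 <= Order.min (V x) A. Proof. by rewrite le_min V0. Qed.

Lemma truncated_bound x : 0 <= truncated x <= A ^+ 2.
Proof. by rewrite sqr_ge0 lerXn2r ?nnegrE// ge_min lexx orbT. Qed.

Lemma truncated_move c x : truncated (mv c x) <= Q ^+ 2 * truncated x.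
Proof.
have Q0 : 0 <= Q by rewrite (le_trans ler01).
rewrite -exprMn lerXn2r ?nnegrE ?mulr_ge0// minr_pMr// le_min !ge_min VQ/= ?orbT.
by rewrite ler_peMl ?orbT.
Qed.

(** A move multiplies the truncated function by at most [Q ^ 2]. *)
Lemma truncated_generator x : jump_generator truncated x <= (\sum_c r c) * Q ^+ 2 * truncated x.
Proof.
rewrite -mulrA mulr_suml; apply: ler_sum => c _.
have /andP[p0 p1] := rate_bound c x; have h := truncated_move c x.
have /andP[t0 _] := truncated_bound x; have /andP[t1 _] := truncated_bound (mv c x).
apply: (@le_trans _ _ (rate c x * (Q ^+ 2 * truncated x))).
  by rewrite ler_wpM2l// (le_trans _ h)// gerBl.
by rewrite ler_wpM2r// mulr_ge0// sqr_ge0.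
Qed.

(** A move across the level [A] of [V] starts at height at least [A / Q]: there a function
    dominated by [V] is at most of the order of [V ^+ 2 / A]. *)
Lemma cutoff_generator f x : (forall x, 0 <= f x <= V x) ->
  `|jump_generator (fun x => f x * cutoff x) x - cutoff x * jump_generator f x| <=
  (\sum_c r c) * Q ^+ 2 / A * truncated x.
Proof.
move=> fV; have Apos : 0 < A by rewrite (lt_le_trans ltr01).
rewrite /jump_generator mulr_sumr -sumrB.
rewrite (le_trans (ler_norm_sum _ _ _))// -2![leRHS]mulrA mulr_suml; apply: ler_sum => c _.
have /andP[p0 p1] := rate_bound c x.
set y := mv c x.
have -> : rate c x * (f y * cutoff y - f x * cutoff x) - cutoff x * (rate c x * (f y - f x)) =
   rate c x * (f y * (cutoff y - cutoff x)) by ring.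
rewrite normrM (ger0_norm p0).
suff h : `|f y * (cutoff y - cutoff x)| <= Q ^+ 2 * (A^-1 * truncated x).
  by apply: ler_pM.
have /andP[f0 fy] := fV y; rewrite normrM (ger0_norm f0).
have /andP[t0 _] := truncated_bound x.
have Q2 : 1 <= Q ^+ 2 by rewrite exprn_ege1.
rewrite [leRHS]mulrCA [leRHS]mulrC ler_pdivlMr//.
have r0 : 0 <= Q ^+ 2 * truncated x by rewrite mulr_ge0 ?sqr_ge0.
rewrite /cutoff; case: (leP (V y)) => Vy; case: (leP (V x)) => Vx;
  rewrite ?subrr ?normr0 ?mulr0 ?mul0r// ?subr0 ?sub0r ?normrN normr1 mulr1.
  rewrite /truncated min_r; last exact: ltW.
  apply: (@le_trans _ _ (A ^+ 2)).
    by rewrite expr2 ler_wpM2r// (le_trans fy).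
  by rewrite ler_peMl// sqr_ge0.
rewrite /truncated min_l// -exprMn; apply: (@le_trans _ _ (V y ^+ 2)).
  by rewrite expr2 ler_pM// ltW.
by rewrite lerXn2r ?nnegrE ?mulr_ge0 ?VQ ?V0//; exact: le_trans ler01 Q1.
Qed.

End truncation.


(** * Markov semigroups on a discrete space *)

Section mean.
Context (R : realType) (d : measure_display) (S : measurableType d).
Hypothesis discrete : forall A : set S, measurable A.
Implicit Types (mu : {measure set S -> \bar R}) (f h : S -> R).

Definition bounded_by f (M : R) := forall x, `|f x| <= M.
(** A bound for the functions themselves; everything is measurable because the space is
    discrete. *)
Definition bdd f := exists M, bounded_by f M.
Definition mean mu f : R := \int[mu]_x f x.

Lemma discrete_measurable_fun d' (T : measurableType d') (f : S -> T) : measurable_fun setT f.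
Proof. by move=> _ A _; exact: discrete. Qed.

Lemma bddP f : bdd f -> bounded_fun f.
Proof.
move=> [M fM]; exists `|M|; split; first exact: num_real.
by move=> y My x _ /=; rewrite (le_trans (fM x))// (le_trans (ler_norm _)) ?ltW.
Qed.

Lemma bdd_cst c : bdd (fun=> c). Proof. by exists `|c| => x. Qed.
Lemma bddD f h : bdd f -> bdd h -> bdd (fun x => f x + h x).
Proof.
by move=> [M fM] [M' hM]; exists (M + M') => x; rewrite (le_trans (ler_normD _ _))// lerD.
Qed.
Lemma bddM f h : bdd f -> bdd h -> bdd (fun x => f x * h x).
Proof. by move=> [M fM] [M' hM]; exists (M * M') => x; rewrite normrM ler_pM. Qed.
Lemma bddZ c f : bdd f -> bdd (fun x => c * f x).
Proof. exact/bddM/bdd_cst. Qed.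
Lemma bddN f : bdd f -> bdd (fun x => - f x).
Proof. by move=> [M fM]; exists M => x; rewrite normrN. Qed.
Lemma bddB f h : bdd f -> bdd h -> bdd (fun x => f x - h x).
Proof. by move=> bf /bddN; exact: bddD. Qed.
Lemma bdd_sum (I : Type) (s : seq I) (F : I -> S -> R) : (forall i, bdd (F i)) ->
  bdd (fun x => \sum_(i <- s) F i x).
Proof.
move=> bF; elim: s => [|i s IH].
  by under eq_fun do rewrite big_nil; exact: bdd_cst.
by under eq_fun do rewrite big_cons; exact: bddD.
Qed.
Lemma bdd_comp f (m : S -> S) : bdd f -> bdd (f \o m).
Proof. by move=> [M fM]; exists M => x; exact: fM. Qed.

Section probability_mean.
Context mu.
Hypothesis mu1 : mu setT = 1%E.

Lemma bdd_integrable f : bdd f -> mu.-integrable setT (EFin \o f).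
Proof.
move=> /bddP bf; apply: measurable_bounded_integrable => //.
  by rewrite mu1 ltry.
Qed.

Lemma meanE f : bdd f -> (\int[mu]_x (f x)%:E)%E = (mean mu f)%:E.
Proof.
move=> bf; rewrite /mean /Rintegral fineK//.
exact: integrable_fin_num (bdd_integrable bf).
Qed.

Lemma meanD f h : bdd f -> bdd h -> mean mu (fun x => f x + h x) = mean mu f + mean mu h.
Proof. by move=> bf bh; rewrite /mean RintegralD//; exact: bdd_integrable. Qed.

Lemma meanZ c f : bdd f -> mean mu (fun x => c * f x) = c * mean mu f.
Proof. by move=> bf; rewrite /mean RintegralZl//; exact: bdd_integrable. Qed.

Lemma meanN f : bdd f -> mean mu (fun x => - f x) = - mean mu f.
Proof.
by move=> bf; rewrite -mulN1r -meanZ//; congr mean; apply/funext => x; rewrite mulN1r.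
Qed.

Lemma meanB f h : bdd f -> bdd h -> mean mu (fun x => f x - h x) = mean mu f - mean mu h.
Proof. by move=> bf bh; rewrite /mean RintegralB//; exact: bdd_integrable. Qed.

Lemma mean_cst c : mean mu (fun=> c) = c.
Proof. by rewrite /mean Rintegral_cst// mu1 mulr1. Qed.

Lemma mean_sum (I : Type) (s : seq I) (F : I -> S -> R) : (forall i, bdd (F i)) ->
  mean mu (fun x => \sum_(i <- s) F i x) = \sum_(i <- s) mean mu (F i).
Proof.
move=> bF; elim: s => [|i s IH].
  by under eq_fun do rewrite big_nil; rewrite big_nil mean_cst.
by under eq_fun do rewrite big_cons; rewrite big_cons meanD ?IH//; exact: bdd_sum.
Qed.

Lemma le_mean f h : bdd f -> bdd h -> (forall x, f x <= h x) -> mean mu f <= mean mu h.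
Proof. by move=> bf bh fh; apply: le_Rintegral => //; exact: bdd_integrable. Qed.

Lemma mean_norm f h : bdd f -> bdd h -> (forall x, `|f x| <= h x) -> `|mean mu f| <= mean mu h.
Proof.
move=> bf bh fh; have F x : - h x <= f x <= h x by rewrite -ler_norml.
rewrite ler_norml -meanN// (le_mean (bddN bh) bf) ?(le_mean bf bh)// => x.
  by case/andP: (F x).
by case/andP: (F x).
Qed.

End probability_mean.

Section semigroup.
Context (K : R -> R.-pker S ~> S) (L : (S -> R) -> S -> R).
Hypotheses (semi : markov_semigroup K) (gen : semigroup_generator K L).

Lemma kernel1 t x : K t x setT = 1%E. Proof. exact: prob_kernel. Qed.

Lemma chapman_kolmogorov s t x (f : S -> \bar R) : 0 <= s -> 0 <= t -> (forall y, 0 <= f y)%E ->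
  (\int[K (s + t) x]_y f y = \int[K s x]_y \int[K t y]_z f z)%E.
Proof.
move=> s0 t0 f0.
rewrite -(@integral_kcomp _ _ _ S S S R (K s) (kernel.kernel_snd (K t)) x f f0); last first.
  exact: discrete_measurable_fun.
by apply: eq_measure_integral => A mA _; exact: semi.2.
Qed.

(** The Chapman-Kolmogorov equation is available for nonnegative functions; a bounded
    function becomes one after adding a constant. *)
Lemma mean_semigroup s t x f : 0 <= s -> 0 <= t -> bdd f ->
  mean (K (s + t) x) f = mean (K s x) (fun y => mean (K t y) f).
Proof.
move=> s0 t0 bf; have [M fM] := bf.
have bm h : bdd h -> bdd (fun y => mean (K t y) h).
  move=> bh; have [M' hM] := bh; exists M' => y; rewrite (le_trans (mean_norm _ bh (bdd_cst M') hM))//.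
    exact: kernel1.
  by rewrite mean_cst// kernel1.
suff nonneg h : (forall y, 0 <= h y) -> bdd h ->
    mean (K (s + t) x) h = mean (K s x) (fun y => mean (K t y) h).
  have bM := bdd_cst M; have hD := bddD bf bM.
  have fM0 y : 0 <= f y + M by have := fM y; rewrite ler_norml => /andP[]; lra.
  have := nonneg _ fM0 hD; rewrite (meanD (kernel1 _ _) bf bM) (mean_cst (kernel1 _ _)).
  have -> : (fun y => mean (K t y) (fun x => f x + M)) = (fun y => mean (K t y) f + M).
    by apply/funext => y; rewrite (meanD (kernel1 _ _) bf bM) (mean_cst (kernel1 _ _)).
  rewrite (meanD (kernel1 _ _) (bm _ bf) bM) (mean_cst (kernel1 _ _)).
  exact: addIr.
move=> h0 bh; apply: EFin_inj; rewrite -(meanE (kernel1 _ _) bh) -(meanE (kernel1 _ _) (bm _ bh)).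
rewrite chapman_kolmogorov//.
by apply: eq_integral => y _; rewrite (meanE (kernel1 _ _) bh).
Qed.

(** The defining property of the generator, transported to positive times by the
    semigroup property: the error of one Euler step is uniform in time. *)
Lemma mean_step (x : S) f (e : R) : bdd f -> bdd (L f) -> 0 < e ->
  exists2 r : R, 0 < r & forall t h : R, 0 <= t -> 0 <= h < r ->
  `|mean (K (t + h) x) f - (mean (K t x) f + h * mean (K t x) (L f))| <= h * e.
Proof.
move=> bf bLf e0.
have [r /= r0 hr] := gen (discrete_measurable_fun f) (bddP bf) e0.
exists r => // t h t0 /andP[]; rewrite le_eqVlt => /predU1P[<- _|h0 hrr].
  by rewrite addr0 !mul0r addr0 subrr normr0.
have bKf : bdd (fun y => mean (K h y) f).
  have [M fM] := bf; exists M => y.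
  rewrite (le_trans (mean_norm (kernel1 h y) bf (bdd_cst M) fM))// mean_cst//.
  exact: kernel1.
rewrite (mean_semigroup x t0 (ltW h0) bf) -(meanZ (kernel1 t x) h bLf).
rewrite -(meanD (kernel1 t x) bf (bddZ h bLf)).
rewrite -(meanB (kernel1 t x) bKf (bddD bf (bddZ h bLf))).
rewrite -[leRHS](mean_cst (kernel1 t x)); apply: (mean_norm (kernel1 t x)).
- exact/bddB/bddD/bddZ.
- exact: bdd_cst.
move=> y; have := hr h; rewrite /= sub0r normrN gtr0_norm// => /(_ hrr h0 y).
have -> : mean (K h y) f - (f y + h * L f y) = h * ((mean (K h y) f - f y) / h - L f y).
  by field; rewrite gt_eqF.
by rewrite normrM gtr0_norm// => H; rewrite ler_pM2l.
Qed.

End semigroup.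
End mean.

(** * Comparison along Euler's scheme *)

Section dual_morphism.
Context (N k : nat) (F F' : fieldType) (phi : {rmorphism F -> F'}).
Context (q : F) (a : 'I_N -> F) (rR rL : F).
Implicit Types n : {ffun 'I_k -> 'I_N.+1}.

(** The process is real and the integrals are complex: the dual operator must be transported
    along the inclusion of the reals. *)
Lemma left_terms_morph v n : left_terms (phi q) (phi \o a) v n =
  [seq (phi cm.1, cm.2) | cm <- left_terms q a v n].
Proof.
elim: v n => [//|v IH] n.
change (((rate_at (phi \o a) v)^-1, n) ::
    [seq (phi q ^- count_eq n v * cm.1, cm.2) | cm <- left_terms (phi q) (phi \o a) v (dec v.+1 n)] =
  [seq (phi cm.1, cm.2) | cm <- ((rate_at a v)^-1, n) ::
    [seq (q ^- count_eq n v * cm.1, cm.2) | cm <- left_terms q a v (dec v.+1 n)]]).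
rewrite IH /= -!map_comp.
have -> : rate_at (phi \o a) v = phi (rate_at a v).
  by rewrite /rate_at; case: insub => //=; rewrite rmorph0.
rewrite -fmorphV; congr (_ :: _); apply: eq_map => cm /=.
by rewrite rmorphM fmorphV rmorphXn.
Qed.

Lemma dual_terms_morph n : dual_terms (phi q) (phi \o a) (phi rR) (phi rL) n =
  [seq (phi cm.1, cm.2) | cm <- dual_terms q a rR rL n].
Proof.
rewrite /dual_terms map_flatten -[in RHS]map_comp; congr flatten; apply: eq_map => v.
rewrite [RHS]/comp fun_if; case: ifP => // _; rewrite left_terms_morph map_cat -!map_comp.
congr (_ ++ _).
  by rewrite /= !rmorphM rmorphB rmorph1 rmorphXn rmorphN1.
by apply: eq_map => cm /=; rewrite !rmorphM rmorphB rmorph1 fmorphV rmorphXn.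
Qed.

End dual_morphism.

Section gronwall.
Context (R : realType) (I : Type) (P : I -> Prop) (y : nat -> I -> R).
Context (c e b0 t : R) (m : nat).
Hypotheses (c0 : 0 <= c) (e0 : 0 <= e) (b00 : 0 <= b0) (t0 : 0 <= t).
Hypothesis init : forall i, P i -> y 0 i <= b0.
Hypothesis incr : forall j b, (j < m)%N -> 0 <= b -> (forall i, P i -> y j i <= b) ->
  forall i, P i -> y j.+1 i <= (1 + t / m%:R * c) * b + t / m%:R * e.

(** The recursion is stated through bounds uniform over the indices in [P], because the value
    at one state involves the neighbouring ones. *)
Lemma discrete_gronwall j i : (j <= m)%N -> P i -> y j i <= expR (t * c) * (b0 + t * e).
Proof.
case: (posnP m) => [m0|m0].
  rewrite m0 leqn0 => /eqP -> /init /le_trans; apply.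
  apply: (@le_trans _ _ (b0 + t * e)); first by rewrite lerDl mulr_ge0.
  rewrite ler_peMl ?addr_ge0 ?mulr_ge0//.
  by rewrite (le_trans _ (expR_ge1Dx _))// lerDl mulr_ge0.
have h0 : 0 <= t / m%:R by rewrite divr_ge0.
have hc0 : 0 <= t / m%:R * c by rewrite mulr_ge0.
have c1 : 1 <= 1 + t / m%:R * c by rewrite lerDl.
have H l : (l <= m)%N -> forall i, P i ->
    y l i <= (1 + t / m%:R * c) ^+ l * (b0 + l%:R * (t / m%:R * e)).
  elim: l => [_ i' Pi'|l IH lm i' Pi']; first by rewrite expr0 mul0r addr0 mul1r init.
  rewrite (le_trans (incr lm _ (IH (ltnW lm)) Pi'))//.
    by rewrite mulr_ge0 ?exprn_ge0 ?addr_ge0 ?mulr_ge0.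
  rewrite mulrA -exprS -natr1 [in leRHS]mulrDl mul1r addrA [leRHS]mulrDr lerD2l.
  by rewrite ler_peMl ?mulr_ge0// exprn_ege1.
move=> jm Pi; rewrite (le_trans (H _ jm _ Pi))// ler_pM//.
- by rewrite exprn_ge0// addr_ge0.
- by rewrite addr_ge0// mulr_ge0// mulr_ge0.
- have E : t * c = m%:R * (t / m%:R * c) by field; rewrite pnatr_eq0 -lt0n.
  rewrite E expRM_natl (@le_trans _ _ ((1 + t / m%:R * c) ^+ m))//; first exact: ler_weXn2l.
  by rewrite lerXn2r ?nnegrE ?expR_ge0 ?addr_ge0// expR_ge1Dx.
have -> : t * e = m%:R * (t / m%:R * e) by field; rewrite pnatr_eq0 -lt0n.
by rewrite lerD2l ler_wpM2r ?mulr_ge0// ler_nat.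
Qed.

End gronwall.

Section process_moments.
Context (R : realType) (N k : nat) (q : R) (a : 'I_N -> R) (rR rL : R).
Hypotheses (q01 : 0 < q < 1) (a0 : forall i, 0 < a i) (rR0 : 0 <= rR) (rL0 : 0 <= rL).
Hypothesis N0 : (0 < N)%N.
Context (K : R -> R.-pker (config N) ~> (config N)).
Hypotheses (semi : markov_semigroup K) (gen : semigroup_generator K (qPushASEP_generator q a rR rL)).
Implicit Types n : {ffun 'I_k -> 'I_N.+1}.

Local Notation S := (config N).
Local Notation L := (qPushASEP_generator q a rR rL).
Local Notation Q := (q^-1 ^+ k).
Local Notation total_rate := (\sum_c max_rate a rR rL c).
Local Notation growth := (total_rate * Q ^+ 2).
Local Notation V := (@dominant R N q k).
Local Notation E t := (mean (K t (step N))).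

Lemma near_quotient_small (t r : R) : 0 <= t -> 0 < r -> \forall m \near \oo, t / m%:R < r.
Proof.
move=> t0 r0; exists (Num.bound (t / r)).+1 => //= m Bm.
have m0 : (0 : R) < m%:R by rewrite ltr0n (leq_ltn_trans _ Bm).
rewrite ltr_pdivrMr// mulrC -ltr_pdivrMr// (lt_trans (archi_boundP _))// ?divr_ge0 ?(ltW r0)//.
by rewrite ltr_nat.
Qed.

Lemma config_discrete (A : set S) : measurable A. Proof. by []. Qed.

Lemma generator_jump f : L f = jump_generator (@move_rate R N q a rR rL) (@move N) f.
Proof. by apply/funext => x; exact: generatorE. Qed.

Lemma bdd_generator f : bdd f -> bdd (L f).
Proof.
move=> bf; rewrite generator_jump; apply: bdd_sum => c; apply: bddM.
  exists (max_rate a rR rL c) => x.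
  by have /andP[r0 r1] := move_rate_bound q01 a0 rR0 rL0 c x; rewrite ger0_norm.
by apply: bddB => //; exact: (bdd_comp (move c) bf).
Qed.

Lemma mean_start f : E 0 f = f (step N).
Proof.
have h : {measure set S -> \bar R} := \d_(step N).
rewrite /mean /Rintegral (eq_measure_integral (\d_(step N))) => [|A mA _].
  by rewrite integral_dirac// diracT mul1e.
exact: semi.1.
Qed.

Lemma qpos_step v : (0 < v <= N)%N -> qpos q (step N) v = 1.
Proof.
case: v => // v /= vN; rewrite (qposS _ _ (Ordinal vN)) /= ffunE.
by rewrite addNr expr0z.
Qed.

Let Q1 : 1 <= Q.
Proof. by rewrite exprn_ege1// invf_ge1//; case/andP: q01 => // q0 /ltW. Qed.

Let rate_ge0 : 0 <= total_rate.
Proof. by apply: sumr_ge0 => c _; exact: max_rate_ge0. Qed.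

Let growth_ge0 : 0 <= growth.
Proof. by rewrite mulr_ge0// sqr_ge0. Qed.

Section cutoff.
Context (A t : R).
Hypotheses (A1 : 1 <= A) (t0 : 0 <= t).
Local Notation W := (truncated V A).
Local Notation chi := (cutoff V A).
Local Notation f n := (fun x => observable q n x * chi x).

Let Apos : 0 < A. Proof. by rewrite (lt_le_trans ltr01). Qed.

Lemma bdd_truncated : bdd W.
Proof.
exists (A ^+ 2) => x; have /andP[w0 w1] := truncated_bound (dominant_ge0 q01 k) A1 x.
by rewrite ger0_norm.
Qed.

Lemma cutoff_observable_bound n x : 0 <= f n x <= A.
Proof.
rewrite /cutoff; case: ifP => VA; rewrite ?mulr1 ?mulr0 ?lexx ?(ltW Apos)//.
by rewrite observable_ge0// (le_trans (observable_le q01 n x)).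
Qed.

Lemma bdd_cutoff_observable n : bdd (f n).
Proof. by exists A => x; have /andP[? ?] := cutoff_observable_bound n x; rewrite ger0_norm. Qed.

(** Gronwall's inequality for [truncated_generator].  The truncated function is [1] at the
    step configuration, hence a bound which does not depend on [A]. *)
Lemma mean_truncated : \forall m \near \oo, forall j, (j <= m)%N ->
  E (j%:R * (t / m%:R)) W <= expR (t * growth) * (1 + t).
Proof.
have bW := bdd_truncated; have bLW := bdd_generator bW.
have [r r0 hr] := mean_step config_discrete semi gen (step N) bW bLW ltr01.
near=> m => j jm.
have h0 : 0 <= t / m%:R by rewrite divr_ge0.
have hr' : t / m%:R < r.
  by near: m; exact: near_quotient_small.
rewrite -[X in 1 + X]mulr1.
apply: (@discrete_gronwall R unit (fun=> True) (fun j _ => E (j%:R * (t / m%:R)) W) growth 1 1 t m _ _ _ _ _ _ j tt) => //.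
- move=> _ _; rewrite mul0r mean_start /truncated /dominant qpos_step ?N0//=.
  by rewrite expr1n min_l// expr1n.
move=> l b lm b0 /(_ tt I) bl _ _.
have lh0 : 0 <= l%:R * (t / m%:R) by rewrite mulr_ge0.
have := hr _ (t / m%:R) lh0; rewrite h0 hr' => /(_ isT).
rewrite -natr1 mulrDl mul1r ler_norml => /andP[_]; rewrite lerBlDl => H'.
have LW : E (l%:R * (t / m%:R)) (L W) <= growth * E (l%:R * (t / m%:R)) W.
  rewrite -(meanZ config_discrete (kernel1 K _ _) _ bW).
  apply: (le_mean config_discrete (kernel1 K _ _) bLW (bddZ _ bW)) => x.
  rewrite generator_jump.
  exact: (truncated_generator (move_rate_bound q01 a0 rR0 rL0) (dominant_ge0 q01 k) Q1 (dominant_move q01 k) A1).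
have Wb := bl.
apply: (le_trans H'); rewrite mulr1.
have := ler_wpM2l h0 LW; have := ler_wpM2l (mulr_ge0 h0 growth_ge0) Wb; rewrite -mulrA.
move: (growth) => gr; move: (E (l%:R * (t / m%:R)) W) (E (l%:R * (t / m%:R)) (L W)) (t / m%:R) Wb => w lw h Wb H1 H2.
lra.
Unshelve. all: end_near.
Qed.

(** The cut-off commutes with the generator except at moves across the level [A], which
    [cutoff_generator] controls. *)
Lemma mean_generator n s : 0 <= s -> sorted_state n ->
  `|E s (L (f n)) - dual q a rR rL (fun m => E s (f m)) n| <= growth / A * E s W.
Proof.
move=> s0 sn.
have bf := bdd_cutoff_observable; have bW := bdd_truncated.
rewrite -(meanZ config_discrete (kernel1 K _ _) _ bW).
have -> : dual q a rR rL (fun m => E s (f m)) n = E s (fun x => chi x * L (observable q n) x).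
  under [X in mean _ X]eq_fun do rewrite (generator_observable q01 a rR rL _ sn) /dual /apply_terms mulr_sumr.
  rewrite (mean_sum config_discrete (kernel1 K _ _)).
    apply: eq_bigr => cm _; rewrite -(meanZ config_discrete (kernel1 K _ _) _ (bf _)).
    by congr mean; apply/funext => x; ring.
  move=> cm; rewrite (_ : (fun x => _) = (fun x => cm.1 * (observable q cm.2 x * chi x))).
    exact: bddZ.
  by apply/funext => x; ring.
have bL := bdd_generator (bf n).
have bchi : bdd (fun x => chi x * L (observable q n) x).
  have [M fM] := bdd_sum (dual_terms q a rR rL n) (fun cm => bddZ cm.1 (bf cm.2)).
  exists M => x; have := fM x; rewrite (generator_observable q01 a rR rL _ sn) /dual /apply_terms mulr_sumr.
  by congr (`|_| <= _); apply: eq_bigr => cm _; ring.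
rewrite -(meanB config_discrete (kernel1 K _ _) bL bchi).
apply: (mean_norm config_discrete (kernel1 K _ _) (bddB bL bchi) (bddZ _ bW)) => x.
rewrite !generator_jump.
apply: (cutoff_generator (move_rate_bound q01 a0 rR0 rL0) (dominant_ge0 q01 k) Q1 (dominant_move q01 k) A1).
by move=> y; rewrite observable_ge0// observable_le.
Qed.

Definition dual_norm : R :=
  \sum_(n : {ffun 'I_k -> 'I_N.+1}) \sum_(cm <- dual_terms q a rR rL n) `|cm.1|.

Lemma dual_norm_ge0 : 0 <= dual_norm.
Proof. by apply: sumr_ge0 => n _; exact: sumr_ge0. Qed.

Lemma le_dual_norm n : \sum_(cm <- dual_terms q a rR rL n) `|cm.1| <= dual_norm.
Proof.
rewrite /dual_norm (bigD1 n)//= lerDl; apply: sumr_ge0 => n' _; exact: sumr_ge0.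
Qed.

Local Notation dualC := (dual q%:C (fun i => (a i)%:C) rR%:C rL%:C).

Lemma dual_complex (h : {ffun 'I_k -> 'I_N.+1} -> R[i]) n :
  dualC h n = \sum_(cm <- dual_terms q a rR rL n) cm.1%:C * h cm.2.
Proof.
rewrite /dual /apply_terms (dual_terms_morph (real_complex R) q a rR rL n).
by rewrite big_map.
Qed.

Definition error_constant : R :=
  expR (t * dual_norm) * (t * (1 + growth * (expR (t * growth) * (1 + t)))).

(** The one-step error has two parts, of order [A ^- 1] each after division by the mesh: the
    error of the generator approximation, where [A ^- 1] is taken as precision, and that of
    the cut-off.  Gronwall's inequality sums them up over the [m] steps. *)
Lemma mean_scheme (G : nat -> nat -> {ffun 'I_k -> 'I_N.+1} -> R[i]) :
  (forall m n, sorted_state n ->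
    G m 0%N n = prod_state (fun v => if v == 0%N then 0 else 1) n) ->
  (forall m j n, sorted_state n ->
    G m j.+1 n = G m j n + (t / m%:R)%:C * dualC (G m j) n) ->
  \forall m \near \oo, forall n, sorted_state n ->
    cnorm ((E t (f n))%:C - G m m n) <= error_constant / A.
Proof.
move=> G0 GS; set M := expR (t * growth) * (1 + t).
have M0 : 0 <= M by rewrite mulr_ge0 ?expR_ge0 ?addr_ge0.
have bf := bdd_cutoff_observable.
have near_step : \forall m \near \oo, forall n (s : R), 0 <= s ->
    `|E (s + t / m%:R) (f n) - (E s (f n) + t / m%:R * E s (L (f n)))| <= t / m%:R * A^-1.
  apply: filter_forall => n.
  have [|r r0 hr] := mean_step config_discrete semi gen (step N) (bf n) (bdd_generator (bf n)) (e := A^-1).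
    by rewrite invr_gt0.
  near=> m => s s0; apply: hr => //; rewrite divr_ge0//=.
  by near: m; exact: near_quotient_small.
near=> m => n sn.
have h0 : 0 <= t / m%:R by rewrite divr_ge0.
have hstep : forall n (s : R), 0 <= s ->
    `|E (s + t / m%:R) (f n) - (E s (f n) + t / m%:R * E s (L (f n)))| <= t / m%:R * A^-1.
  by near: m.
have hW : forall j, (j <= m)%N -> E (j%:R * (t / m%:R)) W <= M.
  by near: m; exact: mean_truncated.
pose s j : R := j%:R * (t / m%:R).
have s0 j : 0 <= s j by rewrite mulr_ge0.
pose y j n := cnorm ((E (s j) (f n))%:C - G m j n).
have e0 : 0 <= (1 + growth * M) / A.
  by rewrite divr_ge0 ?(ltW Apos)// addr_ge0// mulr_ge0.
have m0 : (0 < m)%N by near: m; exists 1%N.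
have -> : error_constant / A = expR (t * dual_norm) * (0 + t * ((1 + growth * M) / A)).
  by rewrite /error_constant -/M add0r !mulrA.
have -> : E t (f n) = E (s m) (f n).
  by rewrite /s mulrC divfK// pnatr_eq0 -lt0n.
apply: (@discrete_gronwall R _ (@sorted_state N k) y dual_norm _ 0 t m _ _ _ _ _ _ m n) => //.
- exact: dual_norm_ge0.
- move=> n' sn'; rewrite /y /s mul0r mean_start G0//.
  rewrite /cutoff /dominant qpos_step ?N0 ?leqnn// expr1n A1 mulr1 /observable.
  have -> : (prod_state (qpos q (step N)) n')%:C =
      prod_state (fun v => if v == 0%N then 0 else 1) n' :> R[i].
    rewrite /prod_state rmorph_prod/=; apply: eq_bigr => p _; case: eqP => [->//|/eqP p0].
    by rewrite qpos_step// lt0n p0/= -ltnS.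
  by rewrite subrr cnorm0.
move=> l b lm b0 yb n' sn'.
rewrite /y GS// dual_complex.
set g1 := E (s l.+1) (f n'); set g2 := E (s l) (f n'); set g3 := E (s l) (L (f n')).
set g4 := dual q a rR rL (fun m => E (s l) (f m)) n'.
have -> : g1%:C - (G m l n' + (t / m%:R)%:C * \sum_(cm <- dual_terms q a rR rL n') cm.1%:C * G m l cm.2) =
    (g1 - (g2 + t / m%:R * g3))%:C + (t / m%:R)%:C * (g3 - g4)%:C + (g2%:C - G m l n') +
    (t / m%:R)%:C * \sum_(cm <- dual_terms q a rR rL n') cm.1%:C * ((E (s l) (f cm.2))%:C - G m l cm.2).
  have -> : \sum_(cm <- dual_terms q a rR rL n') cm.1%:C * ((E (s l) (f cm.2))%:C - G m l cm.2) =
      g4%:C - \sum_(cm <- dual_terms q a rR rL n') cm.1%:C * G m l cm.2.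
    rewrite /g4 /dual /apply_terms rmorph_sum/= -sumrB; apply: eq_bigr => cm _.
    by rewrite mulrBr rmorphM.
  rewrite !(rmorphB, rmorphD, rmorphM)/=; ring.
have H1 : cnorm (g1 - (g2 + t / m%:R * g3))%:C <= t / m%:R * A^-1.
  by rewrite cnormR; have := hstep n' _ (s0 l); rewrite /g1 /s -natr1 mulrDl mul1r.
have H2 : cnorm ((t / m%:R)%:C * (g3 - g4)%:C) <= t / m%:R * (growth / A * M).
  rewrite cnormM !cnormR ger0_norm// ler_wpM2l// (le_trans (mean_generator (s0 l) sn'))//.
  by rewrite ler_wpM2l ?hW ?(ltnW lm)// divr_ge0// ltW.
have H3 := yb n' sn'.
have H4 : cnorm ((t / m%:R)%:C * \sum_(cm <- dual_terms q a rR rL n')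
    cm.1%:C * ((E (s l) (f cm.2))%:C - G m l cm.2)) <= t / m%:R * (dual_norm * b).
  rewrite cnormM cnormR ger0_norm// ler_wpM2l// (le_trans (cnorm_sum _ _ _))//.
  apply: le_trans (ler_wpM2r b0 (le_dual_norm n')); rewrite mulr_suml !big_seq; apply: ler_sum => cm cmn.
  by rewrite cnormM cnormR ler_wpM2l// yb// (allP (dual_terms_sorted q a rR rL sn')).
rewrite (le_trans (cnormD _ _))// (le_trans (lerD (cnormD _ _) (lexx _)))//.
rewrite (le_trans (lerD (lerD (cnormD _ _) (lexx _)) (lexx _)))//.
rewrite (le_trans (lerD (lerD (lerD H1 H2) H3) H4))//.
rewrite le_eqVlt; apply/orP; left; apply/eqP; ring.
Unshelve. all: end_near.
Qed.

End cutoff.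
End process_moments.

(** * From the cut-off moments to the expectation *)

Section cutoff_removal.
Context (R : realType) (d : measure_display) (S : measurableType d).
Hypothesis discrete : forall A : set S, measurable A.
Context (mu : {measure set S -> \bar R}) (V f : S -> R) (Z : R[i]) (c : R).
Hypotheses (mu1 : mu setT = 1%E) (fV : forall x, 0 <= f x <= V x).
Hypothesis approx : forall A, 1 <= A ->
  cnorm ((mean mu (fun x => f x * cutoff V A x))%:C - Z) <= c / A.

(** Monotone convergence along the levels [A = 1, 2, ...]. *)
Lemma cutoff_integral :
  (\int[mu]_x (f x)%:E)%E = (complex.Re Z)%:E /\ Z = (complex.Re Z)%:C.
Proof.
pose A (p : nat) : R := p.+1%:R.
have A1 p : 1 <= A p by rewrite ler1n.
have Apos p : 0 < A p by rewrite ltr0n.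
pose e p := mean mu (fun x => f x * cutoff V (A p) x).
have fc p x : 0 <= f x * cutoff V (A p) x.
  by rewrite mulr_ge0 ?(andP (fV x)).1// /cutoff; case: ifP.
have Aoo (r : R) : \forall p \near \oo, r <= A p.
  exists (Num.bound `|r|) => // p /= rp; rewrite (le_trans (ler_norm r))// ltW//.
  by rewrite (lt_le_trans (archi_boundP _))// ler_nat leqW.
have small (r : R) : 0 < r -> \forall p \near \oo, c / A p <= r.
  move=> r0; near=> p; rewrite ler_pdivrMr// mulrC -ler_pdivrMr//.
  by near: p; exact: Aoo.
have ImZ : complex.Im Z = 0.
  apply/eqP; rewrite -normr_le0; apply/ler_addgt0Pr => r r0; rewrite add0r.
  have [p _ /(_ p (leqnn p)) /= hp] := small r r0.
  apply: le_trans hp; apply: le_trans (approx (A1 p)).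
  by apply: le_trans (cnorm_Im _); rewrite raddfB/= sub0r normrN.
have ZE : Z = (complex.Re Z)%:C by rewrite [LHS]complexE ImZ mulr0 addr0.
split=> //.
have cvgRe : (e p)%:E @[p --> \oo] --> (complex.Re Z)%:E.
  apply: cvg_EFin; first exact: nearW.
  apply/cvgrPdist_le => r r0; near=> p.
  have hp : c / A p <= r by near: p; exact: small.
  rewrite distrC (le_trans _ hp)// (le_trans _ (approx (A1 p)))//.
  by rewrite (le_trans _ (cnorm_Re _))// raddfB.
have lim_f x : limn (fun p => (f x * cutoff V (A p) x)%:E) = (f x)%:E.
  apply/cvg_lim => //; apply: cvg_near_cst; near=> p.
  rewrite /cutoff ifT ?mulr1//; near: p; exact: Aoo.
have nd x : nondecreasing_seq (fun p => (f x * cutoff V (A p) x)%:E).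
  move=> p p' pp'; rewrite lee_fin ler_wpM2l ?(andP (fV x)).1// /cutoff.
  case: ifP => Vp; last by case: ifP.
  by rewrite ifT// (le_trans Vp)// ler_nat.
have meas p : measurable_fun setT (fun x => (f x * cutoff V (A p) x)%:E).
  exact: discrete_measurable_fun.
have := @cvg_monotone_convergence _ _ R mu setT measurableT _ meas (fun p x _ => fc p x) (fun x _ => nd x).
under [X in _ --> X -> _]eq_integral do rewrite lim_f.
have -> : (fun p => \int[mu]_x (f x * cutoff V (A p) x)%:E)%E = (fun p => (e p)%:E).
  apply/funext => p; rewrite meanE//; exists (A p) => x.
  rewrite ger0_norm// /cutoff; case: ifP => VA; last by rewrite mulr0 ltW.
  by rewrite mulr1 (le_trans (andP (fV x)).2).
by move=> h; exact: cvg_unique h cvgRe.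
Unshelve. all: end_near.
Qed.

End cutoff_removal.

Section law.
Context (R : realType) (dS d : measure_display) (S : measurableType dS) (T : measurableType d).
Context (P : probability T R) (X : R -> {mfun T >-> S}) (K : R -> R.-pker S ~> S) (x0 : S).
Hypotheses (start : {ae P, forall w, X 0 w = x0}) (markov : markov_property P X K).

(** The Markov property at time [0], where the process is at [x0] almost surely. *)
Lemma law_kernel t B : 0 <= t -> measurable B -> P (X t @^-1` B) = K t x0 B.
Proof.
move=> t0 mB; have hT : history X 0 setT.
  rewrite -[setT]setC0 -setTD; apply: sigma_algebraCD; exact: sigma_algebra0.
have := markov (lexx 0) t0 hT mB; rewrite setTI add0r => ->.
rewrite (@ae_eq_integral _ _ _ P setT (fun=> K t x0 B))//.
- by rewrite integral_cst// -[RHS]mule1; congr (_ * _)%E; exact: probability_setT.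
- by apply: (@measurableT_comp _ _ _ _ _ _ (fun x => K t x B)) => //; exact: measurable_kernel.
by apply: filterS start => w -> _.
Qed.

Lemma expectation_kernel t (f : S -> \bar R) : 0 <= t -> measurable_fun setT f ->
  (forall x, 0 <= f x)%E -> (\int[P]_w f (X t w) = \int[K t x0]_x f x)%E.
Proof.
move=> t0 mf f0.
have -> : (\int[P]_w f (X t w) = \int[pushforward P (X t)]_x f x)%E.
  by rewrite ge0_integral_pushforward.
by apply: eq_measure_integral => A mA _; exact: law_kernel.
Qed.

End law.

Section moment_formula.
Context (R : realType) (N k : nat) (q : R) (a : 'I_N -> R) (rR rL : R).
Hypotheses (q01 : 0 < q < 1) (a0 : forall i, 0 < a i) (rR0 : 0 <= rR) (rL0 : 0 <= rL).
Hypothesis N0 : (0 < N)%N.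
Context (g : 'I_k -> R -> R[i]^o).
Hypothesis hg : nested_contours q a g.
Local Notation state := {ffun 'I_k -> 'I_N.+1}.

Definition moment_formula (t : R) (n : state) : R[i] :=
  prefactor k q * state_integral q a g n (fun z => cexp (t%:C * total_weight q rR rL z)).

Lemma Pi_quotient t (z : R[i]) :
  Pi_ rR rL t (q%:C * z) / Pi_ rR rL t z = cexp (t%:C * weight q rR rL z).
Proof.
rewrite /Pi_ -cexpN -cexpD; congr cexp.
by rewrite /weight invfM; ring.
Qed.

Lemma moment_formulaE t n : moment_formula t n =
  (-1) ^+ k * q%:C ^+ ((k * k.-1)./2) / (2%:R * pi%:C * 'i%C) ^+ k *
  iterated_contour_integral g (fun z =>
      (\prod_(A < k) \prod_(B < k | (A < B)%N)
         ((z A - z B) / (z A - q%:C * z B))) *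
      \prod_(j < k)
        ((\prod_(i < N | (i < n j)%N) ((a i)%:C / ((a i)%:C - z j))) *
         (Pi_ rR rL t (q%:C * z j) / Pi_ rR rL t (z j)) / z j)).
Proof.
rewrite /moment_formula /prefactor /state_integral /moment_integral iterated_contour_integralE.
congr (_ * iter_functional _ _); apply/funext => z.
rewrite /integrand cross_double -mulrA; congr (_ * _).
rewrite /total_weight mulr_sumr cexp_sum -big_split/=; apply: eq_bigr => j _.
by rewrite Pi_quotient /phi mulrAC.
Qed.

Context (K : R -> R.-pker (config N) ~> (config N)).
Hypotheses (semi : markov_semigroup K) (gen : semigroup_generator K (qPushASEP_generator q a rR rL)).

(** Euler's scheme is within a multiple of [A ^- 1] of both the cut-off moment and the integral formula. *)
Lemma kernel_moment t (n : state) : 0 <= t -> sorted_state n ->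
  (\int[K t (step N)]_x (observable q n x)%:E)%E = (complex.Re (moment_formula t n))%:E /\
  moment_formula t n = (complex.Re (moment_formula t n))%:C.
Proof.
move=> t0 sn.
apply: (@cutoff_integral R _ (config N) (@config_discrete N) (K t (step N)) (@dominant R N q k)
  (observable q n) _ (@error_constant R N k q a rR rL t + 1)) => [|x|A A1].
- exact: kernel1.
- by rewrite observable_ge0// observable_le.
have Apos : 0 < A by rewrite (lt_le_trans ltr01).
have [D D0 hD] := euler_limit rR rL hg t n.
have hS := mean_scheme q01 a0 rR0 rL0 N0 semi gen A1 t0
  (fun m n => euler_init rR rL q01 a0 N0 hg (t / m%:R)%:C (n := n))
  (fun m j n => euler_step rR rL q01 a0 hg (t / m%:R)%:C j (n := n)).
have Ainv : 0 < A^-1 by rewrite invr_gt0.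
have [m _ /(_ m (leqnn m)) /= [/(_ n sn) h1 [h2 h3]]] :=
  filterI hS (filterI hD (near_quotient_small D0 Ainv)).
set x1 := (X in cnorm (X - _)); rewrite mulrDl mul1r.
rewrite -[x1](subrK (euler_moment q a rR rL g (t / m%:R)%:C m n)) -addrA.
rewrite (le_trans (cnormD _ _))// lerD//.
exact: le_trans h2 (ltW h3).
Qed.

End moment_formula.

Theorem theorem1p2 (R : realType) (N k : nat) (q : R) (a : 'I_N -> R)
    (rR rL : R)
    (hN : (1 <= N)%N) (hk : (1 <= k)%N) (hq : 0 < q < 1)
    (ha : forall i, 0 < a i) (hR : 0 <= rR) (hL : 0 <= rL)
    (hRL : ~ (rR = 0 /\ rL = 0))
    (d : measure_display) (T : measurableType d) (P : probability T R)
    (X : R -> {mfun T >-> config N})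
    (hX : markov_jump_process P (qPushASEP_generator q a rR rL) (step N) X)
    (g : 'I_k -> R -> R[i]^o) (hg : nested_contours q a g)
    (n : 'I_k -> nat) (hnN : forall j, (n j <= N)%N)
    (hn : forall i j : 'I_k, (i <= j)%N -> (n j <= n i)%N)
    (t : R) (ht : 0 <= t) :
  let E := ('E_P[fun w => (\prod_(i < k)
              qpow q (particle (X t w) (n i) + (n i)%:Z%:E)%E)%R])%E in
  E \is a fin_num /\
  (fine E)%:C =
    (-1) ^+ k * q%:C ^+ ((k * k.-1)./2) / (2%:R * pi%:C * 'i%C) ^+ k *
    iterated_contour_integral g (fun z =>
      (\prod_(A < k) \prod_(B < k | (A < B)%N)
         ((z A - z B) / (z A - q%:C * z B))) *
      \prod_(j < k)
        ((\prod_(i < N | (i < n j)%N) ((a i)%:C / ((a i)%:C - z j))) *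
         (Pi_ rR rL t (q%:C * z j) / Pi_ rR rL t (z j)) / z j)).
Proof.
move=> E; have [start _ [K [semi gen markov]]] := hX.
pose m : {ffun 'I_k -> 'I_N.+1} := [ffun j => inord (n j)].
have mE j : m j = n j :> nat by rewrite ffunE inordK// ltnS.
have sm : sorted_state m.
  by apply/forallP => i; apply/forallP => j; apply/implyP => ij; rewrite !mE hn.
have EE : E = (complex.Re (moment_formula q a rR rL g t m))%:E.
  have [<- _] := kernel_moment hq ha hR hL hN hg semi gen ht sm.
  rewrite /E unlock -(expectation_kernel start markov ht).
  - by apply: eq_integral => w _; congr (_%:E); apply: eq_bigr => j _; rewrite mE.
  - exact: discrete_measurable_fun.
  - by move=> x; rewrite lee_fin observable_ge0.
rewrite EE; split=> //=.
have [_ <-] := kernel_moment hq ha hR hL hN hg semi gen ht sm.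
rewrite moment_formulaE; congr (_ * iterated_contour_integral _ _); apply/funext => z.
by congr (_ * _); apply: eq_bigr => j _; rewrite mE.
Qed.
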